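(* Fix $\alpha\in(0,2)$, $a\in(0,1)$ and a tree $T$ with designated root $\rho$, and let $X$ be the corresponding tree-indexed $\alpha$-stable Markov chain on $T$. Then $X^0$ is a color process.
   Context: $S_\alpha(1,0,0)$ denotes the symmetric $\alpha$-stable distribution on $\mathbb{R}$ with characteristic function $\theta\mapsto e^{-|\theta|^\alpha}$. The tree-indexed $\alpha$-stable Markov chain on the rooted tree $(T,\rho)$ with parameter $a$ is the process $X=(X_v)_{v\in V(T)}$ defined as follows: $X_\rho\sim S_\alpha(1,0,0)$, and for each vertex $v\ne\rho$ with parent $v^-$ (the neighbour of $v$ on the path to $\rho$), $X_v=aX_{v^-}+(1-a^\alpha)^{1/\alpha}U_v$, where the $U_v$, $v\neq\rho$, are i.i.d. with distribution $S_\alpha(1,0,0)$ and independent of $X_\rho$. (Trees are finite or countably infinite.) A $\{0,1\}$-valued process $(Y_i)_{i\in S}$ is a color process (divide and color process) if there are $p\in[0,1]$ and a random partition $\pi$ of $S$ such that $(Y_i)$ has the same law as the process obtained by sampling $\pi$ and then, independently of $\pi$ and independently for different partition elements, assigning all elements of a partition element the value $1$ with probability $p$ and the value $0$ with probability $1-p$. For a process $X=(X_v)$, $X^0=(X^0_v)$ with $X^0_v=I(X_v>0)$. *)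

(* Defs.v *)
From HB Require Import structures.
From mathcomp Require Import all_boot all_order all_algebra.
From mathcomp Require Import all_classical all_reals all_analysis.
From mathcomp Require Import complex.

Set Implicit Arguments.
Unset Strict Implicit.
Unset Printing Implicit Defensive.

Import Order.TTheory GRing.Theory Num.Theory.
Import numFieldNormedType.Exports.

Local Open Scope classical_set_scope.
Local Open Scope ring_scope.

(* A graph is given by its adjacency relation; a cycle needs at least three
   vertices, so that an edge traversed back and forth does not count. *)
Definition is_tree (V : countType) (e : rel V) : Prop :=
  [/\ symmetric e, irreflexive e,
      forall x y : V, exists2 p : seq V, path e x p & last x p = y &
      forall c : seq V, (2 < size c)%N -> ~~ (cycle e c && uniq c)].

(* [u] is the neighbour of [v] on the simple path from [v] to [rho]; in a tree,
   every vertex other than [rho] has exactly one parent and [rho] has none. *)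
Definition is_parent (V : countType) (e : rel V) (rho v u : V) : Prop :=
  exists p : seq V,
    [/\ path e v (u :: p), uniq (v :: u :: p) & last u p = rho].

Definition char_function (R : realType) (mu : probability R R) (t : R) : R[i] :=
  Complex (Rintegral mu [set: R] (fun x => cos (t * x)))
          (Rintegral mu [set: R] (fun x => sin (t * x))).

Definition is_sym_stable (R : realType) (alpha : R) (mu : probability R R) :
  Prop :=
  forall t : R, char_function mu t = (expR (- (`|t| `^ alpha)))%:C%C.

(* Mutual independence of a family of systems of events; below it is only
   applied to sigma-algebras. *)
Definition mutually_independent (d : measure_display) (T : measurableType d)
    (R : realType) (P : probability T R) (I : eqType)
    (G : I -> set (set T)) : Prop :=
  forall (s : seq I) (A : I -> set T), uniq s ->
    (forall i, i \in s -> G i (A i)) ->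
    P (\bigcap_(i in [set` s]) A i) = (\prod_(i <- s) P (A i))%E.

(* The family [U] of innovations is extended to the root by [U rho = X rho], so
   that "the [U v], [v <> rho], are i.i.d. and independent of [X rho]" is mutual
   independence of the extended family. *)
Definition is_stable_chain (d : measure_display) (T : measurableType d)
    (R : realType) (P : probability T R) (alpha a : R)
    (V : countType) (e : rel V) (rho : V) (X : V -> {RV P >-> R}) : Prop :=
  exists U : V -> {RV P >-> R},
    [/\ U rho = X rho,
        forall v, is_sym_stable alpha (distribution P (U v)),
        mutually_independent P (fun v => g_sigma_algebra_preimage (U v)) &
        forall v u, is_parent e rho v u -> forall w : T,
          X v w = a * X u w + (1 - a `^ alpha) `^ alpha^-1 * U v w].

Arguments is_stable_chain {d T R} P alpha a {V} e rho X.

(* A partition of [S] is encoded as an equivalence relation. *)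
Definition is_random_partition (d : measure_display) (T : measurableType d)
    (S : countType) (pi : T -> rel S) : Prop :=
  (forall w, equivalence_rel (pi w)) /\
  (forall i j, measurable [set w | pi w i j]).

Definition partition_sigma_algebra (T : Type) (S : countType)
    (pi : T -> rel S) : set (set T) :=
  <<s [set A | exists i j, A = [set w | pi w i j]] >>.

(* The canonical element of the block of [i]: the first one in the enumeration
   of [S]. It depends only on the block and, unlike an arbitrary choice, is a
   measurable function of the partition. *)
Definition block_rep (S : countType) (r : rel S) (i : S) : S :=
  xget i [set j | r i j /\ forall k, r i k -> (pickle j <= pickle k)%N].

Definition process_sigma_algebra (S : Type) : set (set (S -> bool)) :=
  <<s [set E | exists i, E = [set y : S -> bool | y i]] >>.

Definition same_law (R : realType) (S : Type)
    (d : measure_display) (T : measurableType d) (P : probability T R)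
    (d' : measure_display) (T' : measurableType d') (P' : probability T' R)
    (Y : S -> T -> bool) (Z : S -> T' -> bool) : Prop :=
  forall E, process_sigma_algebra E ->
    P [set w | E (Y^~ w)] = P' [set w | E (Z^~ w)].

(* The colour of a block is [C j], where [j] is its canonical element and the
   [C j] are i.i.d. Bernoulli(p) variables independent of the partition. *)
Definition is_color_process (d : measure_display) (T : measurableType d)
    (R : realType) (P : probability T R) (S : countType)
    (Y : S -> T -> bool) : Prop :=
  (forall i, measurable_fun [set: T] (Y i)) /\
  exists (p : R) (d' : measure_display) (T' : measurableType d')
    (P' : probability T' R) (pi : T' -> rel S) (C : S -> {RV P' >-> bool}),
    [/\ 0 <= p <= 1,
        is_random_partition pi,
        forall i, distribution P' (C i) = bernoulli_prob p :> (set bool -> \bar R),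
        mutually_independent P' (fun o : option S =>
          if o is Some i then g_sigma_algebra_preimage (C i)
          else partition_sigma_algebra pi) &
        same_law P P' Y (fun i w => C (block_rep (pi w) i) w)].

(* Main.v *)
(* The only property of the stable law that matters is that it has a symmetric
   density g which is nonincreasing on [0, oo).

   Unimodality. Consider the bounded functions f such that, for every Gaussian
   weight, the cosine transform of the weighted f is nonnegative and nonincreasing
   on [0, oo). Their multipliers are stable under sums, products and bounded limits
   and contain the Gaussians. As |t|^alpha is a limit of nonnegative combinations of
   functions 1 - exp(-s t^2), the exponential series and a limit put
   exp(-|t|^alpha) in this class, and Fourier inversion yields g.

   Colouring. Let y = t + c u be the value at a vertex, where t is a times the value
   at its parent and u is the innovation. Open the edge between them with
   probability 1 - g((|y| + |t|)/c) / g(u). This vanishes when t and y have opposite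
   signs, and it is exactly the probability for which giving y the sign of the
   parent on an open edge, and a fair random sign on a closed one, leaves the law of
   the innovation unchanged, even if the sign of the parent has itself been
   resampled. Going down the tree, the chain with resampled signs has i.i.d. stable
   innovations again, hence the law of the original chain, while its signs are
   obtained by tossing one fair coin per cluster of open edges. Since the coins are
   independent of the partition into clusters, it is irrelevant whether the coin of a
   cluster is carried by its top vertex or by its canonical element. *)

(* The opening probability comes from splitting two weights. Given |t| and |y|, equal signs of t and
   y have weight proportional to g((|y| - |t|)/c), opposite signs to g((|y| + |t|)/c). Unimodality
   makes the second the smaller one. That amount of each weight is what a fair coin produces, and
   the excess of the first is carried by the open edge, as in the Edwards-Sokal coupling of the
   Ising model. The stable density has no closed form for general alpha and is accessible only
   through its characteristic function, so its monotonicity has to be read off a cosine transform.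
   The tree may be infinite, so joint densities are out of reach. Laws are compared through
   innovations instead: an independent family, even an infinite one, is determined by its marginals,
   and it is enough that each new innovation keeps its law whatever happens at the other
   vertices. *)
Require Import Defs.
From HB Require Import structures.
From mathcomp Require Import all_boot all_order all_algebra.
From mathcomp Require Import all_classical all_reals all_analysis.
From mathcomp Require Import complex measurable_realfun.
From mathcomp Require Import ring lra.
Set Implicit Arguments.
Unset Strict Implicit.
Unset Printing Implicit Defensive.
Import Order.TTheory GRing.Theory Num.Theory.
Import numFieldNormedType.Exports.
Local Open Scope classical_set_scope.
Local Open Scope ring_scope.

(** * Cosine transforms *)

Section affine.
Variable R : realType.
Notation leb := (@lebesgue_measure R).

Lemma measurable_affine (c b : R) : measurable_fun [set: R] (fun x : R => c * x + b).
Proof. by apply: measurable_funD => //; apply: measurable_funM. Qed.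

Lemma lebesgue_measure_affine (c b : R) (A : set R) : 0 < c -> measurable A ->
  (leb A = c%:E * leb ((fun x : R => c * x + b)%R @^-1` A))%E.
Proof.
move=> c0 mA.
pose aff : R -> measurableTypeR R := (fun x : R => c * x + b).
have maff : measurable_fun [set: R] aff by exact: measurable_affine.
rewrite (@lebesgue_measure_unique R (mscale (NngNum (ltW c0)) (pushforward leb aff)) _ A mA)//.
move=> X /ocitvP[->|[x /= xlt ->]]; first by rewrite !measure0.
rewrite /mscale/= /pushforward.
rewrite (_ : aff @^-1` _ = `]((x.1 - b) / c), ((x.2 - b) / c)]%classic); last first.
  apply/seteqP; split => z /=; rewrite !in_itv/= /aff ltr_pdivrMr// ler_pdivlMr//.
    by move=> /andP[? ?]; apply/andP; split; lra.
  by move=> /andP[? ?]; apply/andP; split; lra.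
rewrite !lebesgue_measure_itv/= !lte_fin xlt.
have -> : (x.1 - b) / c < (x.2 - b) / c.
  by rewrite ltr_pM2r ?invr_gt0//; lra.
rewrite -!EFinB -EFinM; congr EFin; field; exact: lt0r_neq0.
Qed.

Lemma ge0_integral_affine (c b : R) (f : R -> \bar R) : 0 < c ->
  measurable_fun [set: R] f -> (forall x, 0 <= f x)%E ->
  (\int[leb]_x f x = c%:E * \int[leb]_x f (c * x + b)%R)%E.
Proof.
move=> c0 mf f0.
pose aff : R -> measurableTypeR R := (fun x : R => c * x + b).
have maff : measurable_fun [set: R] aff by exact: measurable_affine.
rewrite (eq_measure_integral (mscale (NngNum (ltW c0)) (pushforward leb aff))); last first.
  by move=> A mA _; exact: lebesgue_measure_affine.
by rewrite ge0_integral_mscale// ge0_integral_pushforward// preimage_setT.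
Qed.

Lemma ge0_integralN (f : R -> \bar R) :
  measurable_fun [set: R] f -> (forall x, 0 <= f x)%E ->
  (\int[leb]_x f x = \int[leb]_x f (- x)%R)%E.
Proof.
move=> mf f0.
transitivity (\int[pushforward leb (-%R : R -> measurableTypeR R)]_x f x)%E.
  apply: eq_measure_integral => A mA _.
  exact/esym/lebesgue_measureN.
by rewrite ge0_integral_pushforward// preimage_setT.
Qed.
End affine.

Lemma dominated_cvgR d (T : measurableType d) (R : realType)
    (mu : {measure set T -> \bar R}) (f_ : nat -> T -> R) (f g : T -> R) :
  (forall n, measurable_fun setT (f_ n)) ->
  (forall x, f_ n x @[n --> \oo] --> f x) ->
  mu.-integrable setT (EFin \o g) -> (forall n x, `|f_ n x| <= g x) ->
  \int[mu]_x f_ n x @[n --> \oo] --> \int[mu]_x f x.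
Proof.
move=> mf cf ig fg.
have mlim : measurable_fun setT f by apply: measurable_fun_cvg mf (fun x _ => cf x).
have intf : mu.-integrable setT (EFin \o f).
  apply: (@le_integrable _ _ _ mu setT measurableT _ (EFin \o g)) => //.
    exact/measurable_EFinP.
  move=> x _ /=; rewrite lee_fin; apply: le_trans (ler_norm _).
  apply: (cvgr_to_le (cvg_norm (cf x))); exact: nearW.
apply: fine_cvg; rewrite /Rintegral fineK; last exact: integrable_fin_num.
apply: (@dominated_cvg _ _ _ mu setT measurableT (fun n x => (f_ n x)%:E) (EFin \o f) (EFin \o g)) => //.
- by move=> n; exact/measurable_EFinP.
- by move=> x _; apply: cvg_EFin; [exact: nearW|exact: cf].
- by move=> n x _ /=; rewrite lee_fin.
Qed.

Lemma integrableZR d (T : measurableType d) (R : realType)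
    (mu : {measure set T -> \bar R}) (c : R) (f : T -> R) :
  mu.-integrable setT (EFin \o f) -> mu.-integrable setT (EFin \o (fun t => c * f t)).
Proof.
move=> fi; rewrite (_ : _ \o _ = fun t => (c%:E * (EFin \o f) t)%E)//.
exact: integrableZl.
Qed.

Lemma integrableDR d (T : measurableType d) (R : realType)
    (mu : {measure set T -> \bar R}) (f g : T -> R) :
  mu.-integrable setT (EFin \o f) -> mu.-integrable setT (EFin \o g) ->
  mu.-integrable setT (EFin \o (fun t => f t + g t)).
Proof.
move=> fi gi; rewrite (_ : _ \o _ = (fun t => (EFin \o f) t + (EFin \o g) t)%E)//.
exact: integrableD.
Qed.

(** * Gaussian weights and their cosine transforms *)

Section gauss.
Variable R : realType.
Notation leb := (@lebesgue_measure R).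

(** The fundamental theorem of calculus on [-n, n], passed to the limit by dominated convergence. It
    serves as integration by parts without boundary terms. *)
Lemma Rintegral_derive0 (k k' : R -> R) :
  (forall x : R, is_derive x (1 : R) k (k' x)) -> continuous k' ->
  leb.-integrable setT (EFin \o k') ->
  k n%:R @[n --> \oo] --> 0 -> k (- n%:R) @[n --> \oo] --> 0 ->
  \int[leb]_x k' x = 0.
Proof.
move=> dk ck ik k1 k2.
have ck0 : continuous k.
  by move=> x; apply/differentiable_continuous/derivable1_diffP; have [] := dk x.
pose f_ (n : nat) := (EFin \o k') \_ (`[- n%:R, n%:R] : set R).
have mk : measurable_fun [set: R] (EFin \o k') by apply: (measurable_int leb).
have fE (n : nat) : (0 < n)%N -> (\int[leb]_x f_ n x)%E = (k n%:R - k (- n%:R))%:E.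
  move=> n0; rewrite -integral_mkcond EFinB.
  apply: continuous_FTC2 => //.
  - by rewrite gtrN// ltr0n.
  - by apply: continuous_subspaceT => x; exact: ck.
  - split.
    + by move=> x _; have [] := dk x.
    + by apply: cvg_at_right_filter; exact: ck0.
    + by apply: cvg_at_left_filter; exact: ck0.
  - by move=> x _; rewrite derive1E; apply: derive_val.
have c1 : (\int[leb]_x f_ n x)%E @[n --> \oo] --> (\int[leb]_x (EFin \o k') x)%E.
  apply: (@dominated_cvg _ _ _ leb setT measurableT f_ (EFin \o k') (fun x => `|(k' x)%:E|%E)) => //.
  - move=> n; apply/measurable_restrict => //; exact: measurable_funS mk.
  - move=> x _; apply: cvg_near_cst; near=> n.
    rewrite /f_ /patch mem_set//= in_itv/= -ler_norml.
    by near: n; exact: nbhs_infty_ger.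
  - exact: integrable_abse.
  - move=> n x _; rewrite /f_ /patch; case: ifPn => //= _.
    by rewrite normr0 lee_fin.
have c2 : (\int[leb]_x f_ n x)%E @[n --> \oo] --> 0%E.
  have : (k n%:R - k (- n%:R))%:E @[n --> \oo] --> 0%E.
    by apply: cvg_EFin; [exact: nearW|rewrite -[0](subrr 0); exact: cvgB].
  apply: cvg_trans; apply: near_eq_cvg; near=> n; rewrite fE//.
  by near: n; exact: nbhs_infty_gt.
by rewrite /Rintegral (cvg_unique _ c1 c2).
Unshelve. all: end_near. Qed.

Definition gauss_weight (s t : R) := expR (- (s * t ^+ 2)).

Lemma continuous_gauss_weight s : continuous (gauss_weight s).
Proof.
move=> t; apply: continuous_comp; last exact: continuous_expR.
apply: cvgN; apply: cvgM; [exact: cvg_cst|exact: exprn_continuous].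
Qed.

Lemma measurable_gauss_weight s : measurable_fun [set: R] (gauss_weight s).
Proof. by apply: continuous_measurable_fun; exact: continuous_gauss_weight. Qed.

Lemma gauss_weight_gt0 s t : 0 < gauss_weight s t. Proof. exact: expR_gt0. Qed.

Lemma gauss_weightD s s' t : gauss_weight (s + s') t = gauss_weight s t * gauss_weight s' t.
Proof. by rewrite /gauss_weight -expRD; congr expR; ring. Qed.

Lemma gauss_weight_le1 s t : 0 <= s -> gauss_weight s t <= 1.
Proof. by move=> s0; rewrite -expR0 ler_expR oppr_le0 mulr_ge0// sqr_ge0. Qed.

Lemma gauss_weightE s : 0 < s -> gauss_weight s = normal_fun 0 (Num.sqrt (2 * s)^-1).
Proof.
move=> s0; apply/funext => t; rewrite /gauss_weight /normal_fun subr0; congr expR.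
rewrite sqr_sqrtr ?invr_ge0 ?mulr_ge0// ?ltW// mulNr; congr -%R.
by rewrite -mulr_natl; field; exact: lt0r_neq0.
Qed.

Lemma integral_gauss_weight s : 0 < s ->
  (\int[leb]_t (gauss_weight s t)%:E)%E = (Num.sqrt (pi / s))%:E.
Proof.
move=> s0; set g := Num.sqrt (2 * s)^-1.
have g0 : g != 0 by rewrite gt_eqF// sqrtr_gt0 invr_gt0 mulr_gt0.
have pk : normal_peak g != 0 by rewrite gt_eqF// normal_peak_gt0.
have := @integral_normal_pdf R 0 g.
rewrite (normal_pdfE _ g0) -(gauss_weightE s0) /=.
under eq_integral do rewrite EFinM.
rewrite ge0_integralZl//=; last 3 first.
- by apply/measurable_EFinP; exact: measurable_gauss_weight.
- by move=> t _; rewrite lee_fin ltW// gauss_weight_gt0.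
- by rewrite lee_fin normal_peak_ge0.
move=> e1.
have : (((normal_peak g)^-1)%:E * ((normal_peak g)%:E * \int[leb]_t (gauss_weight s t)%:E) = ((normal_peak g)^-1)%:E)%E.
  by rewrite e1 mule1.
rewrite muleA -EFinM mulVf// mul1e => ->; congr EFin.
rewrite /normal_peak invrK; congr Num.sqrt.
rewrite sqr_sqrtr ?invr_ge0 ?mulr_ge0// ?ltW// -mulr_natl.
by field; exact: lt0r_neq0.
Qed.

Lemma integrable_gauss_weight s : 0 < s -> leb.-integrable setT (EFin \o gauss_weight s).
Proof.
move=> s0; apply/integrableP; split; first by apply/measurable_EFinP; exact: measurable_gauss_weight.
under eq_integral do rewrite /= ger0_norm ?expR_ge0//.
by rewrite integral_gauss_weight// ltry.
Qed.

(** Half of the exponent absorbs the factor |t|: |t| <= 1 + t^2, while 1 + (s/2) t^2 lies below its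
    exponential. *)
Lemma normr_gw_le s t : 0 < s -> `|t| * gauss_weight s t <= (1 + 2 / s) * gauss_weight (s / 2) t.
Proof.
move=> s0; rewrite {1}(_ : s = s / 2 + s / 2); last by field.
rewrite gauss_weightD mulrA ler_wpM2r ?expR_ge0//.
have e1 : 1 + s / 2 * t ^+ 2 <= expR (s / 2 * t ^+ 2) by exact: expR_ge1Dx.
rewrite /gauss_weight expRN ler_pdivrMr ?expR_gt0//.
apply: le_trans (_ : (1 + 2 / s) * (1 + s / 2 * t ^+ 2) <= _); last first.
  by apply: ler_wpM2l => //; rewrite addr_ge0// divr_ge0// ltW.
rewrite (_ : (1 + 2 / s) * (1 + s / 2 * t ^+ 2) = 1 + t ^+ 2 + (2 / s + s / 2 * t ^+ 2)); last by field; exact: lt0r_neq0.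
have h1 : 0 <= 2 / s by rewrite divr_ge0// ltW.
have h2 : 0 <= s / 2 * t ^+ 2 by rewrite mulr_ge0 ?sqr_ge0// divr_ge0// ltW.
apply: ler_wpDr; first exact: addr_ge0.
have := sqr_ge0 (`|t| - 1); rewrite -(real_normK (num_real t)); nra.
Qed.

Lemma integrable_normr_gauss_weight s : 0 < s ->
  leb.-integrable setT (EFin \o (fun t => `|t| * gauss_weight s t)).
Proof.
move=> s0; apply: (@le_integrable _ _ _ leb setT measurableT _ (EFin \o (fun t => (1 + 2 / s) * gauss_weight (s / 2) t))) => //.
- apply/measurable_EFinP; apply: measurable_funM; last exact: measurable_gauss_weight.
  exact: normr_measurable.
- move=> t _ /=; rewrite lee_fin ger0_norm ?mulr_ge0// ?expR_ge0//.
  by apply: le_trans (ler_norm _); exact: normr_gw_le.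
- rewrite (_ : _ \o _ = fun t => ((1 + 2 / s)%:E * (EFin \o gauss_weight (s / 2)) t)%E)//.
  by apply: integrableZl => //; apply: integrable_gauss_weight; rewrite divr_gt0.
Qed.

Definition gauss_fourier (s x : R) := \int[leb]_t (cos (x * t) * gauss_weight s t).

Lemma integrable_bounded_gauss_weight (s C : R) (f : R -> R) : 0 < s -> measurable_fun setT f ->
  (forall t, `|f t| <= C) -> leb.-integrable setT (EFin \o (fun t => f t * gauss_weight s t)).
Proof.
move=> s0 mf fC; apply: (@le_integrable _ _ _ leb setT measurableT _ (EFin \o (fun t => C * gauss_weight s t))) => //.
- by apply/measurable_EFinP; apply: measurable_funM => //; exact: measurable_gauss_weight.
- move=> t _ /=; rewrite lee_fin 2!normrM ler_wpM2r//.
  exact: le_trans (ler_norm _).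
- by apply: integrableZR; exact: integrable_gauss_weight.
Qed.

Lemma measurable_cosM (x : R) : measurable_fun setT (fun t : R => cos (x * t)).
Proof.
apply: continuous_measurable_fun => t; apply: continuous_comp; last exact: continuous_cos.
exact: mulrl_continuous.
Qed.

Lemma measurable_sinM (x : R) : measurable_fun setT (fun t : R => sin (x * t)).
Proof.
apply: continuous_measurable_fun => t; apply: continuous_comp; last exact: continuous_sin.
exact: mulrl_continuous.
Qed.

Lemma normr_cos_le1 (x : R) : `|cos x| <= 1.
Proof. by rewrite ler_norml cos_geN1 cos_le1. Qed.

Lemma normr_sin_le1 (x : R) : `|sin x| <= 1.
Proof. by rewrite ler_norml sin_geN1 sin_le1. Qed.


Lemma is_derive_gauss_weight s (t : R) : is_derive t (1 : R) (gauss_weight s) (- (2 * s * t) * gauss_weight s t).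
Proof.
have d0 : is_derive t (1 : R) (- (cst s * (@id R ^+ 2))) (- (2 * s * t)).
  by apply: is_derive_eq; rewrite /GRing.scale/=; ring.
rewrite (_ : gauss_weight s = expR \o (- (cst s * (@id R ^+ 2)))); last first.
  by apply/funext => x; rewrite /gauss_weight /= !fctE.
apply: (is_derive_eq (is_derive1_comp _ d0)).
by rewrite mulrC.
Qed.

Lemma is_derive_sinM (x t : R) : is_derive t (1 : R) (fun t => sin (x * t)) (x * cos (x * t)).
Proof.
have d0 : is_derive t (1 : R) (cst x * @id R) x.
  by apply: is_derive_eq; rewrite /GRing.scale/=; ring.
rewrite (_ : (fun _ => _) = sin \o (cst x * @id R)); last exact/funext.
by apply: (is_derive_eq (is_derive1_comp _ d0)); rewrite mulrC.
Qed.

Lemma is_derive_cosM (x t : R) : is_derive t (1 : R) (fun t => cos (x * t)) (- (x * sin (x * t))).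
Proof.
have d0 : is_derive t (1 : R) (cst x * @id R) x.
  by apply: is_derive_eq; rewrite /GRing.scale/=; ring.
rewrite (_ : (fun _ => _) = cos \o (cst x * @id R)); last exact/funext.
by apply: (is_derive_eq (is_derive1_comp _ d0)); rewrite mulNr mulrC.
Qed.

Lemma cvg_gauss_weight s : 0 < s -> gauss_weight s n%:R @[n --> \oo] --> (0:R).
Proof.
move=> s0.
apply: (@squeeze_cvgr _ _ _ _ (fun=> 0) (fun n => (1 + s^-1) * harmonic n)).
- apply: nearW => n; rewrite ltW ?gauss_weight_gt0//= /gauss_weight expRN ler_pdivlMr ?ltr0Sn// mulrC.
  rewrite ler_pdivrMr ?expR_gt0//.
  apply: (@le_trans _ _ ((1 + s^-1) * (1 + s * n%:R ^+ 2))); last first.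
    by rewrite ler_pM2l ?expR_ge1Dx// addr_gt0// invr_gt0.
  rewrite (_ : (1 + s^-1) * (1 + s * n%:R ^+ 2) = 1 + n%:R ^+ 2 + (s^-1 + s * n%:R ^+ 2)); last by field; exact: lt0r_neq0.
  apply: ler_wpDr.
    by apply: addr_ge0; [rewrite invr_ge0 ltW|rewrite mulr_ge0 ?sqr_ge0// ltW].
  by rewrite -natrX -natr1 addrC lerD2l ler_nat; case: n => // n; rewrite expnS leq_pmulr.
- exact: cvg_cst.
- rewrite -[X in _ --> X](mulr0 (1 + s^-1)); apply: cvgM; [exact: cvg_cst|exact: cvg_harmonic].
Qed.

(** The derivative of sin(x t) e^(-s t^2) in t has integral 0. This trades the factor t, which
    appears when [gauss_fourier] is differentiated in x, for [gauss_fourier] itself. *)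
Lemma gauss_fourier_parts (s x : R) : 0 < s ->
  \int[leb]_t (t * sin (x * t) * gauss_weight s t) = x / (2 * s) * gauss_fourier s x.
Proof.
move=> s0.
have dk (t : R) : is_derive t (1 : R) (fun t => sin (x * t) * gauss_weight s t)
    (x * (cos (x * t) * gauss_weight s t) + - (2 * s) * (t * sin (x * t) * gauss_weight s t)).
  have d1 := is_derive_gauss_weight s t.
  have d2 := is_derive_sinM x t.
  rewrite (_ : (fun _ => _) = (fun t => sin (x * t)) * gauss_weight s)//.
  by apply: is_derive_eq; rewrite /GRing.scale/=; ring.
have i1 : leb.-integrable setT (EFin \o (fun t => cos (x * t) * gauss_weight s t)).
  by apply: (@integrable_bounded_gauss_weight _ 1) => //; [exact: measurable_cosM|move=> t; exact: normr_cos_le1].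
have i2 : leb.-integrable setT (EFin \o (fun t => t * sin (x * t) * gauss_weight s t)).
  apply: (@le_integrable _ _ _ leb setT measurableT _ (EFin \o (fun t => `|t| * gauss_weight s t))) => //.
  - apply/measurable_EFinP; apply: measurable_funM; last exact: measurable_gauss_weight.
    by apply: measurable_funM => //; exact: measurable_sinM.
  - move=> t _ /=; rewrite lee_fin !normrM normr_id ler_wpM2r//.
    by rewrite ler_piMr// normr_sin_le1.
  - exact: integrable_normr_gauss_weight.
have j1 : leb.-integrable setT (EFin \o (fun t => x * (cos (x * t) * gauss_weight s t))).
  exact: integrableZR.
have j2 : leb.-integrable setT (EFin \o (fun t => - (2 * s) * (t * sin (x * t) * gauss_weight s t))).
  exact: integrableZR.
have csc : continuous (fun t => sin (x * t)).
  by move=> t; apply: continuous_comp; [exact: mulrl_continuous|exact: continuous_sin].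
have ccc : continuous (fun t => cos (x * t)).
  by move=> t; apply: continuous_comp; [exact: mulrl_continuous|exact: continuous_cos].
have cgw := @continuous_gauss_weight s.
have sgw0 (u : nat -> R) : (forall n, `|u n| = n%:R) -> sin (x * u n) * gauss_weight s (u n) @[n --> \oo] --> 0.
  move=> un; apply: norm_cvg0.
  apply: (@squeeze_cvgr _ _ _ _ (fun=> 0) (fun n => gauss_weight s n%:R)); [|exact: cvg_cst|exact: cvg_gauss_weight].
  apply: nearW => n; rewrite normr_ge0/= normrM [X in _ * X]ger0_norm ?expR_ge0//.
  by rewrite /gauss_weight -(un n) real_normK ?num_real// ler_piMl ?expR_ge0// normr_sin_le1.
have := @Rintegral_derive0 _ _ dk.
rewrite RintegralD// RintegralZl// RintegralZl//.
have s1 : 2 * s != 0 by rewrite mulf_neq0// gt_eqF.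
move=> H; apply: (mulfI s1); rewrite mulrA [x / _]mulrC mulrA mulfV// mul1r -/(gauss_fourier s x).
apply/eqP; rewrite eq_sym -subr_eq0 -mulNr; apply/eqP; apply: H.
- move=> t; apply: cvgD; apply: cvgM; try exact: cvg_cst.
    by apply: cvgM; [exact: ccc|exact: cgw].
  by apply: cvgM; [apply: cvgM; [exact: cvg_id|exact: csc]|exact: cgw].
- exact: integrableDR.
- by apply: sgw0 => n; rewrite normr_nat.
- by apply: (sgw0 (fun n => - n%:R)) => n; rewrite normrN normr_nat.
Qed.

Lemma is_derive_gauss_fourier (s x : R) : 0 < s -> is_derive x (1 : R) (gauss_fourier s) (- (x / (2 * s)) * gauss_fourier s x).
Proof.
move=> s0.
pose f (x t : R) := cos (x * t) * gauss_weight s t.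
have df (y t : R) : is_derive y (1 : R) (f ^~ t) (- (t * sin (y * t)) * gauss_weight s t).
  have d2 := is_derive_cosM t y.
  rewrite (_ : f ^~ t = (fun y => cos (t * y)) * (cst (gauss_weight s t))); last first.
    by apply/funext => z; rewrite /f fctE (mulrC z).
  by apply: is_derive_eq; rewrite /GRing.scale/= (mulrC t y); ring.
have mf (y : R) : leb.-integrable setT (EFin \o f y).
  by apply: (@integrable_bounded_gauss_weight _ 1) => //; [exact: measurable_cosM|move=> t; exact: normr_cos_le1].
have xI : `]x - 1, x + 1[%classic x by rewrite /= in_itv/=; apply/andP; split; lra.
have h1 (y t : R) : partial1of2 f y t = - (t * sin (y * t)) * gauss_weight s t.
  by rewrite partial1of2E; apply: derive_val.
have H1 := @derivable_under_integral R _ _ leb f setT measurableT x (x - 1) (x + 1) xI (fun y _ => mf y)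
  (fun y t _ _ => @ex_derive _ _ _ _ _ _ _ (df y t)) (fun t => `|t| * gauss_weight s t).
have H2 := @differentiation_under_integral R _ _ leb f setT measurableT x (x - 1) (x + 1) xI (fun y _ => mf y)
  (fun y t _ _ => @ex_derive _ _ _ _ _ _ _ (df y t)) (fun t => `|t| * gauss_weight s t).
have G0 (t : R) : 0 <= `|t| * gauss_weight s t by rewrite mulr_ge0// ltW// gauss_weight_gt0.
have Gi := integrable_normr_gauss_weight s0.
have Gb (y t : R) : `]x - 1, x + 1[%classic y -> [set: R] t -> `|partial1of2 f y t| <= `|t| * gauss_weight s t.
  move=> _ _; rewrite h1 normrM normrN (ger0_norm (ltW (gauss_weight_gt0 _ _))) ler_wpM2r//; first exact: ltW (gauss_weight_gt0 _ _).
  by rewrite normrM ler_piMr// normr_sin_le1.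
apply: DeriveDef; first exact: (H1 G0 Gi Gb).
rewrite -derive1E (H2 G0 Gi Gb).
under eq_Rintegral do rewrite h1 mulNr -mulN1r.
rewrite RintegralZl//; first by rewrite gauss_fourier_parts// mulN1r mulNr.
apply: (@le_integrable _ _ _ leb setT measurableT _ (EFin \o (fun t => `|t| * gauss_weight s t))) => //.
- apply/measurable_EFinP; apply: measurable_funM; last exact: measurable_gauss_weight.
  by apply: measurable_funM => //; exact: measurable_sinM.
- move=> t _ /=; rewrite lee_fin !normrM normr_id ler_wpM2r//.
  by rewrite ler_piMr// normr_sin_le1.
Qed.

Lemma gauss_fourier_E (s x : R) : 0 < s -> gauss_fourier s x = Num.sqrt (pi / s) * expR (- (x ^+ 2 / (4 * s))).
Proof.
move=> s0.
have s1 : s != 0 by rewrite gt_eqF.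
(* With its negative parameter this [gauss_weight] is e^(x^2/(4s)), the reciprocal of the expected
   Gaussian. The equation F' = -(x/(2s)) F makes the product constant, and its value at 0 is the
   Gaussian integral. *)
have d (y : R) : is_derive y (1 : R) (gauss_fourier s * gauss_weight (- (4 * s)^-1)) 0.
  have d1 := is_derive_gauss_fourier y s0.
  have d2 := is_derive_gauss_weight (- (4 * s)^-1) y.
  by apply: is_derive_eq; rewrite /GRing.scale/=; field.
have := is_derive_0_is_cst x 0 d.
rewrite !fctE {2}/gauss_weight expr0n/= mulr0 oppr0 expR0 mulr1.
rewrite {2}/gauss_fourier; under eq_Rintegral do rewrite mul0r cos0 mul1r.
rewrite /Rintegral integral_gauss_weight//= => <-.
rewrite -mulrA /gauss_weight -expRD (_ : _ + _ = 0) ?expR0 ?mulr1//.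
by field.
Qed.
End gauss.

(** * Functions with unimodal cosine transforms, and their multipliers *)

Section cone.
Variable R : realType.
Notation leb := (@lebesgue_measure R).
Implicit Types (f h b : R -> R) (s c : R).

Definition gauss_cos_transform f s x := \int[leb]_t (cos (x * t) * f t * gauss_weight s t).
Local Notation gtr := gauss_cos_transform.

(* The Gaussian weight makes the cosine transform of every bounded function
   converge; it is removed at the very end, for the stable law. *)
Definition gauss_unimodal f :=
  [/\ measurable_fun setT f, exists C : R, forall t, `|f t| <= C &
    forall s, 0 < s -> (forall x, 0 <= gtr f s x) /\
                       (forall x y, 0 <= x -> x <= y -> gtr f s y <= gtr f s x)].

(** Products of characteristic functions correspond to convolutions, and that these preserve
    symmetric unimodality is a theorem in its own right. Asking [f] to preserve the whole class
    turns closure under products into mere composition; applying [f] to the constant 1 then puts it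
    in the class. *)
Definition unimodal_multiplier f :=
  [/\ measurable_fun setT f, exists C : R, forall t, `|f t| <= C &
    forall h, gauss_unimodal h -> gauss_unimodal (fun t => f t * h t)].

Local Notation CC := gauss_unimodal.
Local Notation MM := unimodal_multiplier.

Lemma integrable_gtr f s x C : 0 < s -> measurable_fun setT f -> (forall t, `|f t| <= C) ->
  leb.-integrable setT (EFin \o (fun t => cos (x * t) * f t * gauss_weight s t)).
Proof.
move=> s0 mf fC; apply: (@integrable_bounded_gauss_weight _ _ C) => //.
  by apply: measurable_funM => //; exact: measurable_cosM.
move=> t; rewrite normrM; apply: le_trans (fC t).
by rewrite ler_piMl// normr_cos_le1.
Qed.

(** The only transform that is computed: a centred Gaussian in x. The members needed later arise
    from this one through multipliers. *)
Lemma gauss_unimodal1 : CC (fun=> 1).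
Proof.
split; [exact: measurable_cst|by exists 1 => t; rewrite normr1|].
move=> s s0.
have e x : gtr (fun=> 1) s x = Num.sqrt (pi / s) * expR (- (x ^+ 2 / (4 * s))).
  by rewrite -gauss_fourier_E//; apply: eq_Rintegral => t _; rewrite mulr1.
split => [x|x y x0 xy]; rewrite !e; first by rewrite mulr_ge0 ?sqrtr_ge0// expR_ge0.
rewrite ler_wpM2l ?sqrtr_ge0// ler_expR lerN2 ler_wpM2r//.
  by rewrite invr_ge0 mulr_ge0// ltW.
by rewrite lerXn2r// nnegrE// (le_trans x0).
Qed.

Lemma gauss_unimodal_lim (f_ : nat -> R -> R) f C : (forall n, CC (f_ n)) ->
  (forall n t, `|f_ n t| <= C) -> (forall t, f_ n t @[n --> \oo] --> f t) -> CC f.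
Proof.
move=> cf fC cvf.
have mf n : measurable_fun setT (f_ n) by have [] := cf n.
have mlim : measurable_fun setT f by apply: measurable_fun_cvg mf (fun x _ => cvf x).
split => //.
  by exists C => t; apply: (cvgr_to_le (cvg_norm (cvf t))); exact: nearW.
move=> s s0.
have cg x : gtr (f_ n) s x @[n --> \oo] --> gtr f s x.
  apply: (@dominated_cvgR _ _ _ leb _ _ (fun t => C * gauss_weight s t)).
  - move=> n; apply: measurable_funM; last exact: measurable_gauss_weight.
    by apply: measurable_funM; [exact: measurable_cosM|exact: mf].
  - move=> t; apply: cvgM; last exact: cvg_cst.
    by apply: cvgM; [exact: cvg_cst|exact: cvf].
  - by apply: integrableZR; exact: integrable_gauss_weight.
  - move=> n t; rewrite normrM (ger0_norm (ltW (gauss_weight_gt0 _ _))) ler_wpM2r//; first exact: ltW (gauss_weight_gt0 _ _).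
    by rewrite normrM (le_trans _ (fC n t))// ler_piMl// normr_cos_le1.
split => [x|x y x0 xy].
  by apply: (cvgr_to_ge (cg x)); apply: nearW => n; have [_ _ /(_ s s0)[]] := cf n.
apply: (ler_cvg_to (cg y) (cg x)); apply: nearW => n.
by have [_ _ /(_ s s0)[_]] := cf n; exact.
Qed.

Lemma gauss_unimodalD f h : CC f -> CC h -> CC (fun t => f t + h t).
Proof.
move=> [mf [C fC] cf] [mh [D hD] ch]; split; first exact: measurable_funD.
  by exists (C + D) => t; rewrite (le_trans (ler_normD _ _))// lerD.
move=> s s0.
have e x : gtr (fun t => f t + h t) s x = gtr f s x + gtr h s x.
  rewrite /gtr -RintegralD//; [|exact: integrable_gtr fC|exact: integrable_gtr hD].
  by apply: eq_Rintegral => t _; rewrite mulrDr mulrDl.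
have [cf1 cf2] := cf s s0; have [ch1 ch2] := ch s s0.
split => [x|x y x0 xy]; rewrite !e; first exact: addr_ge0.
by rewrite lerD ?cf2 ?ch2.
Qed.

Lemma gauss_unimodalZ c f : 0 <= c -> CC f -> CC (fun t => c * f t).
Proof.
move=> c0 [mf [C fC] cf]; split; first exact: measurable_funM.
  by exists (c * C) => t; rewrite normrM (ger0_norm c0) ler_wpM2l.
move=> s s0.
have e x : gtr (fun t => c * f t) s x = c * gtr f s x.
  rewrite /gtr -RintegralZl//; last exact: integrable_gtr fC.
  by apply: eq_Rintegral => t _; ring.
have [cf1 cf2] := cf s s0.
split => [x|x y x0 xy]; rewrite !e; first exact: mulr_ge0.
by rewrite ler_wpM2l ?cf2.
Qed.

Lemma unimodal_multiplier_unimodal f : MM f -> CC f.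
Proof.
move=> [_ _ /(_ _ gauss_unimodal1)].
by rewrite (_ : (fun t => f t * 1) = f)//; apply/funext => t; rewrite mulr1.
Qed.

Lemma multiplier_cst c : 0 <= c -> MM (fun=> c).
Proof.
move=> c0; split; [exact: measurable_cst|by exists c => t; rewrite ger0_norm|].
by move=> h ch; exact: gauss_unimodalZ.
Qed.

Lemma multiplierD f h : MM f -> MM h -> MM (fun t => f t + h t).
Proof.
move=> [mf [C fC] cf] [mh [D hD] ch]; split; first exact: measurable_funD.
  by exists (C + D) => t; rewrite (le_trans (ler_normD _ _))// lerD.
move=> k ck; rewrite (_ : (fun t => _) = (fun t => f t * k t + h t * k t)).
  by apply: gauss_unimodalD; [exact: cf|exact: ch].
by apply/funext => t; rewrite mulrDl.
Qed.

Lemma multiplierM f h : MM f -> MM h -> MM (fun t => f t * h t).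
Proof.
move=> [mf [C fC] cf] [mh [D hD] ch]; split; first exact: measurable_funM.
  by exists (C * D) => t; rewrite normrM ler_pM.
move=> k ck; rewrite (_ : (fun t => _) = (fun t => f t * (h t * k t))).
  by apply: cf; exact: ch.
by apply/funext => t; rewrite mulrA.
Qed.

Lemma multiplierX f n : MM f -> MM (fun t => f t ^+ n).
Proof.
move=> cf; elim: n => [|n IH].
  rewrite (_ : (fun t => _) = (fun=> 1)); last by apply/funext => t; rewrite expr0.
  exact: multiplier_cst.
rewrite (_ : (fun t => _) = (fun t => f t * f t ^+ n)); last by apply/funext => t; rewrite exprS.
exact: multiplierM.
Qed.

Lemma multiplier_sum (f_ : nat -> R -> R) n : (forall i, MM (f_ i)) ->
  MM (fun t => \sum_(0 <= i < n) f_ i t).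
Proof.
move=> cf; elim: n => [|n IH].
  rewrite (_ : (fun t => _) = (fun=> 0)); last by apply/funext => t; rewrite big_nil.
  exact: multiplier_cst.
rewrite (_ : (fun t => _) = (fun t => \sum_(0 <= i < n) f_ i t + f_ n t)).
  exact: multiplierD.
by apply/funext => t; rewrite big_nat_recr.
Qed.

Lemma multiplier_lim (f_ : nat -> R -> R) f C : (forall n, MM (f_ n)) ->
  (forall n t, `|f_ n t| <= C) -> (forall t, f_ n t @[n --> \oo] --> f t) -> MM f.
Proof.
move=> cf fC cvf.
have mf n : measurable_fun setT (f_ n) by have [] := cf n.
split.
- by apply: measurable_fun_cvg mf (fun x _ => cvf x).
- by exists C => t; apply: (cvgr_to_le (cvg_norm (cvf t))); exact: nearW.
- move=> h ch; have [_ [D hD] _] := ch.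
  apply: (@gauss_unimodal_lim (fun n t => f_ n t * h t) _ (C * D)).
  + by move=> n; have [_ _] := cf n; exact.
  + by move=> n t; rewrite normrM ler_pM.
  + by move=> t; apply: cvgM; [exact: cvf|exact: cvg_cst].
Qed.

(** A Gaussian factor merely changes the weight r into s + r. This is why the class quantifies over
    all Gaussian weights. *)
Lemma multiplier_gauss_weight s : 0 <= s -> MM (gauss_weight s).
Proof.
move=> s0; split; first exact: measurable_gauss_weight.
  by exists 1 => t; rewrite (ger0_norm (ltW (gauss_weight_gt0 _ _))) gauss_weight_le1.
move=> h [mh [D hD] ch]; split.
- by apply: measurable_funM => //; exact: measurable_gauss_weight.
- exists D => t; rewrite normrM (ger0_norm (ltW (gauss_weight_gt0 _ _))).
  by rewrite (le_trans _ (hD t))// ler_piMl// gauss_weight_le1.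
- move=> r r0.
  have e x : gtr (fun t => gauss_weight s t * h t) r x = gtr h (s + r) x.
    by apply: eq_Rintegral => t _; rewrite gauss_weightD; ring.
  have [c1 c2] := ch (s + r) (ltr_wpDl s0 r0).
  by split => [x|x y x0 xy]; rewrite !e//; exact: c2.
Qed.

Lemma multiplier_expR f : MM f -> MM (fun t => expR (f t)).
Proof.
move=> cf; have [mf [C fC] _] := cf.
(* The partial sums are polynomials in [f] with nonnegative coefficients, hence multipliers, and e^C
   bounds them all. *)
apply: (@multiplier_lim (fun n t => series (exp_coeff (f t)) n) _ (expR C)).
- move=> n; rewrite /series/=; apply: multiplier_sum => i.
  rewrite /exp_coeff; rewrite (_ : (fun t => _) = (fun t => i`!%:R^-1 * f t ^+ i)).
    by apply: multiplierM; [apply: multiplier_cst; rewrite invr_ge0|exact: multiplierX].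
  by apply/funext => t; rewrite mulrC.
- move=> n t; rewrite /series/=.
  apply: (@le_trans _ _ (series (exp_coeff C) n)).
    rewrite (le_trans (ler_norm_sum _ _ _))//; apply: ler_sum => i _.
    rewrite /exp_coeff/= normrM normfV normrX (ger0_norm (ler0n _ _)) ler_wpM2r ?invr_ge0//.
    by rewrite lerXn2r// nnegrE// (le_trans _ (fC t)).
  rewrite /expR.
  apply: nondecreasing_cvgn_le; last exact: is_cvg_series_exp_coeff.
  apply: nondecreasing_series => i _ _; apply: exp_coeff_ge0.
  exact: le_trans (fC t).
- by move=> t; exact: is_cvg_series_exp_coeff.
Qed.

(** [b] plays the part of a Levy exponent. The condition bears on the functions e^(-c b), which are
    bounded by 1 even when [b] is unbounded; sums of exponents become products of multipliers, and
    pointwise limits need no common bound. *)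
Definition bernstein b := (forall t, 0 <= b t) /\ (forall c, 0 <= c -> MM (fun t => expR (- (c * b t)))).
Local Notation BB := bernstein.

Lemma bernstein0 : BB (fun=> 0).
Proof.
split=> // c c0.
rewrite (_ : (fun t => _) = (fun=> 1)); last by apply/funext => t; rewrite mulr0 oppr0 expR0.
exact: multiplier_cst.
Qed.

Lemma bernstein_gauss_weight s : 0 <= s -> BB (fun t => 1 - gauss_weight s t).
Proof.
move=> s0; split=> [t|c c0]; first by rewrite subr_ge0 gauss_weight_le1.
(* The compound Poisson form: once the constant e^(-c) is split off, the remaining exponent has a
   positive sign and is covered by [multiplier_expR]. *)
rewrite (_ : (fun t => _) = (fun t => expR (- c) * expR (c * gauss_weight s t))).
  apply: multiplierM; first by apply: multiplier_cst; exact: expR_ge0.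
  apply: multiplier_expR; apply: multiplierM; first exact: multiplier_cst.
  exact: multiplier_gauss_weight.
by apply/funext => t; rewrite -expRD; congr expR; ring.
Qed.

Lemma bernsteinD b b' : BB b -> BB b' -> BB (fun t => b t + b' t).
Proof.
move=> [b0 Bb] [b0' Bb']; split=> [t|c c0]; first exact: addr_ge0.
rewrite (_ : (fun t => _) = (fun t => expR (- (c * b t)) * expR (- (c * b' t)))).
  by apply: multiplierM; [exact: Bb|exact: Bb'].
by apply/funext => t; rewrite -expRD; congr expR; ring.
Qed.

Lemma bernsteinZ c b : 0 <= c -> BB b -> BB (fun t => c * b t).
Proof.
move=> c0 [b0 Bb]; split=> [t|c' c'0]; first exact: mulr_ge0.
rewrite (_ : (fun t => _) = (fun t => expR (- (c' * c * b t)))).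
  by apply: Bb; exact: mulr_ge0.
by apply/funext => t; congr expR; ring.
Qed.

Lemma bernstein_sum (b_ : nat -> R -> R) n : (forall i, BB (b_ i)) ->
  BB (fun t => \sum_(0 <= i < n) b_ i t).
Proof.
move=> cf; elim: n => [|n IH].
  rewrite (_ : (fun t => _) = (fun=> 0)); last by apply/funext => t; rewrite big_nil.
  exact: bernstein0.
rewrite (_ : (fun t => _) = (fun t => \sum_(0 <= i < n) b_ i t + b_ n t)).
  exact: bernsteinD.
by apply/funext => t; rewrite big_nat_recr.
Qed.

Lemma bernstein_lim (b_ : nat -> R -> R) b : (forall n, BB (b_ n)) ->
  (forall t, b_ n t @[n --> \oo] --> b t) -> BB b.
Proof.
move=> Bb cvb; split=> [t|c c0].
  by apply: (cvgr_to_ge (cvb t)); apply: nearW => n; have [] := Bb n.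
apply: (@multiplier_lim (fun n t => expR (- (c * b_ n t))) _ 1).
- by move=> n; have [_] := Bb n; exact.
- move=> n t; rewrite ger0_norm ?expR_ge0// -expR0 ler_expR oppr_le0 mulr_ge0//.
  by have [] := Bb n.
- move=> t; apply: continuous_cvg; first exact: continuous_expR.
  by apply: cvgN; apply: cvgM; [exact: cvg_cst|exact: cvb].
Qed.

End cone.

Lemma cvg_succ (R : realType) (v : nat -> R) (l : R) :
  v n @[n --> \oo] --> l -> v n.+1 @[n --> \oo] --> l.
Proof. by move=> vl; rewrite -cvg_shiftS in vl. Qed.

(** * The stable laws have symmetric unimodal densities *)

Section stable_exponent.
Variable R : realType.
Variables (beta h : R).
Hypotheses (b0 : 0 < beta) (b1 : beta < 1) (h0 : 0 < h).
Implicit Types (u : R) (k n : nat).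

(* The sum over [k] in Z of e^(-beta h k) (1 - e^(-u e^(h k))) is a Riemann sum of
   the integral of (1 - e^(-u r)) r^(-1-beta) dr, which is a multiple of u^beta. It
   is multiplied by e^(beta h) when [u] is multiplied by e^h, so its monotonicity in
   [u] alone shows that, normalised at [u = 1], it tends to u^beta as [h] tends
   to 0. *)
Definition upterm u k := expR (- (beta * h * k%:R)) * (1 - expR (- (u * expR (h * k%:R)))).
Definition downterm u k := expR (beta * h * k.+1%:R) * (1 - expR (- (u * expR (- (h * k.+1%:R))))).

Lemma expRN_le1 (x : R) : 0 <= x -> expR (- x) <= 1.
Proof. by move=> x0; rewrite -expR0 ler_expR oppr_le0. Qed.

Lemma upterm_ge0 u k : 0 <= u -> 0 <= upterm u k.
Proof. by move=> u0; rewrite mulr_ge0 ?expR_ge0// subr_ge0 expRN_le1// mulr_ge0// expR_ge0. Qed.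

Lemma downterm_ge0 u k : 0 <= u -> 0 <= downterm u k.
Proof. by move=> u0; rewrite mulr_ge0 ?expR_ge0// subr_ge0 expRN_le1// mulr_ge0// expR_ge0. Qed.

Lemma is_cvg_upterm u : 0 <= u -> cvgn (series (upterm u)).
Proof.
move=> u0; have q1 : `|expR (- (beta * h))| < 1.
  by rewrite ger0_norm ?expR_ge0// -expR0 ltr_expR oppr_lt0 mulr_gt0.
apply: (@series_le_cvg _ _ (geometric 1 (expR (- (beta * h))))).
- by move=> n; exact: upterm_ge0.
- by move=> n; rewrite /geometric/= mul1r exprn_ge0// expR_ge0.
- move=> n; rewrite /geometric/= mul1r -expRM_natl.
  rewrite (_ : n%:R * - (beta * h) = - (beta * h * n%:R)); last by ring.
  by rewrite /upterm ler_piMr ?expR_ge0// lerBlDr lerDl expR_ge0.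
- exact: is_cvg_geometric_series.
Qed.

(** The weights e^(beta h (k+1)) grow, so the bound 1 - e^(-x) <= x is used. It leaves the ratio
    e^(-(1 - beta) h), below 1 since beta < 1; for beta = alpha/2 this is the condition alpha <
    2. *)
Lemma is_cvg_downterm u : 0 <= u -> cvgn (series (downterm u)).
Proof.
move=> u0; have q1 : `|expR (- ((1 - beta) * h))| < 1.
  by rewrite ger0_norm ?expR_ge0// -[ltRHS]expR0 ltr_expR oppr_lt0 mulr_gt0// subr_gt0.
apply: (@series_le_cvg _ _ (geometric (u * expR (- ((1 - beta) * h))) (expR (- ((1 - beta) * h))))).
- by move=> n; exact: downterm_ge0.
- by move=> n; rewrite /geometric/= !mulr_ge0 ?expR_ge0// exprn_ge0// expR_ge0.
- move=> n; rewrite /geometric/= -expRM_natl -mulrA -expRD.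
  rewrite (_ : - ((1 - beta) * h) + _ = beta * h * n.+1%:R - h * n.+1%:R); last first.
    by rewrite -natr1; ring.
  rewrite expRD mulrCA /downterm ler_wpM2l ?expR_ge0//.
  have := expR_ge1Dx (- (u * expR (- (h * n.+1%:R)))); lra.
- exact: is_cvg_geometric_series.
Qed.

Definition lattice_sum u := limn (series (upterm u)) + limn (series (downterm u)).
Local Notation S := lattice_sum.

Lemma lattice_sum0 : S 0 = 0.
Proof.
rewrite /S; rewrite (_ : upterm 0 = fun=> 0); last first.
  by apply/funext => k; rewrite /upterm mul0r oppr0 expR0 subrr mulr0.
rewrite (_ : downterm 0 = fun=> 0); last first.
  by apply/funext => k; rewrite /downterm mul0r oppr0 expR0 subrr mulr0.
rewrite (_ : series (fun=> 0) = fun=> 0 :> R); last first.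
  by apply/funext => k; rewrite /series/= big1.
by rewrite lim_cst// addr0.
Qed.

(** Scaling by e^h shifts the lattice index by one. The term of index 0 leaves the upper series and
    becomes the leading term of the lower one, so the two corrections cancel. *)
Lemma lattice_sum_scale u : 0 <= u -> S (expR h * u) = expR (beta * h) * S u.
Proof.
move=> u0; have v0 : 0 <= expR h * u by rewrite mulr_ge0 ?expR_ge0.
have cu := is_cvg_upterm u0; have cd := is_cvg_downterm u0.
have eu : limn (series (upterm (expR h * u))) = expR (beta * h) * (limn (series (upterm u)) - upterm u 0).
  apply/cvg_lim => //.
  rewrite (_ : series _ = fun n => expR (beta * h) * (series (upterm u) n.+1 - upterm u 0)); last first.
    apply/funext => n; rewrite /series/= big_nat_recl// addrAC subrr add0r mulr_sumr.
    apply: eq_bigr => k _; rewrite /upterm mulrA -expRD.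
    congr (expR _ * (1 - expR (- _))); first by rewrite -natr1; ring.
    rewrite mulrAC mulrC -expRD; congr (_ * expR _); by rewrite -natr1; ring.
  apply: cvgM; first exact: cvg_cst.
  apply: cvgB; last exact: cvg_cst.
  exact: cvg_succ cu.
have ed : limn (series (downterm (expR h * u))) = expR (beta * h) * (limn (series (downterm u)) + upterm u 0).
  apply/cvg_lim => //.
  rewrite -cvg_shiftS.
  rewrite (_ : (fun n => _) = fun n => expR (beta * h) * (series (downterm u) n + upterm u 0)); last first.
    apply/funext => n; rewrite /series/= big_nat_recl// mulrDr addrC mulr_sumr; congr (_ + _).
      apply: eq_bigr => k _; rewrite /downterm mulrA -expRD.
      congr (expR _ * (1 - expR (- _))); first by rewrite -[k.+2%:R]natr1; ring.
      rewrite mulrAC mulrC -expRD; congr (_ * expR _); by rewrite -[k.+2%:R]natr1; ring.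
    rewrite /downterm /upterm !mulr0 oppr0 !expR0 mulr1 mul1r mulr1; congr (_ * (1 - expR (- _))).
    by rewrite mulrAC mulr1 -expRD subrr expR0 mul1r.
  apply: cvgM; first exact: cvg_cst.
  by apply: cvgD => //; exact: cvg_cst.
by apply: etrans (congr2 +%R eu ed) _; rewrite -mulrDr addrACA addNr addr0.
Qed.

Lemma lattice_sum_scaleX n u : 0 <= u -> S (expR (h * n%:R) * u) = expR (beta * h * n%:R) * S u.
Proof.
move=> u0; elim: n => [|n IH]; first by rewrite !mulr0 expR0 !mul1r.
have -> : expR (h * n.+1%:R) * u = expR h * (expR (h * n%:R) * u).
  by rewrite mulrA -expRD; congr (expR _ * _); rewrite -natr1; ring.
rewrite lattice_sum_scale; last by rewrite mulr_ge0 ?expR_ge0.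
rewrite IH mulrA -expRD; congr (expR _ * _); rewrite -natr1; ring.
Qed.

Lemma lattice_sum_scalez (j : int) : S (expR (h * j%:~R)) = expR (beta * h * j%:~R) * S 1.
Proof.
case: j => n; first by rewrite -{1}[expR _]mulr1 lattice_sum_scaleX.
rewrite NegzE mulrNz !mulrN.
(* A negative exponent is reached backwards: scaling e^(-h(n+1)) up by n + 1 lattice steps gives
   1. *)
have := @lattice_sum_scaleX n.+1 (expR (- (h * n.+1%:R))) (expR_ge0 _).
by rewrite -expRD subrr expR0 => ->; rewrite mulrA -expRD addNr expR0 mul1r.
Qed.

Lemma lattice_sum_ge u : 0 <= u -> 1 - expR (- u) <= S u.
Proof.
move=> u0; rewrite -[leLHS]addr0; apply: lerD.
  apply: (@le_trans _ _ (series (upterm u) 1)).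
    by rewrite /series/= big_nat1 /upterm !mulr0 oppr0 expR0 mulr1 mul1r.
  apply: nondecreasing_cvgn_le; last exact: is_cvg_upterm.
  by apply: nondecreasing_series => k _ _; exact: upterm_ge0.
apply: limr_ge; first exact: is_cvg_downterm.
by apply: nearW => n; apply: sumr_ge0 => k _; exact: downterm_ge0.
Qed.

Lemma lattice_sum_le u v : 0 <= u -> u <= v -> S u <= S v.
Proof.
move=> u0 uv; have v0 := le_trans u0 uv.
apply: lerD; apply: ler_lim; [exact: is_cvg_upterm|exact: is_cvg_upterm| |
  exact: is_cvg_downterm|exact: is_cvg_downterm|];
 apply: nearW => n; apply: ler_sum => k _;
 by rewrite ler_wpM2l ?expR_ge0// lerB// ler_expR lerN2 ler_wpM2r ?expR_ge0.
Qed.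

Lemma lattice_sum1_gt0 : 0 < S 1.
Proof.
apply: lt_le_trans (lattice_sum_ge ler01).
by rewrite subr_gt0 -[ltRHS]expR0 ltr_expR oppr_lt0.
Qed.

(** Exact scaling holds only on the lattice. Rounding y/h down and up and using monotonicity costs
    at most one step [h] in the exponent. *)
Lemma lattice_sum_bounds (y : R) :
  expR (beta * (y - h)) * S 1 <= S (expR y) <= expR (beta * (y + h)) * S 1.
Proof.
pose j := Num.floor (y / h).
have /andP[j1 j2] := real_floor_itv (num_real (y / h)).
rewrite -/j in j1 j2.
rewrite ler_pdivlMr// in j1; rewrite ltr_pdivrMr// in j2.
have S1 := ltW lattice_sum1_gt0.
apply/andP; split.
  apply: (@le_trans _ _ (S (expR (h * j%:~R)))); last first.
    by apply: lattice_sum_le; rewrite ?expR_ge0// ler_expR mulrC.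
  rewrite lattice_sum_scalez ler_wpM2r// ler_expR -mulrA ler_pM2l//.
  move: j2; rewrite intrD mulrDl mul1r; lra.
apply: (@le_trans _ _ (S (expR (h * (j + 1)%:~R)))).
  by apply: lattice_sum_le; rewrite ?expR_ge0// ler_expR mulrC ltW.
rewrite lattice_sum_scalez ler_wpM2r// ler_expR -mulrA ler_pM2l//.
rewrite intrD; lra.
Qed.

Lemma bernstein_lattice_sum : bernstein (fun t : R => S (t ^+ 2) / S 1).
Proof.
have S1 := ltW lattice_sum1_gt0.
rewrite (_ : (fun t => _) = (fun t => (S 1)^-1 * S (t ^+ 2))); last first.
  by apply/funext => t; rewrite mulrC.
apply: bernsteinZ; first by rewrite invr_ge0.
apply: bernsteinD.
  apply: (@bernstein_lim _ (fun n t => series (upterm (t ^+ 2)) n)).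
    move=> n; apply: (@bernstein_sum _ (fun k t => upterm (t ^+ 2) k)) => k.
    apply: bernsteinZ; first exact: expR_ge0.
    rewrite (_ : (fun t => _) = (fun t => 1 - gauss_weight (expR (h * k%:R)) t)); last first.
      by apply/funext => t; rewrite mulrC.
    by apply: bernstein_gauss_weight; exact: expR_ge0.
  by move=> t; apply: is_cvg_upterm; exact: sqr_ge0.
apply: (@bernstein_lim _ (fun n t => series (downterm (t ^+ 2)) n)).
  move=> n; apply: (@bernstein_sum _ (fun k t => downterm (t ^+ 2) k)) => k.
  apply: bernsteinZ; first exact: expR_ge0.
  rewrite (_ : (fun t => _) = (fun t => 1 - gauss_weight (expR (- (h * k.+1%:R))) t)); last first.
    by apply/funext => t; rewrite mulrC.
  by apply: bernstein_gauss_weight; exact: expR_ge0.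
by move=> t; apply: is_cvg_downterm; exact: sqr_ge0.
Qed.

End stable_exponent.

Section stable_cf.
Variable R : realType.

Lemma bernstein_powR (alpha : R) : 0 < alpha < 2 -> bernstein (fun t : R => `|t| `^ alpha).
Proof.
move=> /andP[a0 a2].
have b0 : 0 < alpha / 2 by rewrite divr_gt0.
have b1 : alpha / 2 < 1 by rewrite ltr_pdivrMr// mul1r.
have h0 (n : nat) : 0 < @harmonic R n by exact: harmonic_gt0.
(* The exponent is alpha/2 because the argument is t^2; the mesh 1/(n+1) tends to 0. *)
apply: (@bernstein_lim _ (fun n t => lattice_sum (alpha / 2) (harmonic n) (t ^+ 2) / lattice_sum (alpha / 2) (harmonic n) 1)).
  by move=> n; exact: bernstein_lattice_sum.
move=> t; have [->|t0] := eqVneq t 0.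
  rewrite normr0 powR0 ?gt_eqF//; apply: cvg_near_cst; apply: nearW => n.
  by rewrite expr0n/= lattice_sum0 mul0r.
rewrite /powR normr_eq0 (negbTE t0).
pose y := 2 * ln `|t|.
have ye : t ^+ 2 = expR y.
  by rewrite /y expRM_natl lnK ?posrE ?normr_gt0// real_normK// num_real.
have E (c : R) : expR (alpha / 2 * (y + c * harmonic n)) @[n --> \oo] --> expR (alpha * ln `|t|).
  apply: continuous_cvg; first exact: continuous_expR.
  rewrite (_ : alpha * ln `|t| = alpha / 2 * (y + c * 0)); last by rewrite /y; field.
  apply: cvgM; first exact: cvg_cst.
  apply: cvgD; first exact: cvg_cst.
  by apply: cvgM; [exact: cvg_cst|exact: cvg_harmonic].
apply: (squeeze_cvgr _ (E (-1)) (E 1)); apply: nearW => n.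
have S1 := lattice_sum1_gt0 b0 b1 (h0 n).
rewrite ye ler_pdivlMr// ler_pdivrMr// mulN1r mul1r.
exact: lattice_sum_bounds.
Qed.

Lemma stable_cf_unimodal (alpha : R) : 0 < alpha < 2 ->
  gauss_unimodal (fun t : R => expR (- (`|t| `^ alpha))).
Proof.
move=> /bernstein_powR[_ /(_ 1 ler01)].
rewrite (_ : (fun t => _) = (fun t => expR (- (`|t| `^ alpha)))).
  exact: unimodal_multiplier_unimodal.
by apply/funext => t; rewrite mul1r.
Qed.
End stable_cf.

(** Truncation at 0 makes this a measure for every measurable [g], so that the instance below
    requires no proof of positivity. *)
Definition density_measure d (T : measurableType d) (R : realType)
    (mu : {measure set T -> \bar R}) (g : T -> R) (A : set T) : \bar R :=
  (\int[mu]_(x in A) (Num.max 0 (g x))%:E)%E.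

Section density_measure.
Context d (T : measurableType d) (R : realType) (mu : {measure set T -> \bar R}).
Variable g : {mfun T >-> R}.
Local Notation nu := (density_measure mu g).

Let nu0 : nu set0 = 0%E.
Proof. by rewrite /density_measure integral_set0. Qed.

Let nu_ge0 A : (0 <= nu A)%E.
Proof. by apply: integral_ge0 => x _; rewrite lee_fin le_max lexx. Qed.

Let nu_sigma_additive : semi_sigma_additive nu.
Proof.
move=> /= F mF tF mUF; rewrite /density_measure; apply: cvg_toP.
  apply: ereal_nondecreasing_is_cvgn => m n mn.
  apply: lee_sum_nneg_natr => // k _ _; apply: integral_ge0 => /= x Fkx.
  by rewrite lee_fin le_max lexx.
rewrite ge0_integral_bigcup//=.
- apply/measurable_funTS/measurableT_comp => //.
  by apply: measurable_maxr.
- by move=> x _; rewrite lee_fin le_max lexx.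
Qed.

HB.instance Definition _ := isMeasure.Build _ _ _ nu nu0 nu_ge0 nu_sigma_additive.
End density_measure.

(** * Fourier inversion for the stable law *)

Section inversion.
Variable R : realType.
Notation leb := (@lebesgue_measure R).
Variable alpha : R.
Hypothesis a02 : 0 < alpha < 2.

Definition stable_cf (t : R) := expR (- (`|t| `^ alpha)).
Local Notation phi := stable_cf.

Lemma stable_cf_gt0 t : 0 < phi t. Proof. exact: expR_gt0. Qed.

Lemma stable_cf_le1 t : phi t <= 1.
Proof. by rewrite -[leRHS]expR0 ler_expR oppr_le0 powR_ge0. Qed.

Lemma measurable_stable_cf : measurable_fun setT phi.
Proof. by have [] := stable_cf_unimodal a02. Qed.

Lemma integrable_oneDsqrV : leb.-integrable setT (EFin \o (fun x => (1 + x ^+ 2)^-1)).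
Proof.
have cont : continuous (fun x : R => (1 + x ^+ 2)^-1) by exact: continuous_oneDsqrV.
apply/integrableP; split.
  by apply/measurable_EFinP; exact: continuous_measurable_fun.
have p0 (x : R) : 0 <= (1 + x ^+ 2)^-1 by rewrite invr_ge0 addr_ge0// sqr_ge0.
under eq_integral do rewrite /= (ger0_norm (p0 _)).
rewrite ge0_symfun_integralT//; last by move=> x /=; rewrite sqrrN.
by rewrite -set_itvcy (integral0y_oneDsqr R) -EFinM ltry.
Qed.

Lemma stable_cf_decay : exists C : R, forall t, phi t <= C * (1 + t ^+ 2)^-1.
Proof.
have /andP[a0 a2] := a02.
(* The power k is such that |t|^(alpha k) >= t^2 as soon as |t| >= 1, while y^k <= k^k e^y. The
   constant 2 below takes care of |t| <= 1. *)
pose k := (Num.truncn (2 / alpha)).+1.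
have ka : 2 <= k%:R * alpha.
  rewrite -ler_pdivrMr//; apply: ltW; exact: truncnS_gt.
have k0 : (0 : R) < k%:R by rewrite ltr0n.
have K0 : (0 : R) <= k%:R ^+ k by exact: exprn_ge0.
exists (2 + k%:R ^+ k) => t.
rewrite ler_pdivlMr; last by rewrite ltr_wpDr ?sqr_ge0.
rewrite /phi expRN mulrC ler_pdivrMr ?expR_gt0//.
have y0 : 0 <= `|t| `^ alpha by exact: powR_ge0.
set y := `|t| `^ alpha in y0 *.
have e1 : 1 <= expR y by rewrite -[leLHS]expR0 ler_expR.
have [t1|t1] := leP `|t| 1.
  have : t ^+ 2 <= 1 by rewrite -real_normK ?num_real// expr_le1.
  nra.
have e2 : y ^+ k <= k%:R ^+ k * expR y.
  have : y / k%:R <= expR (y / k%:R) by apply: le_trans (expR_ge1Dx _); rewrite lerDr.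
  rewrite ler_pdivrMr// => h.
  apply: (@le_trans _ _ ((expR (y / k%:R) * k%:R) ^+ k)); first by rewrite lerXn2r// ?nnegrE ?mulr_ge0 ?expR_ge0// ltW.
  rewrite exprMn -expRM_natl mulrCA mulfV ?gt_eqF// mulr1 mulrC//.
have e3 : t ^+ 2 <= y ^+ k.
  have t0 : 0 < `|t| by exact: lt_trans t1.
  rewrite -(real_normK (num_real t)) -{1}(lnK (_ : `|t| \is Num.pos)) ?posrE//.
  rewrite /y /powR gt_eqF// -!expRM_natl ler_expR mulrA.
  by rewrite ler_wpM2r// ln_ge0// ltW.
nra.
Qed.

Lemma integrable_stable_cf : leb.-integrable setT (EFin \o phi).
Proof.
have [C HC] := stable_cf_decay.
apply: (@le_integrable _ _ _ leb setT measurableT _ (EFin \o (fun t => C * (1 + t ^+ 2)^-1))) => //.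
- by apply/measurable_EFinP; exact: measurable_stable_cf.
- move=> t _ /=; rewrite lee_fin (ger0_norm (ltW (stable_cf_gt0 t))).
  exact: le_trans (ler_norm _).
- by apply: integrableZR; exact: integrable_oneDsqrV.
Qed.

Definition stable_density x := (2 * pi)^-1 * \int[leb]_t (cos (x * t) * phi t).
Local Notation g := stable_density.
Local Notation gtr := (gauss_cos_transform phi).

(** The Gaussian weight is removed here, with the integrable [phi] as dominating function. Sign and
    monotonicity of the weighted transforms pass to the limit [g]. *)
Lemma cvg_gauss_cos_transform (s_ : nat -> R) x : (forall n, 0 < s_ n) ->
  s_ n @[n --> \oo] --> 0 -> (2 * pi)^-1 * gtr (s_ n) x @[n --> \oo] --> g x.
Proof.
move=> s0 cs; apply: cvgM; first exact: cvg_cst.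
apply: (@dominated_cvgR _ _ _ leb _ _ phi).
- move=> n; apply: measurable_funM; last exact: measurable_gauss_weight.
  by apply: measurable_funM; [exact: measurable_cosM|exact: measurable_stable_cf].
- move=> t; rewrite -[X in _ --> X]mulr1; apply: cvgM; first exact: cvg_cst.
  rewrite -expR0; apply: continuous_cvg; first exact: continuous_expR.
  rewrite -oppr0; apply: cvgN; rewrite -[X in _ --> X](mul0r (t ^+ 2)).
  by apply: cvgM => //; exact: cvg_cst.
- exact: integrable_stable_cf.
- move=> n t; rewrite normrM (ger0_norm (ltW (gauss_weight_gt0 _ _))).
  apply: (@le_trans _ _ (`|cos (x * t) * phi t| * 1)).
    by rewrite ler_wpM2l// gauss_weight_le1// ltW.
  by rewrite mulr1 normrM (ger0_norm (ltW (stable_cf_gt0 t))) ler_piMl ?normr_cos_le1// ltW// stable_cf_gt0.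
Qed.

Let cvg_harm x : (2 * pi)^-1 * gtr (harmonic n) x @[n --> \oo] --> g x.
Proof. by apply: cvg_gauss_cos_transform; [exact: harmonic_gt0|exact: cvg_harmonic]. Qed.

Let twopi_ge0 : 0 <= (2 * pi : R)^-1.
Proof. by rewrite invr_ge0 mulr_ge0 ?pi_ge0. Qed.

Lemma stable_density_ge0 x : 0 <= g x.
Proof.
apply: (cvgr_to_ge (@cvg_harm x)).
apply: nearW => n; apply: mulr_ge0 => //.
by have [_ _ /(_ _ (harmonic_gt0 n))[H _]] := stable_cf_unimodal a02; exact: H.
Qed.

Lemma stable_densityN x : g (- x) = g x.
Proof. by congr (_ * _); apply: eq_Rintegral => t _; rewrite mulNr cosN. Qed.

Lemma stable_density_le x y : 0 <= x -> x <= y -> g y <= g x.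
Proof.
move=> x0 xy.
apply: (ler_cvg_to (@cvg_harm y)
  (@cvg_harm x)).
apply: nearW => n; rewrite ler_wpM2l//.
by have [_ _ /(_ _ (harmonic_gt0 n))[_ H]] := stable_cf_unimodal a02; exact: H.
Qed.

Lemma stable_density_le0 x : g x <= g 0.
Proof.
have [x0|/ltW x0] := leP 0 x; first exact: stable_density_le.
by rewrite -stable_densityN stable_density_le// oppr_ge0.
Qed.

Lemma continuous_cos_transform (psi : R -> R) : leb.-integrable setT (EFin \o psi) ->
  continuous (fun x : R => \int[leb]_t (cos (x * t) * psi t)).
Proof.
move=> ipsi x.
have mpsi : measurable_fun setT psi by apply/measurable_EFinP; exact: measurable_int ipsi.
have xI : x \in (`]x - 1, x + 1[%classic : set R) by rewrite inE/= in_itv/=; apply/andP; split; lra.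
have cb y t : `|cos (y * t) * psi t| <= `|psi t| by rewrite normrM ler_piMl// normr_cos_le1.
apply: (@continuity_under_integral R _ _ leb (fun x t => cos (x * t) * psi t) setT measurableT (x - 1) (x + 1) _ _ (fun t => `|psi t|)) => //.
- move=> y _; apply: (@le_integrable _ _ _ leb setT measurableT _ (EFin \o psi)) => //.
    by apply/measurable_EFinP; apply: measurable_funM => //; exact: measurable_cosM.
  by move=> t _ /=; rewrite lee_fin.
- apply: aeW => t _ y _; apply: cvgM; last exact: cvg_cst.
  by apply: continuous_comp; [exact: mulrr_continuous|exact: continuous_cos].
- by move/integrable_abse : ipsi.
- by move=> y _; apply: aeW => t _.
Qed.

Lemma measurable_stable_density : measurable_fun setT g.
Proof.
apply: continuous_measurable_fun => x; apply: cvgM; first exact: cvg_cst.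
exact/continuous_cos_transform/integrable_stable_cf.
Qed.

Lemma integrable_stable_cf_gauss_weight s : 0 < s -> leb.-integrable setT (EFin \o (fun t => phi t * gauss_weight s t)).
Proof.
move=> s0; apply: (@integrable_bounded_gauss_weight _ s 1) => //; first exact: measurable_stable_cf.
by move=> t; rewrite (ger0_norm (ltW (stable_cf_gt0 t))) stable_cf_le1.
Qed.

Lemma measurable_gauss_cos_transform s : 0 < s -> measurable_fun setT (gtr s).
Proof.
move=> s0; apply: continuous_measurable_fun.
rewrite (_ : gtr s = fun x => \int[leb]_t (cos (x * t) * (phi t * gauss_weight s t))).
  exact/continuous_cos_transform/integrable_stable_cf_gauss_weight.
by apply/funext => x; apply: eq_Rintegral => t _; rewrite mulrA.
Qed.

Lemma gauss_cos_transform_le s x : 0 < s -> `|gtr s x| <= \int[leb]_t phi t.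
Proof.
move=> s0.
have i1 : leb.-integrable setT (EFin \o (fun t => cos (x * t) * phi t * gauss_weight s t)).
  apply: (@integrable_gtr _ phi s x 1) => //; first exact: measurable_stable_cf.
  by move=> t; rewrite (ger0_norm (ltW (stable_cf_gt0 t))) stable_cf_le1.
apply: (le_trans (le_normr_Rintegral measurableT i1)).
apply: le_Rintegral => //.
- by move/integrable_abse : i1.
- exact: integrable_stable_cf.
- move=> t _; rewrite normrM (ger0_norm (ltW (gauss_weight_gt0 _ _))).
  apply: (@le_trans _ _ (`|cos (x * t) * phi t| * 1)).
    by rewrite ler_wpM2l// gauss_weight_le1// ltW.
  by rewrite mulr1 normrM (ger0_norm (ltW (stable_cf_gt0 t))) ler_piMl ?normr_cos_le1// ltW// stable_cf_gt0.
Qed.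

Section uniqueness.
Variable mu : probability R R.
Hypothesis mu_stable : is_sym_stable alpha mu.

Lemma integral_cosM_stable t : \int[mu]_x cos (t * x) = phi t.
Proof. by have /(congr1 (@complex.Re R)) := mu_stable t. Qed.

Lemma integral_sinM_stable t : \int[mu]_x sin (t * x) = 0.
Proof. by have /(congr1 (@complex.Im R)) := mu_stable t. Qed.

Lemma prob_integrable_bounded (f : R -> R) (C : R) : measurable_fun setT f ->
  (forall x, `|f x| <= C) -> mu.-integrable setT (EFin \o f).
Proof.
move=> mf fC; apply: measurable_bounded_integrable => //.
  exact: le_lt_trans (probability_le1 mu measurableT) (ltry _).
exists C; split; first exact: num_real.
by move=> M CM x _ /=; exact: le_trans (fC x) (ltW CM).
Qed.

(* Fubini; the sine part of the characteristic function vanishes. *)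
Lemma gauss_smoothing s x : 0 < s -> \int[mu]_y gauss_fourier s (x - y) = gtr s x.
Proof.
move=> s0.
pose F (z : R * R) : \bar R := (cos ((x - z.1) * z.2) * gauss_weight s z.2)%:E.
have mF : measurable_fun setT F.
  apply/measurable_EFinP; apply: measurable_funM.
    apply: measurableT_comp; first by apply: continuous_measurable_fun; exact: continuous_cos.
    by apply: measurable_funM => //; apply: measurable_funB.
  by apply: measurableT_comp => //; exact: measurable_gauss_weight.
have iF : (mu \x leb)%E.-integrable setT F.
  apply/(integrable12ltyP mu leb mF).
  apply: (@le_lt_trans _ _ (\int[mu]_y (\int[leb]_t (gauss_weight s t)%:E))%E).
    apply: ge0_le_integral => //.
    - by move=> y _; exact: integral_ge0.
    - apply: (measurable_fun_fubini_tonelli_F (m2 := leb) (fun z => `|F z|%E)) => //.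
      exact: measurableT_comp.
    - move=> y _; apply: ge0_le_integral => //.
      + apply: measurableT_comp => //; apply/measurable_EFinP; apply: measurable_funM; [exact: (measurable_cosM (x - y))|exact: measurable_gauss_weight].
      + by apply/measurable_EFinP; exact: measurable_gauss_weight.
      + move=> t _; rewrite lee_fin normrM (ger0_norm (ltW (gauss_weight_gt0 _ _))) ler_piMl ?normr_cos_le1//.
        exact: expR_ge0.
  rewrite integral_gauss_weight// integral_cst//; apply: lte_mul_pinfty => //.
  exact: le_lt_trans (probability_le1 mu measurableT) (ltry _).
have := Fubini iF.
have e1 y : (\int[leb]_t F (y, t) = (gauss_fourier s (x - y))%:E)%E.
  rewrite /gauss_fourier /Rintegral fineK//; apply: integrable_fin_num => //.
  apply: (@integrable_bounded_gauss_weight _ s 1 (fun t => cos ((x - y) * t))) => //; first exact: measurable_cosM.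
  by move=> t; exact: normr_cos_le1.
have e2 t : (\int[mu]_y F (y, t) = (cos (x * t) * phi t * gauss_weight s t)%:E)%E.
  have ic : mu.-integrable setT (EFin \o (fun y => cos (t * y))).
    by apply: (@prob_integrable_bounded _ 1); [exact: measurable_cosM|move=> y; exact: normr_cos_le1].
  have is' : mu.-integrable setT (EFin \o (fun y => sin (t * y))).
    by apply: (@prob_integrable_bounded _ 1); [exact: measurable_sinM|move=> y; exact: normr_sin_le1].
  have -> : (\int[mu]_y F (y, t) = (\int[mu]_y (gauss_weight s t * cos (x * t) * cos (t * y) + gauss_weight s t * sin (x * t) * sin (t * y)))%:E)%E.
    rewrite /Rintegral fineK; last first.
      by apply: integrable_fin_num => //; apply: integrableDR; apply: integrableZR.
    apply: eq_integral => y _; rewrite /F/=; congr EFin.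
    rewrite mulrBl cosB (mulrC y t); ring.
  rewrite RintegralD//; [|exact: integrableZR|exact: integrableZR].
  rewrite !RintegralZl// integral_cosM_stable integral_sinM_stable; congr EFin; ring.
under eq_integral do rewrite e1.
under [in RHS]eq_integral do rewrite e2.
by move=> /(congr1 fine).
Qed.

(** Up to the factor 2 pi, [gtr (s n)] is the density of [mu] smoothed by a Gaussian of width
    proportional to [r n]. As [r n] tends to 0, the integral of [h] against it tends to the
    right-hand side; after the substitution x = r z + y it becomes an average over [mu] of smoothed
    values of [h], which tends to the left-hand side. *)
Lemma integral_stable_continuous (h : R -> R) : continuous h ->
  (forall x, 0 <= h x <= 1) -> leb.-integrable setT (EFin \o h) ->
  \int[mu]_x h x = \int[leb]_x (h x * g x).
Proof.
move=> ch h01 ih.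
have mh : measurable_fun setT h by exact: continuous_measurable_fun.
pose r (n : nat) : R := harmonic n.
have r0 n : 0 < r n by exact: harmonic_gt0.
(* This choice makes [gauss_fourier (s n) (r n * z)] a multiple of e^(-z^2), with factor 2 sqrt(pi)
   / r. *)
pose s n := r n ^+ 2 / 4.
have s0 n : 0 < s n by rewrite divr_gt0// exprn_gt0.
pose K n y := \int[leb]_z (h (r n * z + y) * gauss_weight 1 z).
have mhK n y : measurable_fun setT (fun z => h (r n * z + y)).
  by apply: measurableT_comp => //; exact: measurable_affine.
have hK n y z : `|h (r n * z + y)| <= 1.
  by have /andP[? ?] := h01 (r n * z + y); rewrite ger0_norm.
have iK n y : leb.-integrable setT (EFin \o (fun z => h (r n * z + y) * gauss_weight 1 z)).
  exact: (@integrable_bounded_gauss_weight _ 1 1).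
have pi0 : 0 < Num.sqrt pi :> R by rewrite sqrtr_gt0 pi_gt0.
pose c : R := 2 * Num.sqrt pi.
have c0 : 0 < c by rewrite mulr_gt0.
have gFE n z : gauss_fourier (s n) (r n * z) = c / r n * gauss_weight 1 z.
  rewrite gauss_fourier_E//; congr (_ * _).
    rewrite (_ : pi / s n = (c / r n) ^+ 2).
      by rewrite sqrtr_sqr ger0_norm// divr_ge0// ltW.
    rewrite /c /s expr_div_n exprMn sqr_sqrtr ?pi_ge0//; field; exact: lt0r_neq0.
  rewrite /gauss_weight /s; congr expR; field; exact: lt0r_neq0.
have igw1 : \int[leb]_z gauss_weight 1 z = Num.sqrt pi.
  by rewrite /Rintegral integral_gauss_weight//= divr1.
have igwi := @integrable_gauss_weight R 1 ltr01.
have K_le n y : `|K n y| <= Num.sqrt pi.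
  rewrite -igw1 /K; apply: (le_trans (le_normr_Rintegral measurableT (iK n y))).
  apply: le_Rintegral => //; first by have /integrable_abse := iK n y.
  by move=> z _; rewrite normrM (ger0_norm (ltW (gauss_weight_gt0 _ _))) ler_piMl// ltW// gauss_weight_gt0.
have KE n y : (\int[leb]_z (h (r n * z + y) * gauss_weight 1 z)%:E = (K n y)%:E)%E.
  by rewrite /K /Rintegral fineK//; exact: (integrable_fin_num _ (iK n y)).
have mK n : measurable_fun setT (K n).
  apply/measurable_EFinP.
  rewrite (_ : EFin \o K n = fun y => (\int[leb]_z (h (r n * z + y) * gauss_weight 1 z)%:E)%E); last by apply/funext => y; rewrite KE.
  apply: (measurable_fun_fubini_tonelli_F (m2 := leb) (fun w : R * R => (h (r n * w.2 + w.1) * gauss_weight 1 w.2)%:E)).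
    apply/measurable_EFinP; apply: measurable_funM; last by apply: measurableT_comp => //; exact: measurable_gauss_weight.
    by apply: measurableT_comp => //; apply: measurable_funD => //; exact: measurable_funM.
  move=> w; rewrite lee_fin mulr_ge0 ?expR_ge0//; by have /andP[] := h01 (r n * w.2 + w.1).
have gF0 (s' x : R) : 0 < s' -> 0 <= gauss_fourier s' x by move=> s'0; rewrite gauss_fourier_E// mulr_ge0 ?sqrtr_ge0 ?expR_ge0.
have mgF (s' : R) : 0 < s' -> measurable_fun setT (gauss_fourier s').
  by move=> s'0; apply: continuous_measurable_fun; apply: continuous_cos_transform; exact: integrable_gauss_weight.
have E n : \int[leb]_x (h x * gtr (s n) x) = c * \int[mu]_y K n y.
  rewrite -(RintegralZl _ measurableT (prob_integrable_bounded (mK n) (K_le n))).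
  rewrite /Rintegral; congr fine.
  transitivity (\int[leb]_x \int[mu]_y (h x * gauss_fourier (s n) (x - y))%:E)%E.
    apply: eq_integral => x _; rewrite -gauss_smoothing//.
    have ig : mu.-integrable setT (EFin \o (fun y => gauss_fourier (s n) (x - y))).
      apply: (@prob_integrable_bounded _ (Num.sqrt (pi / s n))).
        by apply: measurableT_comp; [exact: mgF|exact: measurable_funB].
      move=> y; rewrite ger0_norm ?gF0// gauss_fourier_E// ler_piMr ?sqrtr_ge0//.
      by rewrite -[leRHS]expR0 ler_expR oppr_le0 divr_ge0 ?sqr_ge0// mulr_ge0// ltW.
    rewrite -RintegralZl// /Rintegral fineK//.
    exact: (integrable_fin_num _ (integrableZR (h x) ig)).
  transitivity (\int[mu]_y \int[leb]_x (h x * gauss_fourier (s n) (x - y))%:E)%E.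
    apply: (fubini_tonelli (m1 := leb) (m2 := mu) (fun w : R * R => (h w.1 * gauss_fourier (s n) (w.1 - w.2))%:E)).
      apply/measurable_EFinP; apply: measurable_funM; first exact: measurableT_comp.
      by apply: measurableT_comp; [exact: mgF|exact: measurable_funB].
    by move=> w; rewrite lee_fin mulr_ge0 ?gF0//; have /andP[] := h01 w.1.
  apply: eq_integral => y _ /=.
  rewrite (@ge0_integral_affine _ (r n) y)//; last 2 first.
  - apply/measurable_EFinP; apply: measurable_funM => //.
    by apply: measurableT_comp; [exact: mgF|exact: measurable_funB].
  - by move=> x; rewrite lee_fin mulr_ge0 ?gF0//; have /andP[] := h01 x.
  transitivity ((r n)%:E * ((c / r n)%:E * \int[leb]_z (h (r n * z + y) * gauss_weight 1 z)%:E))%E.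
    congr (_ * _)%E; rewrite -ge0_integralZl//; last 3 first.
    - by apply/measurable_EFinP; apply: measurable_funM; [exact: mhK|exact: measurable_gauss_weight].
    - by move=> z _; rewrite lee_fin mulr_ge0 ?expR_ge0//; have /andP[] := h01 (r n * z + y).
    - by rewrite lee_fin divr_ge0// ltW.
    apply: eq_integral => z _; rewrite addrK gFE -EFinM; congr EFin; ring.
  rewrite KE -!EFinM; congr EFin; field; exact: lt0r_neq0.
have cs : s n @[n --> \oo] --> 0.
  rewrite /s -[X in _ --> X](mul0r (4^-1)); apply: cvgM; last exact: cvg_cst.
  by rewrite -[X in _ --> X](mulr0 0) /r; under eq_cvg do rewrite expr2; apply: cvgM; exact: cvg_harmonic.
have c1 : \int[leb]_x (h x * ((2 * pi)^-1 * gtr (s n) x)) @[n --> \oo] --> \int[leb]_x (h x * g x).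
  apply: (@dominated_cvgR _ _ _ leb _ _ (fun x => ((2 * pi)^-1 * \int[leb]_t phi t) * h x)).
  - move=> n; apply: measurable_funM => //; apply: measurable_funM => //.
    exact: measurable_gauss_cos_transform.
  - by move=> x; apply: cvgM; [exact: cvg_cst|exact: cvg_gauss_cos_transform].
  - exact: integrableZR.
  - move=> n x; have /andP[h0 h1] := h01 x.
    rewrite normrM (ger0_norm h0) mulrC ler_wpM2r// normrM (ger0_norm twopi_ge0) ler_wpM2l//.
    exact: gauss_cos_transform_le.
have c2 : \int[mu]_y K n y @[n --> \oo] --> \int[mu]_y (h y * Num.sqrt pi).
  apply: (@dominated_cvgR _ _ _ mu _ _ (fun=> Num.sqrt pi)) => //.
  - move=> y; rewrite -igw1 -RintegralZl//.
    apply: (@dominated_cvgR _ _ _ leb _ _ (gauss_weight 1)) => //.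
    + by move=> n; apply: measurable_funM; [exact: mhK|exact: measurable_gauss_weight].
    + move=> z; apply: cvgM; last exact: cvg_cst.
      apply: continuous_cvg; first exact: ch.
      rewrite -[X in _ --> X]add0r; apply: cvgD; last exact: cvg_cst.
      by rewrite -[X in _ --> X](mul0r z); apply: cvgM; [exact: cvg_harmonic|exact: cvg_cst].
    + move=> n z; rewrite normrM (ger0_norm (ltW (gauss_weight_gt0 _ _))) ler_piMl//.
      exact: ltW (gauss_weight_gt0 _ _).
  - apply: (@prob_integrable_bounded _ (Num.sqrt pi)) => // y.
    by rewrite ger0_norm ?sqrtr_ge0.
have ihm : mu.-integrable setT (EFin \o h).
  apply: (@prob_integrable_bounded _ 1) => // y.
  by have /andP[? ?] := h01 y; rewrite ger0_norm.
rewrite RintegralZr// in c2.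
have c3 : \int[leb]_x (h x * ((2 * pi)^-1 * gtr (s n) x)) @[n --> \oo] --> \int[mu]_y h y.
  have -> : (fun n => \int[leb]_x (h x * ((2 * pi)^-1 * gtr (s n) x))) = (fun n => (2 * pi)^-1 * c * \int[mu]_y K n y).
    apply/funext => n; rewrite -mulrA -E -RintegralZl//; last first.
      apply: (@le_integrable _ _ _ leb setT measurableT _ (EFin \o (fun x => (\int[leb]_t phi t) * h x))) => //.
      - apply/measurable_EFinP; apply: measurable_funM => //; exact: measurable_gauss_cos_transform.
      - move=> x _; rewrite lee_fin !normrM mulrC ler_wpM2r//.
        exact: le_trans (gauss_cos_transform_le _ (s0 n)) (ler_norm _).
      - exact: integrableZR.
    by apply: eq_Rintegral => x _; ring.
  (* The normalisations match: (2 pi)^(-1) times 2 sqrt(pi) times sqrt(pi) is 1. *)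
  rewrite (_ : \int[mu]_y h y = (2 * pi)^-1 * c * (\int[mu]_x h x * Num.sqrt pi)).
    by apply: cvgM; [exact: cvg_cst|exact: c2].
  rewrite /c; have := sqr_sqrtr (pi_ge0 R); rewrite expr2 => {1}<-.
  by field; exact: lt0r_neq0.
exact: cvg_unique c3 c1.
Qed.

(** Open intervals are stable under intersection and generate the Borel sets, so it suffices to
    approximate their indicators by the continuous test functions already treated. *)
Theorem stable_distributionE (A : set R) : measurable A ->
  mu A = (\int[leb]_(x in A) (g x)%:E)%E.
Proof.
have mg := measurable_stable_density.
have gE x : Num.max 0 (g x) = g x by apply/max_idPr/stable_density_ge0.
pose gm : {mfun (measurableTypeR R) >-> R} := mfun_Sub (mem_set mg : (g : measurableTypeR R -> R) \in mfun).
suff H B : measurable B -> mu B = density_measure leb gm B.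
  move=> mA; rewrite H//; apply: eq_integral => x _; congr EFin; exact: gE.
move=> mB.
have mid : measurable_fun setT (idfun : R -> measurableTypeR R) by move=> ? Y mY; rewrite setTI.
pose idm : {mfun R >-> measurableTypeR R} := mfun_Sub (mem_set mid : (idfun : R -> measurableTypeR R) \in mfun).
apply: (@measure_unique _ R (measurableTypeR R) (@RGenOpens.G R) (fun k : nat => `]- k%:R, k%:R[%classic) _ _ _ _
  (distribution mu idm) (density_measure leb gm)) => //.
- exact: RGenOpens.measurableE.
- move=> _ _ [a [b ->]] [c [d ->]]; exists (Num.max a c), (Num.min b d).
  by apply/seteqP; split => x /=; rewrite !in_itv/= gt_max lt_min => H; lra.
- by move=> k; exists (- k%:R), k%:R.
- apply/seteqP; split => // x _; exists (Num.truncn `|x|).+1 => //=.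
  by rewrite in_itv/= -ltr_norml truncnS_gt.
- move=> _ [a [b ->]]; have [ab|ba] := ltP a b; last by rewrite set_itv_ge ?measure0// bnd_simp -leNgt.
  (* [u] is twice the positive part of (x - a)(b - x). Hence [h n] is continuous, vanishes outside
     [a, b] and tends to the indicator of the open interval. *)
  pose u x := (x - a) * (b - x) + `|(x - a) * (b - x)|.
  have u0 x : 0 <= u x by rewrite /u -lerBlDl sub0r -normrN ler_norm.
  pose h (n : nat) x := u x / (u x + harmonic n).
  have d0 n x : 0 < u x + harmonic n by rewrite ltr_wpDl// harmonic_gt0.
  have h01 n x : 0 <= h n x <= 1.
    rewrite divr_ge0//; last exact: ltW.
    by rewrite ler_pdivrMr// mul1r lerDl ltW// harmonic_gt0.
  have cu : continuous u.
    have cp : continuous (fun x : R => (x - a) * (b - x)).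
      by move=> x; apply: cvgM; apply: cvgB => //; exact: cvg_cst.
    by move=> x; apply: cvgD; [exact: cp|apply: cvg_norm; exact: cp].
  have ch n : continuous (h n).
    move=> x; apply: cvgM; first exact: cu.
    apply: cvgV; first by rewrite gt_eqF.
    by apply: cvgD; [exact: cu|exact: cvg_cst].
  have u_out x : x \notin (`[a, b]%classic : set R) -> u x = 0.
    rewrite notin_setE/= in_itv/= => H.
    have [xa|ax] := ltP x a; first by rewrite /u ler0_norm ?subrr//; nra.
    have [bx|xb] := ltP b x; first by rewrite /u ler0_norm ?subrr//; nra.
    by case: H; rewrite ax.
  have hle n x : h n x <= \1_(`[a, b]%classic : set R) x.
    rewrite indicE; case: (boolP (x \in _)) => H; first by have /andP[] := h01 n x.
    by rewrite /h u_out// mul0r.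
  have i1 : leb.-integrable setT (EFin \o (\1_(`[a, b]%classic : set R) : R -> R)).
    exact: (@integrable_indic_itv R a b true false).
  have ih n : leb.-integrable setT (EFin \o h n).
    apply: (@le_integrable _ _ _ leb setT measurableT _ (EFin \o (\1_(`[a, b]%classic : set R) : R -> R))) => //.
      by apply/measurable_EFinP; apply: continuous_measurable_fun; exact: ch.
    move=> x _ /=; rewrite lee_fin; apply: le_trans (ler_norm _).
    by rewrite ger0_norm//; have /andP[] := h01 n x.
  have cvh x : h n x @[n --> \oo] --> (\1_(`]a, b[%classic : set R) x : R).
    have [ux|ux] := eqVneq (u x) 0.
      rewrite indicE memNset; last first.
        rewrite /= in_itv/= => /andP[ax xb].
        have : 0 < u x by rewrite /u ltr_wpDr// mulr_gt0// subr_gt0.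
        by rewrite ux ltxx.
      by apply: cvg_near_cst; apply: nearW => n; rewrite /h ux mul0r.
    rewrite indicE mem_set; last first.
      rewrite /= in_itv/=; apply/andP; split; rewrite ltNge; apply/negP => H; move/eqP: ux; apply;
      rewrite /u; have [H'|H'] := leP 0 ((x - a) * (b - x)); rewrite ?(ler0_norm (ltW H')) ?subrr//; rewrite ?(ger0_norm H'); nra.
    rewrite -(divff ux); apply: cvgM; first exact: cvg_cst.
    apply: cvgV => //; rewrite -[u x in X in _ --> X]addr0.
    by apply: cvgD; [exact: cvg_cst|exact: cvg_harmonic].
  have c1 : \int[mu]_x h n x @[n --> \oo] --> \int[mu]_x (\1_(`]a, b[%classic : set R) x).
    apply: (@dominated_cvgR _ _ _ mu _ _ (fun=> 1)) => //.
    - by move=> n; apply: continuous_measurable_fun; exact: ch.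
    - by apply: (@prob_integrable_bounded _ 1) => // x; rewrite normr1.
    - by move=> n x; have /andP[? ?] := h01 n x; rewrite ger0_norm.
  have c2 : \int[mu]_x h n x @[n --> \oo] --> \int[leb]_x (\1_(`]a, b[%classic : set R) x * g x).
    under eq_cvg do rewrite integral_stable_continuous//.
    apply: (@dominated_cvgR _ _ _ leb _ _ (fun x => g 0 * \1_(`[a, b]%classic : set R) x)) => //.
    - by move=> n; apply: measurable_funM => //; apply: continuous_measurable_fun; exact: ch.
    - by move=> x; apply: cvgM; [exact: cvh|exact: cvg_cst].
    - exact: integrableZR.
    - move=> n x; have /andP[hn0 _] := h01 n x.
      rewrite normrM (ger0_norm hn0) (ger0_norm (stable_density_ge0 _)) mulrC.
      by rewrite ler_pM ?stable_density_ge0 ?stable_density_le0.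
  have := cvg_unique _ c1 c2.
  rewrite /Rintegral integral_indic// setIT => E.
  have iab : leb.-integrable setT (EFin \o (fun x => \1_(`]a, b[%classic : set R) x * g x)).
    apply: (@le_integrable _ _ _ leb setT measurableT _ (EFin \o (fun x => g 0 * \1_(`]a, b[%classic : set R) x))) => //.
    - apply/measurable_EFinP; apply: measurable_funM => //; exact: measurable_indic.
    - move=> x _ /=; rewrite lee_fin (normrM _ (g x)) (normrM (g 0)) mulrC ler_wpM2r//.
      by rewrite (ger0_norm (stable_density_ge0 x)) (ger0_norm (stable_density_ge0 0)) stable_density_le0.
    - by apply: integrableZR; exact: (@integrable_indic_itv R a b false true).
  rewrite -[LHS]fineK; last exact: fin_num_measure.
  transitivity (fine (\int[leb]_x (\1_(`]a, b[%classic : set R) x * g x)%:E)%E)%:E; first by congr EFin; exact: E.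
  rewrite fineK; last exact: integrable_fin_num.
  rewrite /density_measure [RHS]integral_mkcond; apply: eq_integral => x _.
  rewrite /patch indicE; case: ifPn => _; last by rewrite mul0r.
  by rewrite mul1r; congr EFin; rewrite -[LHS]gE.
- by move=> k; apply: (@le_lt_trans _ _ 1%E); [exact: probability_le1|exact: ltry].
Qed.
End uniqueness.

End inversion.

(** * Resampling the sign along one edge *)

Section integral_reflect.
Variable R : realType.
Notation leb := (@lebesgue_measure R).

Lemma ge0_integral_reflect (b : R) (f : R -> \bar R) :
  measurable_fun setT f -> (forall x, 0 <= f x)%E ->
  (\int[leb]_x f x = \int[leb]_x f (- x + b)%R)%E.
Proof.
move=> mf f0.
rewrite (@ge0_integral_affine R 1 b)// mul1e.
rewrite ge0_integralN//; last first.
  by apply: measurableT_comp => //; exact: measurable_affine.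
by apply: eq_integral => x _; rewrite mul1r.
Qed.
End integral_reflect.

Section unimodal_law.
Variables (R : realType) (mu : probability R R) (g : R -> R).
Notation leb := (@lebesgue_measure R).
Hypotheses (mg : measurable_fun setT g) (g0 : forall x, 0 <= g x)
  (gN : forall x, g (- x) = g x) (gle : forall x y, 0 <= x -> x <= y -> g y <= g x)
  (muE : forall A, measurable A -> mu A = (\int[leb]_(x in A) (g x)%:E)%E).

Lemma unimodal_atomless x : mu [set x] = 0%E.
Proof. by rewrite muE// integral_set1. Qed.

Lemma unimodal_lawN (A : set R) : measurable A -> mu [set x | A (- x)] = mu A.
Proof.
move=> mA.
have mA' : measurable [set x | A (- x)].
  rewrite -[X in measurable X]setTI.
  by have := @oppr_measurable R setT; apply.
rewrite !muE// [RHS]integral_mkcond [LHS]integral_mkcond [RHS]ge0_integralN//; last 2 first.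
- apply/(measurable_restrictT _ _).1 => //; apply/measurable_EFinP.
  exact: measurable_funTS.
- by move=> x; rewrite /patch; case: ifP => // _; rewrite lee_fin.
by apply: eq_integral => x _; rewrite /patch gN.
Qed.

(** The two open half-lines have equal mass by symmetry, and 0 is not an atom. This makes the sign
    of an innovation a fair coin. *)
Lemma unimodal_gt0 : mu [set x | 0 < x] = (2^-1)%:E.
Proof.
have m1 : measurable [set x : R | 0 < x] by rewrite -set_itvoy.
have e : mu [set x | x < 0] = mu [set x | 0 < x].
  rewrite -[RHS]unimodal_lawN//; congr (mu _).
  by apply/seteqP; split => x /=; rewrite oppr_gt0.
have m2 : measurable [set x : R | x < 0] by rewrite -set_itvNyo.
have : (mu [set x | (x < 0)%R] + mu [set 0%R] + mu [set x | (0 < x)%R])%E = 1%E.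
  rewrite -measureU//; last first.
    by rewrite -subset0 => x [/= + x0]; rewrite x0 ltxx.
  rewrite -measureU//; last 2 first.
  - exact: measurableU.
  - rewrite -subset0 => x [/= [x0|->] y0]; last by rewrite ltxx in y0.
    by have := lt_trans x0 y0; rewrite ltxx.
  rewrite (_ : _ `|` _ = setT); first exact: probability_setT.
  apply/seteqP; split => // x _ /=.
  by case: (ltgtP x 0) => ?; [left; left|right|left; right].
rewrite e unimodal_atomless adde0.
have : mu [set x | 0 < x] \is a fin_num by exact: fin_num_measure.
case: (mu _) => [r| |] // _; rewrite -EFinD => -[/eqP h]; congr EFin; move/eqP: h; lra.
Qed.

Definition law_cdf (x : R) : R := fine (mu `]-oo, x]%classic).

Lemma law_cdfE x : mu `]-oo, x]%classic = (law_cdf x)%:E.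
Proof. by rewrite fineK// fin_num_measure. Qed.

Lemma law_cdf_nd x y : x <= y -> law_cdf x <= law_cdf y.
Proof.
move=> xy; rewrite -lee_fin -!law_cdfE.
by apply: le_measure; rewrite ?inE//; apply: subset_itvl; rewrite bnd_simp.
Qed.

Lemma law_cdf_le1 x : law_cdf x <= 1.
Proof. by rewrite -lee_fin -law_cdfE probability_le1. Qed.

Lemma measurable_law_cdf : measurable_fun setT law_cdf.
Proof. by apply: nondecreasing_measurable => // x y; exact: law_cdf_nd. Qed.

(** By symmetry and monotonicity [g 0] bounds the density. This is the continuity behind
    [law_cdf_uniform]. *)
Lemma law_cdf_lipschitz x y : x <= y -> law_cdf y <= law_cdf x + g 0 * (y - x).
Proof.
move=> xy; rewrite -lee_fin EFinD -!law_cdfE.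
have -> : `]-oo, y]%classic = `]-oo, x]%classic `|` `]x, y]%classic :> set R.
  apply/seteqP; split => z /=; rewrite !in_itv/=; case: (leP z x) => zx /=.
  - by left.
  - by right.
  - by move=> _; exact: le_trans xy.
  - by case.
have H : (mu (`]-oo, x] `|` `]x, y]) <= mu `]-oo, x]%classic + mu `]x, y]%classic)%E by exact: measureU2.
apply: (le_trans H); rewrite leeD2l// muE//.
apply: (@le_trans _ _ (\int[leb]_(z in `]x, y]) (g 0)%:E)%E).
  apply: ge0_le_integral => //.
  - by move=> z _; rewrite lee_fin.
  - by apply/measurable_EFinP; exact: measurable_funTS.
  - move=> z _; rewrite lee_fin; have [z0|/ltW z0] := leP 0 z; first exact: gle.
    by rewrite -gN gle// oppr_ge0.
rewrite integral_cst//.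
have E : leb (`]x, y]%classic : set R) = (y - x)%:E.
  rewrite lebesgue_measure_itv/= lte_fin; case: ltP => [_|yx]; first by rewrite -EFinB.
  by rewrite (_ : y = x) ?subrr//; apply/eqP; rewrite eq_le xy yx.
rewrite EFinM -E; exact: lexx.
Qed.

Lemma law_cdf_cvg1 : law_cdf n%:R @[n --> \oo] --> (1 : R).
Proof.
apply: fine_cvg.
have -> : (1 : R)%:E = mu (\bigcup_n `]-oo, n%:R]%classic).
  rewrite (_ : \bigcup_n _ = setT); first by rewrite -[LHS](@probability_setT _ _ _ mu).
  apply/seteqP; split => // x _; exists (Num.truncn `|x|).+1 => //=.
  rewrite in_itv/=; apply: le_trans (ler_norm _) _; apply: ltW; exact: truncnS_gt.
apply: (@nondecreasing_cvg_mu _ _ _ mu (fun n : nat => `]-oo, n%:R]%classic)) => //.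
  by apply: bigcup_measurable => k _.
by move=> m n mn; apply/subsetPset; apply: subset_itvl; rewrite bnd_simp ler_nat.
Qed.

Lemma law_cdf_cvg0 : law_cdf (- n%:R) @[n --> \oo] --> (0 : R).
Proof.
apply: fine_cvg.
have E : \bigcap_n `]-oo, - n%:R]%classic = set0 :> set R.
  apply/seteqP; split => // x /(_ (Num.truncn `|x|).+1 I) /=; rewrite in_itv/= leNgt => /negP; apply.
  by rewrite ltrNl; apply: le_lt_trans (truncnS_gt _); rewrite -normrN ler_norm.
rewrite -[X in _ --> X](measure0 mu) -E.
apply: (@nonincreasing_cvg_mu _ _ _ mu (fun n : nat => `]-oo, - n%:R]%classic)) => //.
- by apply: (@le_lt_trans _ _ 1%E); [exact: probability_le1|exact: ltry].
- by rewrite E.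
- by move=> m n mn; apply/subsetPset; apply: subset_itvl; rewrite bnd_simp lerN2 ler_nat.
Qed.

(** The probability integral transform. For q < 1 a nonempty sublevel set is a half-line ending at
    its supremum, where continuity forces the value [q]; an empty one forces q = 0. *)
Lemma law_cdf_uniform (q : R) : 0 <= q <= 1 -> mu [set w | law_cdf w <= q] = q%:E.
Proof.
move=> /andP[q0]; rewrite le_eqVlt => /predU1P[->|q1].
  rewrite (_ : [set _ | _] = setT); first exact: probability_setT.
  by apply/seteqP; split => // x _; exact: law_cdf_le1.
set S := [set w | _].
have [n nq] : exists n : nat, q < law_cdf n%:R.
  apply: contrapT => H.
  have : 1 <= q.
    apply: (cvgr_to_le law_cdf_cvg1); apply: nearW => n; rewrite leNgt; apply/negP => ?.
    by apply: H; exists n.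
  by rewrite leNgt q1.
have ubS : ubound S n%:R.
  move=> w /= wq; rewrite leNgt; apply/negP => /ltW /law_cdf_nd nw.
  by have := le_lt_trans (le_trans nw wq) nq; rewrite ltxx.
have: S = set0 \/ S !=set0 by case: (eqVneq S set0) => [|/set0P]; [left|right].
move=> [S0|[w0 Sw0]].
  rewrite S0 measure0; congr EFin; apply/eqP; rewrite eq_le q0 /=.
  apply: (cvgr_to_ge law_cdf_cvg0); apply: nearW => k; rewrite leNgt; apply/negP => /ltW kq.
  by have : S (- k%:R) by []; rewrite S0.
have hS : has_sup S by split; [exists w0|exists n%:R].
have g1 : 0 < g 0 + 1 by rewrite ltr_wpDl.
have F1 : law_cdf (sup S) <= q.
  rewrite leNgt; apply/negP => Fq.
  (* Over the distance [dl] the function [law_cdf] varies by less than the gap. The 1 added to [g 0]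
     keeps the denominator positive. *)
  pose dl := (law_cdf (sup S) - q) / (g 0 + 1).
  have dl0 : 0 < dl by rewrite divr_gt0// subr_gt0.
  have [w Sw] := sup_adherent dl0 hS.
  move=> /ltW /law_cdf_nd Hw.
  have := @law_cdf_lipschitz (sup S - dl) (sup S).
  rewrite lerBlDr lerDl (ltW dl0) => /(_ isT).
  rewrite (_ : sup S - (sup S - dl) = dl); last by ring.
  have : dl * (g 0 + 1) = law_cdf (sup S) - q by rewrite /dl mulfVK// gt_eqF.
  move: Sw; rewrite /S/= => Sw; nra.
have F2 : q <= law_cdf (sup S).
  rewrite leNgt; apply/negP => Fq.
  pose dl := (q - law_cdf (sup S)) / (g 0 + 1).
  have dl0 : 0 < dl by rewrite divr_gt0// subr_gt0.
  have : S (sup S + dl).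
    rewrite /S/=; apply: (le_trans (@law_cdf_lipschitz (sup S) _ _)); first by rewrite lerDl ltW.
    have : dl * (g 0 + 1) = q - law_cdf (sup S) by rewrite /dl mulfVK// gt_eqF.
    rewrite addrAC subrr add0r; nra.
  by move/(sup_upper_bound hS); rewrite gerDl leNgt dl0.
rewrite (_ : S = `]-oo, sup S]%classic).
  by rewrite law_cdfE; congr EFin; apply/eqP; rewrite eq_le F1.
apply/seteqP; split => w /=; rewrite in_itv/=.
  exact: sup_upper_bound.
by move=> /law_cdf_nd H; exact: le_trans F1.
Qed.

(** The multiplied form covers p = 0, which matters because [p] will be the density at [u], possibly
    zero. *)
Lemma law_cdf_scaled_uniform (p r : R) : 0 <= r -> r <= p ->
  (p%:E * mu [set w | (law_cdf w * p <= r)%R] = r%:E)%E.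
Proof.
move=> r0 rp; have [p0|p0] := eqVneq p 0.
  by rewrite p0 mul0e; congr EFin; apply/eqP; rewrite eq_le r0/= -p0.
have {}p0 : 0 < p by rewrite lt_neqAle eq_sym p0 (le_trans r0).
rewrite (_ : [set _ | _] = [set w | law_cdf w <= r / p]); last first.
  by apply/seteqP; split => w /=; rewrite ler_pdivlMr.
rewrite law_cdf_uniform; last by rewrite divr_ge0 ?(ltW p0)//= ler_pdivrMr// mul1r.
by rewrite -EFinM mulrC divfK// gt_eqF.
Qed.

Lemma product_density d (Q : measurableType d) (M : probability Q R) (K : set (R * Q)) :
  measurable K -> (mu \x M)%E K = (\int[leb]_u ((g u)%:E * M (xsection K u)))%E.
Proof.
move=> mK.
have mI : measurable_fun setT (EFin \o \1_K : R * Q -> \bar R).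
  by apply/measurable_EFinP; exact: measurable_indic.
have -> : (mu \x M)%E K = (\int[M]_q \int[mu]_u (\1_K (u, q))%:E)%E.
  transitivity (\int[mu \x M]_z (EFin \o \1_K) z)%E; first by rewrite integral_indic// setIT.
  rewrite (fubini_tonelli2 (EFin \o \1_K))//.
  by move=> z; rewrite lee_fin.
have mKy q : measurable (ysection K q) by exact: measurable_ysection.
have E1 q : (\int[mu]_u (\1_K (u, q))%:E = \int[leb]_u (g u * \1_K (u, q))%:E)%E.
  transitivity (mu (ysection K q)).
    rewrite -[X in mu X]setIT -integral_indic//; apply: eq_integral => u _.
    by rewrite !indicE; congr (_%:R%:E); rewrite mem_ysection.
  rewrite muE// integral_mkcond; apply: eq_integral => u _.
  by rewrite /patch mem_ysection indicE; case: ifP => _; rewrite ?mulr1// mulr0.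
under eq_integral do rewrite E1.
rewrite -(fubini_tonelli (m1 := leb) (m2 := M) (fun z => (g z.1 * \1_K z)%:E)); last 2 first.
- apply/measurable_EFinP; apply: measurable_funM; last exact: measurable_indic.
  by apply: measurableT_comp.
- by move=> z; rewrite lee_fin mulr_ge0.
apply: eq_integral => u _.
have mKx : measurable (xsection K u) by exact: measurable_xsection.
transitivity (\int[M]_q ((g u)%:E * (\1_(xsection K u) q)%:E))%E.
  by apply: eq_integral => q _; rewrite -EFinM !indicE mem_xsection.
rewrite ge0_integralZl//.
- by rewrite integral_indic// setIT.
- by apply/measurable_EFinP; exact: measurable_indic.
- by rewrite lee_fin.
Qed.

Definition bsign (b : bool) : R := if b then 1 else -1.

(* As [law_cdf w] is uniform, given the two values [t] and [y = t + c * u] the edge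
   is open with probability 1 - g ((|y| + |t|) / c) / g u: this is nonnegative
   because |u| <= (|y| + |t|) / c, and it vanishes when [t] and [y] have opposite
   signs. *)
Definition open_edge (c t u w : R) : bool :=
  g ((`|t + c * u| + `|t|) / c) < law_cdf w * g u.

Definition resampled_sign (c t : R) (s : bool) (u w v : R) : bool :=
  if open_edge c t u w then s else 0 < v.

(** The innovation that leads from the parent's contribution with its sign reset to [s], namely
    [bsign s * |t|], to the value at the vertex with its sign resampled. *)
Definition resampled_innovation (c t : R) (s : bool) (u w v : R) : R :=
  (bsign (resampled_sign c t s u w v) * `|t + c * u| - bsign s * `|t|) / c.

Lemma measurable_bsign : measurable_fun setT bsign.
Proof. by move=> _ Y mY. Qed.

Section measurability.
Variables (d : measure_display) (T : measurableType d).
Variables (t u w v : T -> R) (s : T -> bool) (c : R).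
Hypotheses (mt : measurable_fun setT t) (mu_ : measurable_fun setT u)
  (mw : measurable_fun setT w) (mv : measurable_fun setT v) (ms : measurable_fun setT s).

Let mnormt : measurable_fun setT (fun x => `|t x|).
Proof. by apply: measurableT_comp. Qed.

Let mnormy : measurable_fun setT (fun x => `|t x + c * u x|).
Proof.
apply: measurableT_comp => //; apply: measurable_funD => //; exact: measurable_funM.
Qed.

Lemma measurable_open_edge : measurable_fun setT (fun x => open_edge c (t x) (u x) (w x)).
Proof.
apply: measurable_fun_ltr.
  apply: measurableT_comp => //; apply: measurable_funM => //; exact: measurable_funD.
by apply: measurable_funM; apply: measurableT_comp => //; exact: measurable_law_cdf.
Qed.

Lemma measurable_resampled_sign :
  measurable_fun setT (fun x => resampled_sign c (t x) (s x) (u x) (w x) (v x)).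
Proof.
apply: measurable_fun_ifT => //; first exact: measurable_open_edge.
exact: measurable_fun_ltr.
Qed.

Lemma measurable_resampled_innovation :
  measurable_fun setT (fun x => resampled_innovation c (t x) (s x) (u x) (w x) (v x)).
Proof.
apply: measurable_funM => //; apply: measurable_funB; apply: measurable_funM => //.
  by apply: measurableT_comp; [exact: measurable_bsign|exact: measurable_resampled_sign].
by apply: measurableT_comp; [exact: measurable_bsign|].
Qed.
End measurability.

Lemma abs_bsign (y : R) : exists b, `|y| = bsign b * y.
Proof.
have [y0|y0] := leP 0 y; [exists true|exists false]; rewrite /bsign ?mul1r ?mulN1r//.
  by rewrite ger0_norm.
by rewrite ltr0_norm.
Qed.

(** For fixed [u] the mass [g u] splits into g u - g m on the open event, where the new innovation
    is [z s], and g m on the closed event, shared evenly by [z true] and [z false]. Keeping the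
    factor [g u] on the left avoids dividing by a density that may vanish. *)
Lemma resampled_slice (c t : R) (s : bool) (u : R) (A : set R) : 0 < c -> measurable A ->
  let z b := (bsign b * `|t + c * u| - bsign s * `|t|) / c in
  let m := (`|t + c * u| + `|t|) / c in
  ((g u)%:E * (mu \x mu) [set q | A (resampled_innovation c t s u q.1 q.2)] =
   ((g u - g m) * \1_A (z s) + g m * (2^-1 * (\1_A (z true) + \1_A (z false))))%:E)%E.
Proof.
move=> c0 mA z m.
have gmu : g m <= g u.
  have um : `|u| <= m.
    rewrite /m ler_pdivlMr// -{1}(gtr0_norm c0) -normrM.
    rewrite (_ : u * c = (t + c * u) - t); last by ring.
    exact: ler_normB.
  have gu : g u = g `|u| by case: (ger0P u) => // _; rewrite gN.
  by rewrite gu; apply: gle um.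
pose E0 := [set w | law_cdf w * g u <= g m].
have mE0 : measurable E0.
  rewrite -[E0]setTI; apply: (measurable_fun_le (f := fun w => law_cdf w * g u) (g := fun=> g m)) => //.
  by apply: measurable_funM => //; exact: measurable_law_cdf.
have E0E : ((g u)%:E * mu E0 = (g m)%:E)%E by exact: law_cdf_scaled_uniform.
have E1E : ((g u)%:E * mu (~` E0) = (g u - g m)%:E)%E.
  rewrite probability_setC//.
  have : mu E0 \is a fin_num by exact: fin_num_measure.
  move: E0E; case: (mu E0) => [r| |] // E _; rewrite -EFinB -EFinM; congr EFin.
  by rewrite mulrBr mulr1; congr (_ - _); case: E.
(* Off [E0] the edge is open and the sign [s] is kept; on [E0] a coin decides. *)
pose V1 := if z s \in A then setT else set0 : set R.
pose V0 := [set v : R | A (z (0 < v))].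
have mpos : measurable [set v : R | 0 < v] by rewrite -set_itvoy.
have mneg : measurable (~` [set v : R | 0 < v]) by exact: measurableC.
have muneg : mu (~` [set v : R | 0 < v]) = (2^-1)%:E.
  rewrite probability_setC// unimodal_gt0// -EFinB; congr EFin; lra.
have [mV0 V0E] : measurable V0 /\ mu V0 = (2^-1 * (\1_A (z true) + \1_A (z false)))%:E.
  rewrite !indicE; case: (boolP (z true \in A)) => h1; case: (boolP (z false \in A)) => h2 /=.
  - rewrite (_ : V0 = setT); first by split => //; rewrite [LHS]probability_setT; congr EFin; lra.
    apply/seteqP; split => // v _; rewrite /V0/=; case: (0 < v); exact/set_mem.
  - rewrite (_ : V0 = [set v | 0 < v]); first by rewrite unimodal_gt0//; split => //; congr EFin; lra.
    apply/seteqP; split => v; rewrite /V0/=; case: (0 < v) => //.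
      by move/mem_set; rewrite (negbTE h2).
    by move=> _; exact/set_mem.
  - rewrite (_ : V0 = ~` [set v | 0 < v]); first by split => //; rewrite muneg; congr EFin; lra.
    apply/seteqP; split => v; rewrite /V0/=; case: (0 < v) => //.
      by move/mem_set; rewrite (negbTE h1).
    by move=> _; exact/set_mem.
  - rewrite (_ : V0 = set0); first by split => //; rewrite measure0; congr EFin; lra.
    apply/seteqP; split => v //; rewrite /V0/=; case: (0 < v) => /mem_set.
      by rewrite (negbTE h1).
    by rewrite (negbTE h2).
have mV1 : measurable V1 by rewrite /V1; case: ifP.
have -> : [set q | A (resampled_innovation c t s u q.1 q.2)] = (~` E0 `*` V1) `|` (E0 `*` V0).
  apply/seteqP; split => -[w v] /=.
    rewrite /resampled_innovation /resampled_sign /open_edge -/m.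
    case: (ltP (g m) (law_cdf w * g u)) => h H.
      by left; split; [rewrite /E0/=; apply/negP; rewrite -ltNge|rewrite /V1 mem_set].
    by right.
  rewrite /resampled_innovation /resampled_sign /open_edge -/m.
  move=> [[/negP + H]|[]]; rewrite -?ltNge => h; rewrite ?h.
    by move: H; rewrite /V1; case: ifP => // /set_mem.
  by rewrite ltNge h.
have -> : ((mu \x mu) ((~` E0 `*` V1) `|` (E0 `*` V0)) = mu (~` E0) * mu V1 + mu E0 * mu V0)%E.
  have mCE0 : measurable (~` E0) by exact: measurableC.
  rewrite -!product_measure1E//.
  apply: (@measureU _ _ _ (mu \x mu : probability (R * R)%type R)%E); [exact: measurableX|exact: measurableX|].
  by rewrite -subset0 => -[w v] /= [[h _] [h' _]]; exact: h.
rewrite ge0_muleDr ?mule_ge0 ?measure_ge0// !muleA E0E E1E V0E.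
have -> : mu V1 = (\1_A (z s))%:E.
  by rewrite /V1 indicE; case: (z s \in A); [rewrite [LHS]probability_setT|rewrite measure0].
by rewrite -!EFinM -EFinD.
Qed.

Lemma resampled_innovation_law (c t : R) (s : bool) (A : set R) : 0 < c -> measurable A ->
  (mu \x (mu \x mu))%E [set q | A (resampled_innovation c t s q.1 q.2.1 q.2.2)] = mu A.
Proof.
move=> c0 mA.
set K := [set q | _].
have mK : measurable K.
  have m2 : measurable_fun setT (fun q : R * (R * R) => q.2.1) by exact: measurableT_comp.
  have m3 : measurable_fun setT (fun q : R * (R * R) => q.2.2) by exact: measurableT_comp.
  have := @measurable_resampled_innovation _ _ (fun=> t) (fun q : R * (R * R) => q.1) (fun q => q.2.1) (fun q => q.2.2) (fun=> s) c
    (measurable_cst _) measurable_fst m2 m3 (measurable_cst _) measurableT _ mA.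
  by rewrite setTI.
rewrite (@product_density _ _ (mu \x mu)%E)//.
set G1 : R -> \bar R := fun u => ((g u)%:E * (mu \x mu)%E (xsection K u))%E.
have [bt tE] := abs_bsign t.
(* [e] is 1 if the reset sign agrees with that of [t] and -1 otherwise. In the second case the whole
   picture is reflected, so the comparison is with the law of e u, which equals that of u by
   symmetry. *)
pose e := bsign s * bsign bt.
have mG1 : measurable_fun setT G1.
  apply: emeasurable_funM; first exact/measurable_EFinP.
  have H := measurable_fun_xsection (mu \x mu : probability (R * R)%type R)%E mK.
  rewrite (_ : (fun x => _) = (mu \x mu)%E \o xsection K); last by [].
  exact: H.
have G10 u : (0 <= G1 u)%E by rewrite mule_ge0// lee_fin.
pose G2 u : \bar R := (g u * \1_A (e * u))%:E.
have ee : e = 1 \/ e = -1.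
  by rewrite /e /bsign; case: (s); case: (bt); rewrite ?mulrNN ?mulr1 ?mul1r ?mulN1r; tauto.
have mG2 : measurable_fun setT G2.
  apply/measurable_EFinP; apply: measurable_funM => //.
  have mI : measurable_fun setT (\1_A : R -> R) by exact: measurable_indic.
  by apply: (measurableT_comp mI); exact: measurable_funM.
have G20 u : (0 <= G2 u)%E by rewrite lee_fin mulr_ge0.
have muG2 : mu A = (\int[leb]_u G2 u)%E.
  rewrite muE// integral_mkcond.
  have P1 : (\int[leb]_u ((fun u => (g u)%:E) \_ A) u = \int[leb]_u (g u * \1_A u)%:E)%E.
    by apply: eq_integral => u _; rewrite /patch indicE; case: ifP => _; rewrite ?mulr1 ?mulr0.
  rewrite P1 /G2; case: ee => ->; first by apply: eq_integral => u _; rewrite mul1r.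
  rewrite ge0_integralN//.
  - by apply: eq_integral => u _; rewrite gN mulN1r.
  - apply/measurable_EFinP; apply: measurable_funM => //; exact: measurable_indic.
  - by move=> u; rewrite lee_fin mulr_ge0.
pose b := - (2 * t / c).
(* The reflection exchanges the innovations leading from [t] to [y] and to [- y],
   and the law of the new innovation is preserved on each such pair. *)
have key u : (G1 u + G1 (- u + b)%R = G2 u + G2 (- u + b)%R)%E.
  pose y := t + c * u.
  have cn0 : c != 0 by rewrite gt_eqF.
  have [b2 yE] := abs_bsign y.
  have slice u' : xsection K u' = [set q | A (resampled_innovation c t s u' q.1 q.2)].
    by apply/seteqP; split => q; rewrite /xsection/= inE.
  have yr : t + c * (- u + b) = - y by rewrite /b /y; field.
  rewrite /G1 !slice !resampled_slice// yr normrN -/y /G2 -!EFinD; congr EFin.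
  pose J (r : R) : R := \1_A ((r * y - e * t) / c).
  have zJ b0 : \1_A ((bsign b0 * `|y| - bsign s * `|t|) / c) = J (bsign b0 * bsign b2).
    by rewrite yE tE /J; congr (\1_A (_ / _)); rewrite /e; ring.
  have e1 : \1_A (e * u) = J e.
    by rewrite /J; congr (\1_A _); rewrite /y; field.
  have e2 : \1_A (e * (- u + b)) = J (- e).
    by rewrite /J; congr (\1_A _); rewrite /y /b; field.
  have gu : g u = g ((y - t) / c) by congr g; rewrite /y; field.
  have gru : g (- u + b) = g ((y + t) / c).
    by rewrite -gN; congr g; rewrite /y /b; field.
  have gm : g ((`|y| + `|t|) / c) = if b2 == bt then g ((y + t) / c) else g ((y - t) / c).
    rewrite yE tE /bsign; case: (b2); case: (bt) => /=; rewrite ?mul1r ?mulN1r//.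
    - by rewrite -gN; congr g; field.
    - by rewrite -gN; congr g; field.
  rewrite !zJ e1 e2 gu gru gm /e /bsign.
  by case: (s); case: (bt); case: (b2); rewrite /= ?(mulr1, mul1r, mulN1r, mulrN1, opprK); field.
rewrite muG2.
(* The pointwise identity holds only for sums over reflected pairs, so after integration both sides
   appear doubled; finiteness allows halving them. *)
have I2 : (\int[leb]_u G1 u + \int[leb]_u G1 u = \int[leb]_u G2 u + \int[leb]_u G2 u)%E.
  have refl G : measurable_fun setT G -> (forall u, 0 <= G u)%E ->
      (\int[leb]_u G u + \int[leb]_u G u = \int[leb]_u (G u + G (- u + b)%R))%E.
    move=> mG G0; rewrite ge0_integralD//.
      by congr (_ + _)%E; rewrite [LHS](@ge0_integral_reflect _ b).
    by apply: measurableT_comp => //; apply: measurable_funD.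
  by rewrite !refl//; apply: eq_integral => u _; rewrite key.
have : (\int[leb]_u G2 u)%E \is a fin_num by rewrite -muG2 fin_num_measure.
move: I2; have : (0 <= \int[leb]_u G1 u)%E by exact: integral_ge0.
case: (\int[leb]_u G1 u)%E => [r1| |]; case: (\int[leb]_u G2 u)%E => [r2| |] //=.
move=> _ [/eqP r12] _; congr EFin; move/eqP: r12; lra.
Qed.

End unimodal_law.

(** * Independence *)

Section events_of.
Variable T : Type.

(** A pi-system generating the joint sigma-algebra of the systems indexed by [S]. *)
Definition events_of (I : eqType) (F : I -> set (set T)) (S : set I) : set (set T) :=
  [set A | exists s (B : I -> set T), [/\ uniq s, forall i, i \in s -> S i /\ F i (B i) &
     A = \bigcap_(i in [set` s]) B i]].

Variables (I : eqType) (F : I -> set (set T)).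
Hypotheses (FT : forall i, F i setT) (FI : forall i, setI_closed (F i)).

Lemma events_ofT S : events_of F S setT.
Proof. by exists [::], (fun=> setT); split => //; apply/seteqP; split => x. Qed.

Lemma events_of1 (S : set I) i A : S i -> F i A -> events_of F S A.
Proof.
move=> Si FA; exists [:: i], (fun=> A); split => //.
  by move=> j; rewrite inE => /eqP ->.
apply/seteqP; split => [x Ax j //|x /(_ i)]; apply; by rewrite /= inE.
Qed.

Lemma events_ofI S : setI_closed (events_of F S).
Proof.
move=> _ _ [s1 [B1 [u1 H1 ->]]] [s2 [B2 [u2 H2 ->]]].
exists (undup (s1 ++ s2)), (fun i => (if i \in s1 then B1 i else setT) `&` (if i \in s2 then B2 i else setT)).
split; first exact: undup_uniq.
  move=> i; rewrite mem_undup mem_cat => Hi; split.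
    by case/orP: Hi => [/H1[]|/H2[]].
  by apply: FI; [case: ifP => // /H1[]|case: ifP => // /H2[]].
apply/seteqP; split => [x [h1 h2] i /=|x h].
  by rewrite mem_undup mem_cat => _; split; case: ifP => // ?; [exact: h1|exact: h2].
by split => i /= si; have := h i; rewrite /= mem_undup mem_cat si ?orbT => /(_ isT)[] //; rewrite si.
Qed.

End events_of.

Section preimage_sigma.
Context (T : pointedType) d' (T' : measurableType d') (f : T -> T').

Lemma preimage_sigma_T : g_sigma_algebra_preimage f setT.
Proof. by exists setT => //; rewrite preimage_setT setTI. Qed.

Lemma preimage_sigma_I :
  setI_closed (g_sigma_algebra_preimage f).
Proof.
move=> _ _ [A mA <-] [B mB <-]; exists (A `&` B); first exact: measurableI.
by rewrite preimage_setI !setTI.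
Qed.

End preimage_sigma.

Section independence.
Context d (T : measurableType d) (R : realType) (P : probability T R).
Implicit Types (A B : set T) (G : set (set T)).

(** As functions of [A] both sides are finite measures that agree on a pi-system containing the
    whole space. *)
Lemma indep_sigma1 G B : G `<=` measurable -> setI_closed G -> G setT -> measurable B ->
  (forall A, G A -> P (A `&` B) = P A * P B)%E ->
  forall A, <<s G >> A -> (P (A `&` B) = P A * P B)%E.
Proof.
move=> Gm GI GT mB H A GA.
have B0 : 0 <= fine (P B) by exact: fine_ge0.
have BE : (fine (P B))%:E = P B by rewrite fineK// fin_num_measure.
have HU := @g_sigma_algebra_measure_unique _ R T G Gm (fun=> setT) (fun=> GT) _
  (mrestr P mB) (mscale (NngNum B0) P) GI _ _ A GA.
have sE A' : mscale (NngNum B0) P A' = (P A' * P B)%E.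
  by rewrite /mscale muleC; congr (_ * _)%E; exact: BE.
rewrite -sE; apply: HU.
- by apply/seteqP; split => // x _; exists 0%N.
- by move=> A' GA'; exact: etrans (H _ GA') (esym (sE A')).
- move=> _; apply: (@le_lt_trans _ _ 1%E); last exact: ltry.
  by apply: probability_le1; exact: measurableI.
Qed.

Lemma indep_sigma G1 G2 : G1 `<=` measurable -> G2 `<=` measurable ->
  setI_closed G1 -> setI_closed G2 -> G1 setT -> G2 setT ->
  (forall A B, G1 A -> G2 B -> P (A `&` B) = P A * P B)%E ->
  forall A B, <<s G1 >> A -> <<s G2 >> B -> (P (A `&` B) = P A * P B)%E.
Proof.
move=> m1 m2 I1 I2 T1 T2 H A B A1 B2.
have mA : measurable A.
  by move: A1; apply: smallest_sub; [exact: sigma_algebra_measurable|].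
rewrite setIC muleC; move: B B2; apply: indep_sigma1 => // B B2.
rewrite setIC muleC; move: A A1 {mA}; apply: indep_sigma1 => //; first exact: m2.
by move=> A A1; exact: H.
Qed.

Section events_of_measurable.
Variables (I : eqType) (F : I -> set (set T)).
Hypotheses (FT : forall i, F i setT) (FI : forall i, setI_closed (F i))
  (Fm : forall i, F i `<=` measurable).

Lemma events_of_measurable S : events_of F S `<=` measurable.
Proof.
move=> A [s [B [us H ->]]]; elim: s us H => [|i s IH] /=.
  move=> _ _; rewrite (_ : \bigcap_(_ in _) _ = setT)//.
  by apply/seteqP; split => x //.
move=> /andP[_ us] H.
rewrite (_ : \bigcap_(_ in _) _ = B i `&` \bigcap_(j in [set` s]) B j).
  apply: measurableI; first by have [_ /Fm] := H i (mem_head _ _).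
  by apply: IH => // j js; apply: H; rewrite inE js orbT.
apply/seteqP; split => [x H'|x [h1 h2] j /=].
  by split; [apply: H'; rewrite /= mem_head|move=> j /= js; apply: H'; rewrite /= inE js orbT].
by rewrite inE => /predU1P[->//|]; exact: h2.
Qed.

(** For disjoint index sets two finite intersections concatenate into a single one of the
    independent family; the passage to generated sigma-algebras is the pi-lambda argument. *)
Lemma events_of_indep (S1 S2 : set I) : mutually_independent P F ->
  (forall i, S1 i -> S2 i -> False) ->
  forall A B, <<s events_of F S1 >> A -> <<s events_of F S2 >> B -> (P (A `&` B) = P A * P B)%E.
Proof.
move=> indep S12; apply: indep_sigma; [exact: events_of_measurable|exact: events_of_measurable|
  exact: events_ofI|exact: events_ofI|exact: events_ofT|exact: events_ofT|].
move=> _ _ [s1 [B1 [u1 H1 ->]]] [s2 [B2 [u2 H2 ->]]].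
have dis i : i \in s1 -> i \in s2 -> False by move=> /H1[? _] /H2[? _]; exact: (S12 i).
pose B i := if i \in s1 then B1 i else B2 i.
have u12 : uniq (s1 ++ s2).
  by rewrite cat_uniq u1 u2 /= andbT; apply/hasPn => i i2; apply/negP => i1; exact: (dis i).
rewrite (indep s1 B1 u1) ?(indep s2 B2 u2); last 2 first.
- by move=> i /H2[].
- by move=> i /H1[].
rewrite (_ : _ `&` _ = \bigcap_(i in [set` s1 ++ s2]) B i); last first.
  apply/seteqP; split => [x [h1 h2] i /=|x h].
    by rewrite mem_cat /B; case: ifP => //= [i1 _|_ i2]; [exact: h1|exact: h2].
  split => i /= si; have := h i; rewrite /= mem_cat si ?orbT /B => /(_ isT).
    by rewrite si.
  by case: ifP => // /dis /(_ si).
rewrite indep//; last first.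
  by move=> i; rewrite mem_cat /B; case: ifP => [/H1[]|_ /= /H2[]].
rewrite big_cat/=; congr (_ * _)%E; apply: eq_big_seq => i si; rewrite /B ?si//.
by case: ifP => // /dis /(_ si).
Qed.

Lemma sigma_events_of_measurable (S : set I) : <<s events_of F S >> `<=` measurable.
Proof.
apply: smallest_sub; first exact: sigma_algebra_measurable.
exact: events_of_measurable.
Qed.
End events_of_measurable.

Lemma preimage_sigma_measurable d' (T' : measurableType d') (f : T -> T') :
  measurable_fun setT f -> g_sigma_algebra_preimage f `<=` measurable.
Proof. by move=> mf _ [A mA <-]; exact: mf. Qed.

Lemma slice_integral d1 d2 (E : measurableType d1) (F : measurableType d2)
    (M : probability F R) (H : {mfun T >-> E}) (Q : {mfun T >-> F}) (K : set (E * F)) :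
  measurable K ->
  (forall (A : set E) (C : set F), measurable A -> measurable C ->
     P (H @^-1` A `&` Q @^-1` C) = P (H @^-1` A) * M C)%E ->
  P [set w | K (H w, Q w)] = (\int[distribution P H]_h M (xsection K h))%E.
Proof.
move=> mK indep.
have mHQ : measurable_fun setT (fun w => (H w, Q w)) by exact: measurable_fun_pair.
pose HQ : {mfun T >-> (E * F)%type} := mfun_Sub (mem_set mHQ).
transitivity ((distribution P H \x M)%E K) => //.
by apply/esym; apply: (@product_measure_unique _ _ _ _ _ _ _ (distribution P HQ)).
Qed.

(** An event whose conditional probability given H = h is the same [m] for all h in [S] is
    independent of H restricted to [S]. This is how a new innovation is shown to be independent of
    what it was built from. *)
Lemma slice_const d1 d2 (E : measurableType d1) (F : measurableType d2)
    (M : probability F R) (H : {mfun T >-> E}) (Q : {mfun T >-> F}) (S : set E)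
    (K : set (E * F)) (m : \bar R) :
  measurable S -> measurable K ->
  (forall (A : set E) (C : set F), measurable A -> measurable C ->
     P (H @^-1` A `&` Q @^-1` C) = P (H @^-1` A) * M C)%E ->
  (forall h, S h -> M (xsection K h) = m) ->
  P (H @^-1` S `&` [set w | K (H w, Q w)]) = (P (H @^-1` S) * m)%E.
Proof.
move=> mS mK indep slice.
pose K' := K `&` (S `*` setT).
have mK' : measurable K' by apply: measurableI => //; exact: measurableX.
transitivity (P [set w | K' (H w, Q w)]).
  congr (P _); apply/seteqP; split => w /=; rewrite /K'; first by move=> [].
  by move=> [? []].
rewrite (slice_integral mK' indep).
transitivity (\int[distribution P H]_h ((fun=> m) \_ S) h)%E.
  apply: eq_integral => h _; rewrite /patch /=; case: ifPn => [/set_mem|/negP] hS.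
    rewrite -(slice h hS); congr (M _).
    apply/seteqP; split => q; rewrite /xsection/= !inE /K'; first by move=> [].
    by move=> Kq; split.
  rewrite (_ : xsection K' h = set0); first by rewrite measure0.
  by apply/seteqP; split => q //; rewrite /xsection/= inE /K' => -[_ [/= /mem_set]].
by rewrite -integral_mkcond integral_cst// muleC.
Qed.

End independence.

Lemma eq_law (R : realType) (Y : pointedType) (G : set (set Y))
    d1 (T1 : measurableType d1) (P1 : probability T1 R)
    d2 (T2 : measurableType d2) (P2 : probability T2 R) (F1 : T1 -> Y) (F2 : T2 -> Y) :
  setI_closed G -> G setT ->
  (forall A, G A -> measurable (F1 @^-1` A)) -> (forall A, G A -> measurable (F2 @^-1` A)) ->
  (forall A, G A -> P1 (F1 @^-1` A) = P2 (F2 @^-1` A)) ->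
  forall E, <<s G >> E -> P1 (F1 @^-1` E) = P2 (F2 @^-1` E).
Proof.
move=> GI GT m1 m2 eq12 E GE.
pose YG : measurableType _ := g_sigma_algebraType G.
have mF1 : measurable_fun setT (F1 : T1 -> YG).
  by apply: (@measurability _ _ T1 YG setT F1 G erefl) => _ [A GA <-]; rewrite setTI; exact: m1.
have mF2 : measurable_fun setT (F2 : T2 -> YG).
  by apply: (@measurability _ _ T2 YG setT F2 G erefl) => _ [A GA <-]; rewrite setTI; exact: m2.
pose X1 : {mfun T1 >-> YG} := mfun_Sub (mem_set mF1).
pose X2 : {mfun T2 >-> YG} := mfun_Sub (mem_set mF2).
apply: (@g_sigma_algebra_measure_unique _ R YG G (@sub_sigma_algebra _ _ _) (fun=> setT) (fun=> GT) _
  (distribution P1 X1) (distribution P2 X2) GI _ _ E GE).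
- by apply/seteqP; split => // x _; exists 0%N.
- exact: eq12.
- by move=> _; apply: (@le_lt_trans _ _ 1%E); [exact: probability_le1|exact: ltry].
Qed.

Lemma preimage_bigcap_comp (X Y : Type) (I : eqType) (F : X -> Y) (s : seq I) (A : I -> set Y) :
  F @^-1` (\bigcap_(i in [set` s]) A i) = \bigcap_(i in [set` s]) (F @^-1` A i).
Proof. by apply/seteqP; split. Qed.

Definition coordinate_events (R : realType) (V : eqType) : V -> set (set (V -> R)) :=
  fun v => g_sigma_algebra_preimage (fun y : V -> R => y v).
Arguments coordinate_events R V : clear implicits.

(** Independence reduces cylinder probabilities to products of marginals, and cylinders determine
    the law on trajectories. *)
Lemma eq_law_independent (R : realType) (V : eqType)
    d1 (T1 : measurableType d1) (P1 : probability T1 R) (X1 : V -> T1 -> R)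
    d2 (T2 : measurableType d2) (P2 : probability T2 R) (X2 : V -> T2 -> R) :
  (forall v, measurable_fun setT (X1 v)) -> (forall v, measurable_fun setT (X2 v)) ->
  mutually_independent P1 (fun v => g_sigma_algebra_preimage (X1 v)) ->
  mutually_independent P2 (fun v => g_sigma_algebra_preimage (X2 v)) ->
  (forall v B, measurable B -> P1 (X1 v @^-1` B) = P2 (X2 v @^-1` B)) ->
  forall E, <<s events_of (coordinate_events R V) setT >> E ->
    P1 [set w | E (X1^~ w)] = P2 [set w | E (X2^~ w)].
Proof.
move=> m1 m2 i1 i2 eq12.
have pre d (T : measurableType d) (X : V -> T -> R) v A : coordinate_events R V v A ->
    g_sigma_algebra_preimage (X v) ((fun w => X^~ w) @^-1` A).
  by move=> [B mB <-]; exists B => //; rewrite !setTI.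
have mpre d (T : measurableType d) (X : V -> T -> R) A : (forall v, measurable_fun setT (X v)) ->
    events_of (coordinate_events R V) setT A -> measurable ((fun w => X^~ w) @^-1` A).
  move=> mX [s [B [us HB ->]]]; rewrite preimage_bigcap_comp.
  apply: fin_bigcap_measurable => // v vs; have [_ Bv] := HB v vs.
  exact: (preimage_sigma_measurable (mX v) (pre _ _ _ _ _ Bv)).
apply: eq_law.
- by apply: events_ofI => v; [exact: preimage_sigma_T|exact: preimage_sigma_I].
- exact: events_ofT.
- by move=> A; exact: mpre.
- by move=> A; exact: mpre.
move=> _ [s [B [us HB ->]]]; rewrite !preimage_bigcap_comp i1 ?i2//; last 2 first.
- by move=> v /HB[_]; exact: pre.
- by move=> v /HB[_]; exact: pre.
by apply: eq_big_seq => v /HB[_ [C mC <-]]; rewrite setTI; exact: eq12.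
Qed.

Lemma process_event_measurable (S : Type) d (T : measurableType d) (Y : S -> T -> bool) E :
  (forall i, measurable_fun setT (Y i)) -> process_sigma_algebra E ->
  measurable [set w | E (Y^~ w)].
Proof.
move=> mY EE.
pose YG : measurableType _ := g_sigma_algebraType [set E | exists i : S, E = [set y : S -> bool | y i]].
suff mF : measurable_fun setT ((fun w => Y^~ w) : T -> YG).
  by have := mF measurableT E EE; rewrite setTI.
apply: (@measurability _ _ T YG setT _ [set E | exists i : S, E = [set y : S -> bool | y i]] erefl).
move=> _ [A [i ->] <-]; rewrite setTI.
by have := mY i measurableT [set true] I; rewrite setTI.
Qed.

Lemma eq_measure_null d (T : measurableType d) (R : realType) (P : probability T R) (A B N : set T) :
  measurable A -> measurable B -> measurable N -> P N = 0%E ->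
  (forall w, ~ N w -> A w <-> B w) -> P A = P B.
Proof.
move=> mA mB mN N0 AB.
have drop C : measurable C -> P C = P (C `\` N).
  move=> mC; rewrite measureD//; last by apply: le_lt_trans (probability_le1 P mC) _; exact: ltry.
  rewrite -[LHS]sube0; congr (_ - _)%E; apply/esym.
  apply/eqP; rewrite eq_le measure_ge0 andbT -N0.
  by apply: le_measure; rewrite ?inE//; exact: measurableI.
rewrite drop// [RHS]drop//; congr (P _); apply/seteqP; split => w [h n]; split => //;
by have := AB w n; case; auto.
Qed.

Lemma null_bigcup d (T : measurableType d) (R : realType) (P : probability T R) (V : countType)
    (N : V -> set T) : (forall v, measurable (N v)) -> (forall v, P (N v) = 0%E) ->
  measurable (\bigcup_v N v) /\ P (\bigcup_v N v) = 0%E.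
Proof.
move=> mN N0.
have mU : measurable (\bigcup_v N v) by exact: countable_bigcupT_measurable.
split => //.
pose F n := if @unpickle V n is Some v then N v else set0.
have mF n : measurable (F n) by rewrite /F; case: unpickle.
have FE : \bigcup_v N v = \bigcup_n F n.
  apply/seteqP; split => w [v _ Nw].
    by exists (pickle v) => //; rewrite /F pickleK.
  by move: Nw; rewrite /F; case: unpickle => // u Nw; exists u.
have : P.-negligible (\bigcup_n F n).
  apply: negligible_bigcup => n; apply/negligibleP => //; rewrite /F.
  by case: unpickle => [v|]; [exact: N0|exact: measure0].
by rewrite -FE => /negligibleP -> //.
Qed.

Lemma pair_law (R : realType) d1 (T1 : measurableType d1) (P1 : probability T1 R)
    d2 (T2 : measurableType d2) (P2 : probability T2 R)
    e1 (E1 : measurableType e1) (M1 : probability E1 R)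
    e2 (E2 : measurableType e2) (M2 : probability E2 R) (X1 : T1 -> E1) (X2 : T2 -> E2) :
  measurable_fun setT X1 -> measurable_fun setT X2 ->
  (forall A, measurable A -> P1 (X1 @^-1` A) = M1 A) ->
  (forall A, measurable A -> P2 (X2 @^-1` A) = M2 A) ->
  forall K, measurable K ->
    (P1 \x P2)%E [set w | K (X1 w.1, X2 w.2)] = (M1 \x M2)%E K.
Proof.
move=> m1 m2 l1 l2 K mK.
have mX : measurable_fun setT (fun w : T1 * T2 => (X1 w.1, X2 w.2)).
  by apply: measurable_fun_pair; exact: measurableT_comp.
pose X : {mfun (T1 * T2)%type >-> (E1 * E2)%type} := mfun_Sub (mem_set mX).
apply/esym; apply: (@product_measure_unique _ _ _ _ _ _ _
  (distribution (P1 \x P2 : probability (T1 * T2)%type R)%E X)) => // A B mA mB.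
have mA' : measurable (X1 @^-1` A) by rewrite -[_ @^-1` _]setTI; exact: m1.
have mB' : measurable (X2 @^-1` B) by rewrite -[_ @^-1` _]setTI; exact: m2.
transitivity (P1 (X1 @^-1` A) * P2 (X2 @^-1` B))%E; last by rewrite l1// l2.
exact: (product_measure1E P1 P2 mA' mB').
Qed.

(** * Three independent copies of the innovations *)

Section copies.
Context d (T : measurableType d) (R : realType) (P : probability T R).
Variables (V : eqType) (U : V -> {RV P >-> R}).
Hypothesis indepU : mutually_independent P (fun v => g_sigma_algebra_preimage (U v)).

(* Three independent copies of the family [U]: the first carries the chain, the
   second the uniform variables deciding which edges are open, and the third
   the coins. *)
Definition copies : measurableType _ := (T * (T * T))%type.
Definition copies_prob : probability copies R := (P \x (P \x P))%E.
Local Notation P3 := copies_prob.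

Definition copy (k : option bool) (w : copies) : T :=
  match k with None => w.1 | Some false => w.2.1 | Some true => w.2.2 end.

Definition copied (i : V * option bool) (w : copies) : R := U i.1 (copy i.2 w).

Definition copied_events (i : V * option bool) : set (set copies) :=
  g_sigma_algebra_preimage (copied i).

Lemma measurable_copy k : measurable_fun setT (copy k).
Proof.
case: k => [[]|]; rewrite /copy.
- by apply: (measurableT_comp measurable_snd); exact: measurable_snd.
- by apply: (measurableT_comp measurable_fst); exact: measurable_snd.
- exact: measurable_fst.
Qed.

Lemma measurable_copied i : measurable_fun setT (copied i).
Proof. by apply: measurableT_comp => //; exact: measurable_copy. Qed.

Lemma copies_rect (A B C : set T) : measurable A -> measurable B -> measurable C ->
  P3 (A `*` (B `*` C)) = (P A * (P B * P C))%E.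
Proof.
move=> mA mB mC.
transitivity (P A * (P \x P)%E (B `*` C))%E.
  by apply: product_measure1E => //; exact: measurableX.
by congr (_ * _)%E; exact: (product_measure1E P P mB mC).
Qed.

Lemma copies_copy k (A : set T) : measurable A -> P3 (copy k @^-1` A) = P A.
Proof.
move=> mA; case: k => [[]|].
- rewrite (_ : _ @^-1` _ = setT `*` (setT `*` A)); last first.
    by apply/seteqP; split => w //= [_ []].
  by rewrite copies_rect// !probability_setT !mul1e.
- rewrite (_ : _ @^-1` _ = setT `*` (A `*` setT)); last first.
    by apply/seteqP; split => w //= [_ []].
  by rewrite copies_rect// !probability_setT mule1 mul1e.
- rewrite (_ : _ @^-1` _ = A `*` (setT `*` setT)); last first.
    by apply/seteqP; split => w //= [].
  by rewrite copies_rect// !probability_setT !mule1.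
Qed.

(** A finite intersection of such events is a box with one side per copy. The product measure
    separates the sides, and independence of [U] splits each of them. *)
Lemma copied_independent : mutually_independent P3 copied_events.
Proof.
move=> s A us H.
have mU v (B : set R) : measurable B -> measurable (U v @^-1` B).
  by move=> mB; rewrite -[_ @^-1` _]setTI; exact: measurable_funP.
have [B HB] : exists B : V * option bool -> set R, forall i,
    measurable (B i) /\ (i \in s -> A i = copied i @^-1` B i).
  have /choice[B HB] : forall i, exists B : set R,
      measurable B /\ (i \in s -> A i = copied i @^-1` B); last by exists B.
  move=> i.
  case: (boolP (i \in s)) => [/H [B mB <-]|_]; last by exists set0.
  by exists B; split => // _; rewrite setTI.
pose C k := \bigcap_(i in [set` [seq i <- s | i.2 == k]]) (U i.1 @^-1` B i).
have mC k : measurable (C k).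
  rewrite /C; elim: [seq _ <- _ | _] => [|i r IH].
    by rewrite (_ : \bigcap_(_ in _) _ = setT)//; apply/seteqP; split.
  rewrite (_ : \bigcap_(_ in _) _ = U i.1 @^-1` B i `&` \bigcap_(j in [set` r]) (U j.1 @^-1` B j)).
    by apply: measurableI => //; apply: mU; have [] := HB i.
  apply/seteqP; split => [x h|x [h1 h2] j /=].
    by split; [apply: h; rewrite /= mem_head|move=> j /= jr; apply: h; rewrite /= inE jr orbT].
  by rewrite inE => /predU1P[->//|]; exact: h2.
have PC k : P (C k) = (\prod_(i <- s | i.2 == k) P (U i.1 @^-1` B i))%E.
  have := indepU (s := [seq i.1 | i <- s & i.2 == k]) (A := fun v => U v @^-1` B (v, k)).
  rewrite big_map big_filter => E.
  rewrite (_ : C k = \bigcap_(i in [set` [seq i.1 | i <- s & i.2 == k]]) (U i @^-1` B (i, k))); last first.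
    apply/seteqP; split => x h.
      move=> v /= /mapP[[v' k']]; rewrite mem_filter /= => /andP[/eqP -> vs] ->.
      by apply: (h (v', k)) => /=; rewrite mem_filter eqxx.
    move=> [v k'] /=; rewrite mem_filter /= => /andP[/eqP -> vs].
    by apply: (h v) => /=; apply/mapP; exists (v, k) => //; rewrite mem_filter eqxx.
  rewrite E.
  - by apply: eq_bigr => -[v k'] /= /eqP ->.
  - rewrite map_inj_in_uniq ?filter_uniq// => -[v1 k1] [v2 k2].
    by rewrite !mem_filter /= => /andP[/eqP -> _] /andP[/eqP -> _] ->.
  - move=> v _; exists (B (v, k)); last by rewrite setTI.
    by have [] := HB (v, k).
rewrite (_ : \bigcap_(i in _) A i = C None `*` (C (Some false) `*` C (Some true))); last first.
  apply/seteqP; split => [w h|w [h1 [h2 h3]] [v k] /= vs].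
    split; last split; move=> [v k] /=; rewrite mem_filter /= => /andP[/eqP -> vs];
    by have := h _ vs; rewrite ((HB _).2 vs).
  have [_ ->//] := HB (v, k); rewrite /copied/=.
  case: k vs => [[]|] vs; [apply: (h3 (v, Some true))|apply: (h2 (v, Some false))|apply: (h1 (v, None))];
  by rewrite /= mem_filter vs.
rewrite copies_rect// !PC.
have -> : (\prod_(i <- s) P3 (A i) = \prod_(i <- s) P (U i.1 @^-1` B i))%E.
  apply: eq_big_seq => i si; have [mBi ->//] := HB i.
  by rewrite -(copies_copy i.2 (mU _ _ mBi)).
rewrite [RHS](bigID (fun i => i.2 == None))/=; congr (_ * _)%E.
rewrite [RHS](bigID (fun i => i.2 == Some false))/=; congr (_ * _)%E.
  by apply: eq_bigl => -[v [[]|]].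
by apply: eq_bigl => -[v [[]|]].
Qed.

Definition triple (v : V) (w : copies) : R * (R * R) :=
  (copied (v, None) w, (copied (v, Some false) w, copied (v, Some true) w)).

Lemma triple_law (v : V) (mu : probability R R) :
  (forall A, measurable A -> P (U v @^-1` A) = mu A) ->
  forall K, measurable K -> P3 (triple v @^-1` K) = (mu \x (mu \x mu))%E K.
Proof.
move=> l K mK.
apply: (@pair_law R _ _ P _ _ (P \x P)%E _ _ mu _ _ (mu \x mu)%E (U v) (fun w => (U v w.1, U v w.2))) => //.
  by apply: measurable_fun_pair; exact: measurableT_comp.
by move=> A mA; exact: pair_law.
Qed.

(** The same space with the coarser sigma-algebra of the inputs indexed by [S]. Measurability from
    it expresses that a quantity depends on these inputs alone. *)
Definition sub_copies (S : set (V * option bool)) : measurableType _ :=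
  g_sigma_algebraType (events_of copied_events S).

Let FT i : copied_events i setT. Proof. exact: preimage_sigma_T. Qed.
Let FI i : setI_closed (copied_events i). Proof. exact: preimage_sigma_I. Qed.
Let Fm i : copied_events i `<=` measurable.
Proof. by apply: preimage_sigma_measurable; exact: measurable_copied. Qed.

Lemma sub_measurable_copied (S : set (V * option bool)) i : S i ->
  measurable_fun setT (copied i : sub_copies S -> R).
Proof.
move=> Si _ Y mY; apply: sub_sigma_algebra; apply: (@events_of1 _ _ _ _ i) => //.
by exists Y.
Qed.

Lemma sub_measurable_measurable S d' (E : measurableType d') (f : copies -> E) :
  measurable_fun setT (f : sub_copies S -> E) -> measurable_fun setT f.
Proof. by move=> mf _ Y mY; apply: (sigma_events_of_measurable Fm); exact: (mf measurableT Y mY). Qed.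

Lemma sub_measurable_indep (S1 S2 : set (V * option bool))
    d1 (E1 : measurableType d1) d2 (E2 : measurableType d2) (f : copies -> E1) (h : copies -> E2) :
  (forall i, S1 i -> S2 i -> False) ->
  measurable_fun setT (f : sub_copies S1 -> E1) -> measurable_fun setT (h : sub_copies S2 -> E2) ->
  forall A B, measurable A -> measurable B ->
  P3 (f @^-1` A `&` h @^-1` B) = (P3 (f @^-1` A) * P3 (h @^-1` B))%E.
Proof.
move=> S12 mf mh A B mA mB.
apply: (events_of_indep FT FI Fm copied_independent S12).
  by have := mf measurableT A mA; rewrite setTI.
by have := mh measurableT B mB; rewrite setTI.
Qed.

Lemma sub_measurable_triple v : measurable_fun setT (triple v : sub_copies [set i | i.1 = v] -> _).
Proof.
apply: measurable_fun_pair; first exact: sub_measurable_copied.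
by apply: measurable_fun_pair; exact: sub_measurable_copied.
Qed.

(** The inputs at [v] are independent of any [h] that avoids them, and their joint law is the triple
    product of [mu]; [slice_const] applies. *)
Lemma fresh_slice (mu : probability R R) (v : V) (S : set (V * option bool))
    d' (E : measurableType d') (h : copies -> E) (A : set E) (K : set (E * (R * (R * R)))) (m : \bar R) :
  (forall A, measurable A -> P (U v @^-1` A) = mu A) ->
  (forall k, ~ S (v, k)) -> measurable_fun setT (h : sub_copies S -> E) ->
  measurable A -> measurable K ->
  (forall e, A e -> (mu \x (mu \x mu))%E (xsection K e) = m) ->
  P3 (h @^-1` A `&` [set w | K (h w, triple v w)]) = (P3 (h @^-1` A) * m)%E.
Proof.
move=> lU nS mh mA mK slice.
have mh' := sub_measurable_measurable mh.
have mt := sub_measurable_measurable (@sub_measurable_triple v).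
pose H : {mfun copies >-> E} := mfun_Sub (mem_set mh').
pose Q : {mfun copies >-> (R * (R * R))%type} := mfun_Sub (mem_set mt).
apply: (@slice_const _ copies R P3 _ _ E _ (mu \x (mu \x mu))%E H Q A K m) => // A' C mA' mC.
transitivity (P3 (h @^-1` A') * P3 (triple v @^-1` C))%E; last first.
  by congr (_ * _)%E; exact: triple_law.
apply: (sub_measurable_indep _ mh (@sub_measurable_triple v)) => //.
by move=> [v' k] /= Svk vv; move: Svk; rewrite vv; exact: nS.
Qed.

End copies.

(** * The chain on the tree *)

(** The depth is the length of a shortest path to the root. A shortest path made simple has the
    parent as its next vertex, and its tail shows that the parent is less deep. *)
Lemma tree_parent (V : countType) (e : rel V) (rho : V) : is_tree e ->
  exists (par : V -> V) (dep : V -> nat), forall v, v != rho ->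
    is_parent e rho v (par v) /\ (dep (par v) < dep v)%N.
Proof.
move=> [_ _ conn _].
pose Q v n := `[< exists p, [/\ path e v p, last v p = rho & size p = n] >].
have exQ v : exists n, Q v n.
  by have [p pp lp] := conn v rho; exists (size p); apply/asboolP; exists p.
pose dep v := ex_minn (exQ v).
have dep_le v p : path e v p -> last v p = rho -> (dep v <= size p)%N.
  move=> pp lp; rewrite /dep; case: ex_minnP => n _; apply.
  by apply/asboolP; exists p.
have /choice[par Hpar] : forall v, exists u, v != rho ->
    is_parent e rho v u /\ (dep u < dep v)%N; last by exists par, dep.
move=> v; case: (eqVneq v rho) => [_|vr]; first by exists v.
have [p [pp lp sp]] : exists p, [/\ path e v p, last v p = rho & size p = dep v].
  by rewrite /dep; case: ex_minnP => n /asboolP.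
case: (shortenP pp) lp => p' pp' up' sub lp'.
have sp' : (size p' <= size p)%N by apply: uniq_leq_size; [case/andP: up'|].
case: p' pp' up' {sub} lp' sp' => [|u q] pp' up' /= lp' sp'.
  by rewrite lp' eqxx in vr.
exists u => _; split; first by exists q.
rewrite -sp; apply: leq_trans sp'; rewrite ltnS; apply: dep_le => //.
by case/andP: pp'.
Qed.

(** * Induction and recursion along parents *)

Section recursion.
Variables (V : eqType) (rho : V) (par : V -> V) (dep : V -> nat).
Hypothesis depP : forall v, v != rho -> (dep (par v) < dep v)%N.

Lemma tree_ind (Q : V -> Prop) :
  (forall v, (v != rho -> Q (par v)) -> Q v) -> forall v, Q v.
Proof.
move=> H v; have [n] := ubnP (dep v); elim: n v => // n IH v; rewrite ltnS => vn.
by apply: H => /depP dv; apply: IH; exact: leq_trans vn.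
Qed.

Fixpoint fuel_rec (A : Type) (F : V -> A -> A) (x0 : A) (n : nat) (v : V) : A :=
  F v (if n is n'.+1 then fuel_rec F x0 n' (par v) else x0).

Lemma fuel_rec_stable (A : Type) (F : V -> A -> A) x0 n m v :
  (forall x y, F rho x = F rho y) -> (dep v <= n)%N -> (dep v <= m)%N ->
  fuel_rec F x0 n v = fuel_rec F x0 m v.
Proof.
move=> Frho; elim: n m v => [|n IH] m v vn vm;
  (have [->|vr] := eqVneq v rho; first by case: m {vm} => [|m]; exact: Frho);
  have := depP vr; first by rewrite leqNgt in vn; case: (dep v) vn.
case: m vm => [|m] vm dv; first by move: vm dv; case: (dep v).
by congr (F v _); apply: IH; rewrite -ltnS; exact: leq_trans dv _.
Qed.

(** The depth is enough fuel: it drops strictly until the root, where [F] ignores its argument in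
    all uses, so the default [x0] never matters. *)
Definition tree_rec (A : Type) (F : V -> A -> A) (x0 : A) (v : V) : A :=
  fuel_rec F x0 (dep v) v.

Lemma tree_recE (A : Type) (F : V -> A -> A) x0 v :
  (forall x y, F rho x = F rho y) ->
  tree_rec F x0 v = F v (tree_rec F x0 (par v)).
Proof.
move=> Frho; rewrite /tree_rec.
have [->|vr] := eqVneq v rho; first by case: (dep rho) => [|k]; exact: Frho.
have := depP vr; case E : (dep v) => [//|k]; rewrite ltnS => dk /=.
by congr (F v _); exact: fuel_rec_stable.
Qed.

End recursion.

(** * The chain with resampled signs *)

Section resampled_chain.
Context d (T : measurableType d) (R : realType) (P : probability T R).
Variables (V : countType) (rho : V) (par : V -> V) (dep : V -> nat).
Hypothesis depP : forall v, v != rho -> (dep (par v) < dep v)%N.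
Variables (a c : R).
Hypotheses (a0 : 0 < a) (c0 : 0 < c).
Variables (mu : probability R R) (g : R -> R).
Hypotheses (mg : measurable_fun setT g) (g0 : forall x, 0 <= g x)
  (gN : forall x, g (- x) = g x) (gle : forall x y, 0 <= x -> x <= y -> g y <= g x)
  (muE : forall A, measurable A -> mu A = (\int[lebesgue_measure]_(x in A) (g x)%:E)%E).
Variable U : V -> {RV P >-> R}.
Hypothesis indepU : mutually_independent P (fun v => g_sigma_algebra_preimage (U v)).
Hypothesis lawU : forall v A, measurable A -> P (U v @^-1` A) = mu A.
Local Notation P3 := (copies_prob P).
Local Notation copies := (copies T).

(** Coefficient 1 and past 0 turn the root into an ordinary step of the recursion, with the root
    value itself as innovation. *)
Definition coef (v : V) : R := if v == rho then 1 else c.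

Definition chain (y : V -> R) : V -> R :=
  tree_rec par dep (fun v x => (if v == rho then 0 else a * x) + coef v * y v) 0.

Lemma coef_gt0 v : 0 < coef v.
Proof. by rewrite /coef; case: ifP. Qed.

Lemma chainE y v :
  chain y v = (if v == rho then 0 else a * chain y (par v)) + coef v * y v.
Proof. by rewrite /chain (tree_recE depP)// => x x'; rewrite eqxx. Qed.

Definition chain_copy (v : V) (w : copies) : R := chain (fun u => copied U (u, None) w) v.

Definition past (v : V) (w : copies) : R :=
  if v == rho then 0 else a * chain_copy (par v) w.

Definition edge_open (v : V) (w : copies) : bool :=
  open_edge mu g (coef v) (past v w) (copied U (v, None) w) (copied U (v, Some false) w).

(** The last vertex reached from [v] towards the root along open edges. The test [v != rho] makes
    the step at the root independent of its argument, as [tree_recE] requires. *)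
Definition top (v : V) (w : copies) : V :=
  tree_rec par dep (fun v t => if (v != rho) && edge_open v w then t else v) rho v.

Definition coin (v : V) (w : copies) : bool := 0 < copied U (v, Some true) w.

Definition cluster_sign (v : V) (w : copies) : bool := coin (top v w) w.

(** At the root the value [true] is a convention: it multiplies a past equal to 0. *)
Definition past_sign (v : V) (w : copies) : bool :=
  (v == rho) || cluster_sign (par v) w.

Definition resampled_chain (v : V) (w : copies) : R :=
  bsign R (cluster_sign v w) * `|chain_copy v w|.

Definition resampled_input (v : V) (w : copies) : R :=
  resampled_innovation mu g (coef v) (past v w) (past_sign v w)
    (copied U (v, None) w) (copied U (v, Some false) w) (copied U (v, Some true) w).

Lemma chain_copyE v w : chain_copy v w = past v w + coef v * copied U (v, None) w.
Proof. exact: chainE. Qed.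

(** With past 0 and coefficient 1 the threshold is [g |u|], that is [g u], which [law_cdf] times
    [g u] cannot exceed. *)
Lemma edge_open_root w : edge_open rho w = false.
Proof.
rewrite /edge_open /open_edge /past /coef eqxx add0r mul1r normr0 addr0 divr1.
have -> : g `|copied U (rho, None) w| = g (copied U (rho, None) w).
  by case: (ger0P (copied U (rho, None) w)).
by apply/negbTE; rewrite -leNgt ler_piMl// law_cdf_le1.
Qed.

Lemma topE v w : top v w = if edge_open v w then top (par v) w else v.
Proof.
rewrite /top (tree_recE depP); last by move=> x y; rewrite eqxx.
by case: eqVneq => // ->; rewrite edge_open_root.
Qed.

Lemma cluster_signE v w : cluster_sign v w =
  resampled_sign mu g (coef v) (past v w) (past_sign v w)
    (copied U (v, None) w) (copied U (v, Some false) w) (copied U (v, Some true) w).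
Proof.
rewrite /cluster_sign topE /resampled_sign -/(edge_open v w) /past_sign.
by case: ifP => //; case: eqVneq => // ->; rewrite edge_open_root.
Qed.

(** A pathwise identity: the new innovations were defined as those that drive the resampled values.
    Positivity of [a] gives |a x| = a |x| for the parent's contribution. *)
Lemma resampled_chainE w : chain (resampled_input ^~ w) =1 resampled_chain ^~ w.
Proof.
apply: (tree_ind depP) => v IH; rewrite chainE /resampled_input /resampled_innovation.
rewrite -cluster_signE -chain_copyE mulrCA mulfV ?gt_eqF ?coef_gt0// mulr1.
rewrite /resampled_chain /past_sign /past; case: eqVneq IH => [_ _|_ /(_ isT) ->].
  by rewrite normr0 mulr0 subr0 add0r.
by rewrite /resampled_chain/= normrM (gtr0_norm a0) mulrCA addrC subrK.
Qed.

Section measurability.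
Variable S : set (V * option bool).
Local Notation M f := (measurable_fun setT (f : sub_copies U S -> _)).

Lemma measurable_chain_copy v :
  (forall u, u = v \/ (dep u < dep v)%N -> S (u, None)) -> M (chain_copy v).
Proof.
move: v; apply: (tree_ind depP) => v IH HS.
have mU : M (copied U (v, None)) by apply: sub_measurable_copied; apply: HS; left.
rewrite (funext (chain_copyE v)).
apply: measurable_funD; last by apply: measurable_funM => //; exact: measurable_cst.
rewrite /past; case: eqVneq IH => [_ _|vr /(_ isT) IH]; first exact: measurable_cst.
apply: measurable_funM; first exact: measurable_cst.
apply: IH => u [->|uv]; apply: HS; right; first exact: depP.
by apply: ltn_trans uv _; exact: depP.
Qed.

Lemma measurable_past v :
  (forall u, (dep u < dep v)%N -> S (u, None)) -> M (past v).
Proof.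
move=> HS; rewrite /past; case: eqVneq => vr; first exact: measurable_cst.
apply: measurable_funM; first exact: measurable_cst.
apply: measurable_chain_copy => u [->|uv]; apply: HS; first exact: depP.
by apply: ltn_trans uv _; exact: depP.
Qed.

(** The third copy is excluded on purpose: clusters must not depend on the coins. *)
Lemma measurable_edge_open v :
  (forall k u, k != Some true -> u = v \/ (dep u < dep v)%N -> S (u, k)) -> M (edge_open v).
Proof.
move=> HS; apply: measurable_open_edge => //.
- by apply: measurable_past => u uv; apply: HS => //; right.
- by apply: sub_measurable_copied; apply: HS => //; left.
- by apply: sub_measurable_copied; apply: HS => //; left.
Qed.

Lemma measurable_top v u :
  (forall k u, k != Some true -> u = v \/ (dep u < dep v)%N -> S (u, k)) ->
  measurable ([set w | top v w = u] : set (sub_copies U S)).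
Proof.
move: v; apply: (tree_ind depP) => v IH HS.
have mD := measurable_edge_open HS.
have mDb b : measurable ([set w | edge_open v w = b] : set (sub_copies U S)).
  by have := mD measurableT [set b]; rewrite setTI; apply.
have [vr|vr] := eqVneq v rho.
  rewrite (_ : [set w | _] = [set w | v = u]).
    by have [->|vu] := pselect (v = u); [rewrite (_ : [set _ | _] = setT)|rewrite (_ : [set _ | _] = set0)];
      rewrite //; apply/seteqP; split.
  by apply/seteqP; split => w /=; rewrite topE vr edge_open_root.
rewrite (_ : [set w | _] = ([set w | edge_open v w = true] `&` [set w | top (par v) w = u])
   `|` ([set w | edge_open v w = false] `&` [set w | v = u])); last first.
  apply/seteqP; split => w /=; rewrite [top v w]topE; case: (edge_open v w);
    [by left|by right|by case=> [[]|[]]|by case=> [[]|[]]].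
apply: measurableU; apply: measurableI => //.
  apply: IH => // k u' kt [->|uv]; apply: HS => //; right; first exact: depP.
  by apply: ltn_trans uv _; exact: depP.
by have [->|vu] := pselect (v = u); [rewrite (_ : [set _ | _] = setT)|rewrite (_ : [set _ | _] = set0)];
      rewrite //; apply/seteqP; split.
Qed.

Lemma measurable_cluster_sign v :
  (forall k u, u = v \/ (dep u < dep v)%N -> S (u, k)) -> M (cluster_sign v).
Proof.
move: v; apply: (tree_ind depP) => v IH HS.
rewrite (funext (cluster_signE v)).
apply: measurable_resampled_sign => //.
- by apply: measurable_past => u uv; apply: HS; right.
- by apply: sub_measurable_copied; apply: HS; left.
- by apply: sub_measurable_copied; apply: HS; left.
- by apply: sub_measurable_copied; apply: HS; left.
rewrite /past_sign; case: eqVneq IH => [_ _|vr /(_ isT) IH]; first exact: measurable_cst.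
apply: IH => k u [->|uv]; apply: HS; right; first exact: depP.
by apply: ltn_trans uv _; exact: depP.
Qed.

Lemma measurable_past_sign v :
  (forall k u, (dep u < dep v)%N -> S (u, k)) -> M (past_sign v).
Proof.
move=> HS; rewrite /past_sign; case: eqVneq => vr; first exact: measurable_cst.
apply: measurable_cluster_sign => k u [->|uv]; apply: HS; first exact: depP.
by apply: ltn_trans uv _; exact: depP.
Qed.

Lemma measurable_resampled_input v :
  (forall k u, u = v \/ (dep u < dep v)%N -> S (u, k)) -> M (resampled_input v).
Proof.
move=> HS; apply: measurable_resampled_innovation => //.
- by apply: measurable_past => u uv; apply: HS; right.
- by apply: sub_measurable_copied; apply: HS; left.
- by apply: sub_measurable_copied; apply: HS; left.
- by apply: sub_measurable_copied; apply: HS; left.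
- by apply: measurable_past_sign => k u uv; apply: HS; right.
Qed.

End measurability.

Let others (v : V) : set (V * option bool) := [set i | i.1 <> v].

Let measurable_past_others v : measurable_fun setT (past v : sub_copies U (others v) -> R).
Proof. by apply: measurable_past => u uv /= E; move: uv; rewrite (_ : u = v) ?ltnn. Qed.

Let measurable_past_sign_others v :
  measurable_fun setT (past_sign v : sub_copies U (others v) -> bool).
Proof. by apply: measurable_past_sign => k u uv /= E; move: uv; rewrite (_ : u = v) ?ltnn. Qed.

(** Once the inputs at all other vertices are fixed, [past] and [past_sign] are constants, while the
    three inputs at [v] are fresh. By [resampled_innovation_law] the conditional law is [mu]
    whatever these constants are. *)
Lemma resampled_input_slice v (A : set copies) (B : set R) :
  measurable (A : set (sub_copies U (others v))) -> measurable B ->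
  P3 (A `&` resampled_input v @^-1` B) = (P3 A * mu B)%E.
Proof.
move=> mA mB.
pose K := [set q : sub_copies U (others v) * (R * (R * R)) |
  B (resampled_innovation mu g (coef v) (past v q.1) (past_sign v q.1) q.2.1 q.2.2.1 q.2.2.2)].
apply: (@fresh_slice _ _ _ _ _ _ indepU mu v (others v) _ (sub_copies U (others v)) id A K (mu B)) => //.
- by move=> A' mA'; exact: lawU.
- by move=> k; apply.
- have mK : measurable_fun setT (fun q : sub_copies U (others v) * (R * (R * R)) =>
      resampled_innovation mu g (coef v) (past v q.1) (past_sign v q.1) q.2.1 q.2.2.1 q.2.2.2).
    apply: measurable_resampled_innovation => //.
    + by apply: measurableT_comp; [exact: measurable_past_others|exact: measurable_fst].
    + by apply: measurableT_comp; [exact: measurable_fst|exact: measurable_snd].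
    + apply: (measurableT_comp measurable_fst).
      by apply: (measurableT_comp measurable_snd); exact: measurable_snd.
    + apply: (measurableT_comp measurable_snd).
      by apply: (measurableT_comp measurable_snd); exact: measurable_snd.
    + by apply: measurableT_comp; [exact: measurable_past_sign_others|exact: measurable_fst].
  by have := mK measurableT B mB; rewrite setTI.
- move=> w _; rewrite -(resampled_innovation_law mg g0 gN gle muE (past v w) (past_sign v w) (coef_gt0 v) mB).
  by congr (_ _); apply/seteqP; split => q; rewrite /xsection/= inE.
Qed.

Lemma resampled_input_law v B : measurable B -> P3 (resampled_input v @^-1` B) = mu B.
Proof.
move=> mB; have := resampled_input_slice (v := v) measurableT mB.
by rewrite setTI => ->; rewrite [X in (X * _)%E](_ : _ = 1%E) ?mul1e//; exact: probability_setT.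
Qed.

(* The inputs are peeled off in the order of decreasing depth, so that the
   removed one is a fresh innovation given all the others. *)
Lemma resampled_input_independent :
  mutually_independent P3 (fun v => g_sigma_algebra_preimage (resampled_input v)).
Proof.
move=> s A us HA.
pose r := sort (fun u v => (dep v <= dep u)%N) s.
have rs : perm_eq r s by rewrite perm_sort.
rewrite -(perm_big _ rs)/=.
rewrite (_ : [set` s] = [set` r]); last first.
  by apply/seteqP; split => v /=; rewrite (perm_mem rs).
have : sorted (fun u v => (dep v <= dep u)%N) r.
  by apply: sort_sorted => u v; exact: leq_total.
have {us} : uniq r by rewrite (perm_uniq rs).
have {HA} : forall v, v \in r -> g_sigma_algebra_preimage (resampled_input v) (A v).
  by move=> v; rewrite (perm_mem rs); exact: HA.
elim: {s rs} r => [|v r IH] HA.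
  move=> _ _; rewrite big_nil (_ : \bigcap_(_ in _) _ = setT) ?probability_setT//.
  by apply/seteqP; split.
move=> /andP[vr ur] vsort.
have vmax u : u \in r -> (dep u <= dep v)%N.
  have tr : transitive (fun u v => (dep v <= dep u)%N) by move=> y x z h1 h2; exact: leq_trans h1.
  by move/allP: (order_path_min tr vsort) => /(_ u).
rewrite big_cons -IH//; last 2 first.
- by move=> u ur'; apply: HA; rewrite inE ur' orbT.
- exact: path_sorted vsort.
have [B mB EB] := HA v (mem_head _ _).
rewrite (_ : \bigcap_(i in _) A i = \bigcap_(i in [set` r]) A i `&` resampled_input v @^-1` B); last first.
  rewrite -[_ @^-1` B]setTI EB; apply/seteqP; split => [w h|w [h1 h2] u /=].
    by split => [u ur'|]; apply: h; rewrite /= inE ?eqxx// ur' orbT.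
  by rewrite inE => /predU1P[->//|]; exact: h1.
rewrite resampled_input_slice//; first by rewrite -EB setTI resampled_input_law// muleC.
apply: fin_bigcap_measurable => // u ur'.
have uvr : u \in v :: r by rewrite inE (ur' : u \in r) orbT.
have [C mC <-] := HA u uvr.
suff mu' : measurable_fun setT (resampled_input u : sub_copies U (others v) -> R) by exact: mu'.
(* Ties in depth are harmless: apart from [u] itself, the new input at [u] uses only vertices of
   strictly smaller depth, so never [v]. *)
apply: measurable_resampled_input => k u' [->|u'u] /= E.
  by move/negP: vr; apply; rewrite -[v]E.
by have := leq_trans u'u (vmax u ur'); rewrite (_ : u' = v) ?ltnn.
Qed.

(** Given the past, a single value of the fresh innovation yields 0, and [mu] has no atoms. At a
    zero of the chain the sign of the resampled value would be lost. *)
Lemma chain_copy_null v : P3 (chain_copy v @^-1` [set 0]) = 0%E.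
Proof.
pose K := [set q : sub_copies U (others v) * (R * (R * R)) | past v q.1 + coef v * q.2.1 = 0].
have mK : measurable K.
  have mf : measurable_fun setT (fun q : sub_copies U (others v) * (R * (R * R)) => past v q.1 + coef v * q.2.1).
    apply: measurable_funD.
      by apply: measurableT_comp; [exact: measurable_past_others|exact: measurable_fst].
    apply: measurable_funM; first exact: measurable_cst.
    by apply: measurableT_comp; [exact: measurable_fst|exact: measurable_snd].
  by have := mf measurableT [set 0] (measurable_set1 _); rewrite setTI.
transitivity (P3 (setT `&` [set w | K (w, triple U v w)])).
  by congr (_ _); rewrite setTI; apply/seteqP; split => w /=; rewrite /K/= chain_copyE.
transitivity (P3 setT * 0)%E; last by rewrite mule0.
apply: (@fresh_slice _ _ _ _ _ _ indepU mu v (others v) _ (sub_copies U (others v)) id setT K 0%E) => //.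
- by move=> A' mA'; exact: lawU.
- by move=> k; apply.
move=> w _.
transitivity ((mu \x (mu \x mu))%E ([set - past v w / coef v] `*` setT)).
  congr (_ _); apply/seteqP; split => q; rewrite /xsection/= !inE /K/=.
    move=> /eqP; rewrite addrC addr_eq0 => /eqP E; split => //.
    by apply: (mulfI (lt0r_neq0 (coef_gt0 v))); rewrite E; field; rewrite lt0r_neq0 ?coef_gt0.
  by move=> [-> _]; field; rewrite lt0r_neq0 ?coef_gt0.
transitivity (mu [set (- past v w / coef v)%R] * (mu \x mu)%E setT)%E.
  exact: (@product_measure1E _ _ _ _ R mu (mu \x mu : probability (R * R)%type R)%E _ _ (measurable_set1 _) measurableT).
by rewrite (unimodal_atomless muE) mul0e.
Qed.

Lemma measurable_chain y : measurable_fun setT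
  ((fun x => chain x y) : g_sigma_algebraType (events_of (coordinate_events R V) setT) -> R).
Proof.
move: y; apply: (tree_ind depP) => v IH.
rewrite (funext (fun y => chainE y v)).
apply: measurable_funD.
  case: eqVneq IH => [_ _|_ /(_ isT) IH]; first exact: measurable_cst.
  by apply: measurable_funM => //; exact: measurable_cst.
apply: measurable_funM; first exact: measurable_cst.
move=> _ B mB; apply: sub_sigma_algebra; apply: (@events_of1 _ _ _ _ v) => //.
by exists B.
Qed.

Lemma chain_sign_law E : process_sigma_algebra E ->
  P [set w | E (fun v => 0 < chain (U^~ w) v)] = P3 [set w | E (cluster_sign^~ w)].
Proof.
move=> HE.
pose E' : set (V -> R) := [set y | E (fun v => 0 < chain y v)].
have mE' : <<s events_of (coordinate_events R V) setT >> E'.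
  apply: (@process_event_measurable _ _ (g_sigma_algebraType (events_of (coordinate_events R V) setT))
    (fun v y => 0 < chain y v)) => // v.
  by apply: measurable_fun_ltr; [exact: measurable_cst|exact: measurable_chain].
have mX v : measurable_fun setT (chain_copy v).
  by apply: (@sub_measurable_measurable _ _ _ _ _ U setT); exact: measurable_chain_copy.
have mS v : measurable_fun setT (cluster_sign v).
  by apply: (@sub_measurable_measurable _ _ _ _ _ U setT); exact: measurable_cluster_sign.
have mI v : measurable_fun setT (resampled_input v).
  by apply: (@sub_measurable_measurable _ _ _ _ _ U setT); exact: measurable_resampled_input.
(* The original and the new innovations are both i.i.d. with law [mu], so they drive chains of the
   same law. *)
transitivity (P3 [set w | E' (resampled_input^~ w)]).
  apply: (eq_law_independent (P1 := P) (X1 := fun v => U v)) => //.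
    exact: resampled_input_independent.
  by move=> v B mB; rewrite [RHS]resampled_input_law// lawU.
have mX0 v : measurable (chain_copy v @^-1` [set 0]).
  by have := mX v measurableT [set 0] (measurable_set1 0); rewrite setTI.
have [mN N0] := @null_bigcup _ copies R P3 V _ mX0 chain_copy_null.
(* Off the countable union of zero events the positivity of the resampled value is exactly the
   cluster sign. *)
apply: (eq_measure_null _ _ mN N0) => //.
- apply: (@process_event_measurable _ _ _ (fun v w => 0 < chain (resampled_input^~ w) v)) => // v.
  apply: measurable_fun_ltr; first exact: measurable_cst.
  rewrite (_ : (fun w => _) = resampled_chain v); last by apply/funext => w; exact: resampled_chainE.
  apply: measurable_funM; first exact: measurableT_comp (@measurable_bsign R) (mS v).
  exact: measurableT_comp.
- exact: process_event_measurable.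
move=> w Nw; rewrite /E'/=.
rewrite (_ : (fun v => 0 < _) = cluster_sign^~ w)//; apply/funext => v.
rewrite resampled_chainE /resampled_chain.
have n0 : 0 < `|chain_copy v w|.
  by rewrite normr_gt0; apply/eqP => E0; apply: Nw; exists v.
by case: (cluster_sign v w); rewrite /bsign ?mul1r// mulN1r oppr_gt0 ltNge ltW.
Qed.

End resampled_chain.

(** * The random partition and its colours *)

Lemma size_undup_map (S A B : eqType) (f : S -> A) (g : S -> B) (s : seq S) :
  (forall i j, (f i == f j) = (g i == g j)) ->
  size (undup (map f s)) = size (undup (map g s)).
Proof.
move=> fg; elim: s => //= i s IH.
have -> : (f i \in map f s) = (g i \in map g s).
  by apply/mapP/mapP => -[j js /eqP E]; exists j => //; apply/eqP; rewrite ?fg// -fg.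
by case: ifP => //= _; rewrite IH.
Qed.

Lemma block_repP (S : countType) (r : rel S) i j : equivalence_rel r ->
  block_rep r i = j <-> r i j /\ (forall k, r i k -> (pickle j <= pickle k)%N).
Proof.
move=> er; pose Q j := r i j /\ (forall k, r i k -> (pickle j <= pickle k)%N).
have uniqQ j1 j2 : Q j1 -> Q j2 -> j1 = j2.
  move=> [r1 m1] [r2 m2]; apply: (pcan_inj pickleK); apply/eqP.
  by rewrite eqn_leq m1// m2.
have [j0 Qj0] : exists j, Q j.
  have ex : exists n, `[< exists j, r i j /\ pickle j = n >].
    by exists (pickle i); apply/asboolP; exists i; rewrite (er i i i).
  case: (ex_minnP ex) => n /asboolP[j0 [rj <-]] m; exists j0; split => // k rk.
  by apply: m; apply/asboolP; exists k.
have Qrep : Q (block_rep r i) by apply: (@xgetPex _ i Q); exists j0.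
by split => [<-//|Qj]; exact: uniqQ.
Qed.

(** * Fair coins on clusters *)

Section coins.
Context d (T : measurableType d) (R : realType) (P : probability T R).
Variables (V : countType) (U : V -> {RV P >-> R}).
Hypothesis indepU : mutually_independent P (fun v => g_sigma_algebra_preimage (U v)).
Hypothesis half : forall v, P [set w | 0 < U v w] = (2^-1)%:E.
Local Notation P3 := (copies_prob P).
Local Notation copies := (copies T).

Definition coin_free : set (V * option bool) := [set i | i.2 <> Some true].
Definition coin_only : set (V * option bool) := [set i | i.2 = Some true].

Lemma coin_event v : copied_events U (v, Some true) [set w | coin U v w].
Proof.
exists [set x | 0 < x]; last by rewrite setTI.
by rewrite -[X in measurable X]setTI; apply: measurable_fun_ltr.
Qed.

Lemma coin_half v : P3 [set w | coin U v w] = (2^-1)%:E.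
Proof.
rewrite -(half v); apply: (copies_copy P (Some true)).
by rewrite -[X in measurable X]setTI; apply: measurable_fun_ltr.
Qed.

Lemma coins_prob (s : seq V) :
  P3 [set w | forall v, v \in s -> coin U v w] = ((2^-1) ^+ size (undup s))%:E.
Proof.
pose r := [seq (v, Some true) | v <- undup s].
have ur : uniq r by rewrite map_inj_uniq ?undup_uniq// => v v' [].
have := copied_independent indepU (A := fun i => [set w | coin U i.1 w]) ur.
rewrite big_map => E.
rewrite (_ : [set w | _] = \bigcap_(i in [set` r]) [set w | coin U i.1 w]).
  rewrite E; last by move=> _ /mapP[v _ ->]; exact: coin_event.
  rewrite (eq_bigr (fun=> (2^-1)%:E)); last by move=> v _; exact: coin_half.
  elim: (undup s) => [|v l IH]; first by rewrite big_nil expr0.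
  by rewrite big_cons IH -EFinM -exprS.
apply/seteqP; split => [w h _ /mapP[v vs ->]|w h v vs] /=.
  by apply: h; rewrite -mem_undup.
by apply: (h (v, Some true)) => /=; apply/mapP; exists v => //; rewrite mem_undup.
Qed.

Let measurable_id_sub (S : set (V * option bool)) :
  measurable_fun setT (id : copies -> sub_copies U S).
Proof. exact: (@sub_measurable_measurable _ _ _ _ _ _ S _ (sub_copies U S) id (@measurable_id _ _ _)). Qed.

Let from_sub (S : set (V * option bool)) : {mfun copies >-> sub_copies U S} :=
  mfun_Sub (mem_set (@measurable_id_sub S)).

(** Labels and coins are read from separate coordinates, so that their independence can be expressed
    by a product measure. *)
Definition labelled_coins (r : V -> copies -> V) (s : seq V) :
    set (sub_copies U coin_free * sub_copies U coin_only) :=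
  [set q | forall v, v \in s -> coin U (r v q.1) q.2].

Lemma measurable_labelled_coins (r : V -> copies -> V) s :
  (forall v u, measurable ([set w | r v w = u] : set (sub_copies U coin_free))) ->
  measurable (labelled_coins r s).
Proof.
move=> mr.
rewrite (_ : labelled_coins r s = \bigcap_(v in [set` s]) \bigcup_u
  ([set w | r v w = u] `*` [set w | coin U u w])); last first.
  apply/seteqP; split => [q h v vs|q h v vs]; first by exists (r v q.1) => //; split => //; exact: h.
  by have [u _ [/= <-]] := h v vs.
apply: fin_bigcap_measurable => // v vs.
apply: countable_bigcupT_measurable => // u; apply: measurableX => //.
by apply: sub_sigma_algebra; apply: (events_of1 (i := (u, Some true))); [by []|exact: coin_event].
Qed.

(** Labels are independent of coins, so conditionally on them the probability is 2^(-n), n being the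
    number of distinct labels. *)
Lemma labelled_coins_prob (r : V -> copies -> V) (s : seq V) :
  (forall v u, measurable ([set w | r v w = u] : set (sub_copies U coin_free))) ->
  P3 [set w | forall v, v \in s -> coin U (r v w) w] =
  (\int[distribution P3 (from_sub coin_free)]_w
    ((2^-1) ^+ size (undup (map (fun v => r v w) s : seq V)))%:E)%E.
Proof.
move=> mr.
transitivity (\int[distribution P3 (from_sub coin_free)]_w
   distribution P3 (from_sub coin_only) (xsection (labelled_coins r s) w))%E.
  apply: (@slice_integral _ copies R P3 _ _ _ _ (distribution P3 (from_sub coin_only)) (from_sub coin_free) (from_sub coin_only)).
    exact: measurable_labelled_coins.
  move=> A B mA mB.
  apply: (sub_measurable_indep indepU (S1 := coin_free) (S2 := coin_only)) => //.
    exact: measurable_id.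
  exact: measurable_id.
apply: eq_integral => w _; rewrite -coins_prob.
congr (P3 _); apply/seteqP; split => q; rewrite /xsection/= inE /labelled_coins/= => h.
  by move=> _ /mapP[v vs ->]; exact: h.
by move=> v vs; apply: h; exact: map_f.
Qed.

(* Which index carries the coin of a block is irrelevant, as long as distinct
   blocks get distinct coins and the choice does not depend on the coins. *)
Lemma coin_relabel (r1 r2 : V -> copies -> V) E :
  (forall v u, measurable ([set w | r1 v w = u] : set (sub_copies U coin_free))) ->
  (forall v u, measurable ([set w | r2 v w = u] : set (sub_copies U coin_free))) ->
  (forall w i j, (r1 i w == r1 j w) = (r2 i w == r2 j w)) ->
  process_sigma_algebra E ->
  P3 [set w | E (fun v => coin U (r1 v w) w)] = P3 [set w | E (fun v => coin U (r2 v w) w)].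
Proof.
move=> m1 m2 r12 HE.
(* The events that finitely many given coordinates are true form a pi-system generating the process
   sigma-algebra. Their probability involves only the number of distinct labels, hence only the
   equality pattern. *)
pose G : set (set (V -> bool)) := [set A | exists s : seq V, A = [set y : V -> bool | forall v, v \in s -> y v]].
have mG (r : V -> copies -> V) : (forall v u, measurable ([set w | r v w = u] : set (sub_copies U coin_free))) ->
    forall A, G A -> measurable ((fun w v => coin U (r v w) w) @^-1` A).
  move=> mr _ [s ->].
  have mp : measurable_fun setT (fun w : copies => (from_sub coin_free w, from_sub coin_only w)).
    exact: measurable_fun_pair.
  by have := mp measurableT _ (measurable_labelled_coins s mr); rewrite setTI.
apply: (@eq_law R (V -> bool) G _ copies P3 _ copies P3 (fun w v => coin U (r1 v w) w) (fun w v => coin U (r2 v w) w)).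
- move=> _ _ [s1 ->] [s2 ->]; exists (s1 ++ s2); apply/seteqP; split => y /=.
    by move=> [h1 h2] v; rewrite mem_cat => /orP[/h1|/h2].
  by move=> h; split => v vs; apply: h; rewrite mem_cat vs ?orbT.
- by exists [::]; apply/seteqP; split.
- exact: mG.
- exact: mG.
- move=> _ [s ->]; rewrite [LHS](labelled_coins_prob s m1) [RHS](labelled_coins_prob s m2).
  by apply: eq_integral => w _; congr (_ ^+ _)%:E; apply: size_undup_map; exact: r12.
- move: E HE; apply: smallest_sub; first exact: smallest_sigma_algebra.
  move=> _ [i ->]; apply: sub_sigma_algebra; exists [:: i]; apply/seteqP; split => y /=.
    by move=> yi v; rewrite inE => /eqP ->.
  by apply; rewrite inE.
Qed.

Variable top : V -> copies -> V.
Hypothesis mtop : forall v u, measurable ([set w | top v w = u] : set (sub_copies U coin_free)).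

Definition same_top (w : copies) : rel V := fun i j => top i w == top j w.

Lemma same_top_equivalence w : equivalence_rel (same_top w).
Proof. by move=> i j k; rewrite /same_top eqxx; split => // /eqP ->. Qed.

Lemma measurable_same_top i j : measurable ([set w | same_top w i j] : set (sub_copies U coin_free)).
Proof.
rewrite (_ : [set w | _] = \bigcup_u ([set w | top i w = u] `&` [set w | top j w = u])).
  by apply: countable_bigcupT_measurable => // u; exact: measurableI.
apply/seteqP; split => [w /eqP E|w [u _ [/= <- /eqP]]]; last by rewrite eq_sym.
by exists (top i w) => //; split => //=; rewrite E.
Qed.

Lemma measurable_block_rep i j :
  measurable ([set w | block_rep (same_top w) i = j] : set (sub_copies U coin_free)).
Proof.
rewrite (_ : [set w | _] = [set w | same_top w i j] `&`
    \bigcap_(k in [set k | ~~ (pickle j <= pickle k)%N]) ~` [set w | same_top w i k]).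
  apply: measurableI; first exact: measurable_same_top.
  rewrite -[X in measurable X]setCK setC_bigcap; apply: measurableC.
  rewrite bigcup_mkcond; apply: countable_bigcupT_measurable => // k.
  by case: ifP => // _; rewrite setCK; exact: measurable_same_top.
apply/seteqP; split => w /=; rewrite (block_repP _ _ (same_top_equivalence w)).
  by move=> [rij m]; split => // k /negP jk rik; apply: jk; exact: m.
move=> [rij m]; split => // k rik; apply: contrapT => /negP jk; exact: (m k jk).
Qed.

Lemma coin_block_rep E : process_sigma_algebra E ->
  P3 [set w | E (fun v => coin U (top v w) w)] =
  P3 [set w | E (fun v => coin U (block_rep (same_top w) v) w)].
Proof.
move=> HE; apply: coin_relabel HE => // [v u|w i j]; first exact: measurable_block_rep.
have er := same_top_equivalence w.
have [rii mi] := (block_repP i _ er).1 erefl; have [rjj mj] := (block_repP j _ er).1 erefl.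
apply/idP/eqP => [tij|E'].
  apply/(block_repP _ _ er); split.
    by move: rjj tij; rewrite /same_top => /eqP <-.
  by move=> k rik; apply: mj; move: rik tij; rewrite /same_top => /eqP <- /eqP ->.
by move: rii rjj; rewrite E' /same_top => /eqP -> /eqP ->.
Qed.

(** The partition is measurable with respect to the first two copies and the coins with respect to
    the third. An index list therefore splits into a [coin_free] event and a finite intersection of
    independent coin events. *)
Lemma partition_coins_independent :
  mutually_independent P3 (fun o : option V =>
    if o is Some i then g_sigma_algebra_preimage (coin U i)
    else partition_sigma_algebra same_top).
Proof.
move=> s A us HA.
pose A0 := if None \in s then A None else setT.
pose l := pmap id s.
have ls : map Some l = [seq o <- s | isSome o] by apply: pmap_filter => -[].
have mem_l v : (v \in l) = (Some v \in s).
  by rewrite -(mem_map (@Some_inj _)) ls mem_filter.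
have ul : uniq l by rewrite -(map_inj_uniq (@Some_inj _)) ls filter_uniq.
have -> : \bigcap_(o in [set` s]) A o = A0 `&` \bigcap_(v in [set` l]) A (Some v).
  apply/seteqP; split => [w h|w [h1 h2] [v|] os].
  - split => [|v /=]; first by rewrite /A0; case: ifP => // /h.
    by rewrite mem_l => /h.
  - by apply: h2; rewrite /= mem_l.
  - by move: h1; rewrite /A0 (os : None \in s).
have HA0 : <<s events_of (copied_events U) coin_free >> A0.
  rewrite /A0; case: ifP => [/HA|_]; last exact: (@measurableT _ (sub_copies U coin_free)).
  apply: smallest_sub; first exact: smallest_sigma_algebra.
  by move=> _ [i [j ->]]; exact: measurable_same_top.
pose B (i : V * option bool) := A (Some i.1).
pose l' := [seq (v, Some true) | v <- l].
have ul' : uniq l' by rewrite map_inj_uniq// => v v' [].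
have HB i : i \in l' -> coin_only i /\ copied_events U i (B i).
  move=> /mapP[v vl ->]; split => //; rewrite /B/=.
  have [C mC <-] : g_sigma_algebra_preimage (coin U v) (A (Some v)) by apply: (HA (Some v)); rewrite -mem_l.
  exists ((fun x : R => 0 < x) @^-1` C); last by [].
  by rewrite -[X in measurable X]setTI; apply: measurable_fun_ltr.
have -> : \bigcap_(v in [set` l]) A (Some v) = \bigcap_(i in [set` l']) B i.
  apply/seteqP; split => [w h _ /mapP[v vl ->]|w h v vl]; first exact: h.
  by apply: (h (v, Some true)); apply/mapP; exists v.
rewrite (@events_of_indep _ copies R P3 _ (copied_events U) _ _ _ coin_free coin_only)//; last first.
- apply: sub_sigma_algebra; exists l', B; split => //.
- exact: copied_independent.
- by move=> i; apply: preimage_sigma_measurable; exact: measurable_copied.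
- by move=> i; exact: preimage_sigma_I.
- by move=> i; exact: preimage_sigma_T.
rewrite (copied_independent indepU ul'); last by move=> i /HB[].
rewrite [RHS](bigID (fun o => o == None))/=; congr (_ * _)%E.
  rewrite /A0; case: ifP => Ns; first by rewrite -big_filter (filter_pred1_uniq us Ns) big_seq1.
  rewrite big1_seq ?probability_setT// => o /andP[/eqP -> os].
  by rewrite os in Ns.
rewrite big_map -(big_map Some xpredT (fun o => P3 (A o))) ls big_filter.
by apply: eq_bigl => -[].
Qed.

End coins.

Theorem proposition3p3 (R : realType) (alpha a : R)
  (halpha : 0 < alpha < 2) (ha : 0 < a < 1)
  (V : countType) (e : rel V) (rho : V) (hT : is_tree e)
  (d : measure_display) (T : measurableType d) (P : probability T R)
  (X : V -> {RV P >-> R}) (hX : is_stable_chain P alpha a e rho X) :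
  is_color_process P (fun v w => 0 < X v w).
Proof.
split; first by move=> v; apply: measurable_fun_ltr.
have [U [Urho Ustable indepU chainU]] := hX.
have [par [dep Hpar]] := tree_parent rho hT.
have depP v : v != rho -> (dep (par v) < dep v)%N by move=> /Hpar[].
have [a0 a1] := andP ha.
pose c := (1 - a `^ alpha) `^ alpha^-1.
have al0 : 0 < alpha by case/andP: halpha.
have c0 : 0 < c.
  apply: powR_gt0; rewrite subr_gt0.
  have -> : 1 = 1 `^ alpha by rewrite powR1.
  by rewrite gt0_ltr_powR// ?nnegrE ltW.
pose mu : probability R R := distribution P (U rho).
pose g := stable_density alpha.
have g0 : forall x, 0 <= g x := stable_density_ge0 halpha.
have gN : forall x, g (- x) = g x := @stable_densityN _ alpha.
have gle : forall x y, 0 <= x -> x <= y -> g y <= g x := stable_density_le halpha.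
have mg : measurable_fun setT g := measurable_stable_density halpha.
have muE : forall A, measurable A -> mu A = (\int[lebesgue_measure]_(x in A) (g x)%:E)%E.
  by move=> A mA; apply: stable_distributionE => //; exact: Ustable.
(* The law is determined by its characteristic function, so all innovations share the density [g]
   and hence the law [mu]. *)
have lawU v A : measurable A -> P (U v @^-1` A) = mu A.
  move=> mA; rewrite muE//; exact: (stable_distributionE halpha (Ustable v) mA).
have XE v w : X v w = chain rho par dep a c (U^~ w) v.
  move: v; apply: (tree_ind depP) => v IH; rewrite (chainE depP) /coef.
  case: eqVneq IH => [-> _|vr /(_ isT) <-]; first by rewrite -Urho add0r mul1r.
  by have [/chainU -> _] := Hpar v vr.
have half v : P [set w | 0 < U v w] = (2^-1)%:E.
  rewrite -(unimodal_gt0 mg g0 gN muE) -(lawU v)//.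
  by rewrite -[X in measurable X]setTI; apply: measurable_fun_ltr.
pose tp := top rho par dep a c mu g U.
have mtop v u : measurable ([set w | tp v w = u] : set (sub_copies U (coin_free (V := V)))).
  by apply: measurable_top => // k u' /eqP kt _; exact: kt.
have mcoin v : measurable_fun setT (coin U v).
  by apply: measurable_fun_ltr; [exact: measurable_cst|exact: measurable_copied].
(* The parameter is 1/2 because a coin is the sign of a symmetric atomless variable. *)
exists 2^-1, _, (copies T), (copies_prob P), (same_top tp), (fun v => mfun_Sub (mem_set (mcoin v))).
split.
- by rewrite invr_ge0 ler0n/= invf_le1// ler1n.
- split; first exact: same_top_equivalence.
  move=> i j; apply: (sigma_events_of_measurable _ (measurable_same_top mtop i j)).
  by move=> k; apply: preimage_sigma_measurable; exact: measurable_copied.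
- move=> v; apply/funext; apply: eq_bernoulliV2.
  pose M : probability bool R := distribution (copies_prob P) (mfun_Sub (mem_set (mcoin v))).
  have M1 : M [set true] = (2^-1)%:E by exact: coin_half.
  have M0 : M [set false] = (2^-1)%:E.
    rewrite (_ : [set false] = ~` [set true]); last by apply/seteqP; split => -[] //= h; exfalso; apply: h.
    by rewrite probability_setC// M1 -EFinB; congr _%:E; field.
  exact: etrans M1 (esym M0).
- exact: (partition_coins_independent indepU mtop).
move=> E HE.
rewrite (_ : [set w | _] = [set w | E (fun v => 0 < chain rho par dep a c (U^~ w) v)]); last first.
  by apply/seteqP; split => w /=; rewrite (_ : (fun v => _) = (fun v => 0 < chain rho par dep a c (U^~ w) v))//;
    apply/funext => v; rewrite XE.
rewrite (chain_sign_law depP a0 c0 mg g0 gN gle muE indepU lawU HE).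
exact: (coin_block_rep indepU half mtop HE).
Qed.
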